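(* Every $L_3(\mathrm{ac})$-formula $\theta(x,y,z)$, where $x$ is an $l$-tuple of distinct f-variables, $y$ an $m$-tuple of distinct r-variables and $z$ an $n$-tuple of distinct v-variables, is $T$-equivalent to some special $L_3(\mathrm{ac})$-formula $\theta^*(x,y,z)$.
   Context: All differential fields have characteristic $0$ with a single derivation; $f^\dagger:=f'/f$. A valued differential field with valuation $v$ and valuation ring $\mathcal{O}$ is monotone if $v(f')\ge v(f)$ for $f\ne0$, and differential-henselian if every $P\in\mathcal{O}\{Y\}$ whose coefficientwise reduction to the residue field has total degree $1$ has a zero in $\mathcal{O}$. $T$ is the theory of structures $(K,\mathbf{k},\Gamma;\pi,v,c,\mathrm{ac})$ where: $K,\mathbf{k}$ are differential fields, $\Gamma$ an ordered abelian group, $v:K^\times\to\Gamma$ a surjective valuation making $K$ a monotone, differential-henselian valued differential field with valuation ring $\mathcal{O}$; $\pi:\mathcal{O}\to\mathbf{k}$ a surjective differential ring morphism; $c:\Gamma\to\mathbf{k}$ additive with: for all $\gamma$ some $x\in K^\times$ has $v(x)=\gamma$, $\pi(x^\dagger)=c(\gamma)$; and $\mathrm{ac}:K\to\mathbf{k}$ an angular component map: $\mathrm{ac}(0)=0$, $\mathrm{ac}|_{K^\times}:K^\times\to\mathbf{k}^\times$ is a multiplicative morphism with $\mathrm{ac}(a)=\pi(a)$ if $v(a)=0$, $\mathrm{ac}(a^\dagger)=\mathrm{ac}(a)^\dagger+c(v(a))$ if $v(a')=v(a)$, and $\mathrm{ac}(d)^\dagger=-c(v(d))$ for nonzero constants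 $d$ of $K$. The language $L_3(\mathrm{ac})$ has sorts f, r, v, the differential ring language $\{0,1,-,+,\cdot,\partial\}$ on f and on r, $\{\le,0,-,+\}$ on v, and unary function symbols $\pi$ (f to r), $v$ (f to v), $c$ (v to r), $\mathrm{ac}$ (f to r), with a default value $\infty$ added to the r- and v-sorts ($\pi(x)=\infty$ iff $x\notin\mathcal{O}$, $v(0)=\infty$). $L_{\mathrm{rv}}$ is the two-sorted sublanguage consisting of the r- and v-parts together with $c$. An $L_3(\mathrm{ac})$-formula $\phi(x,y,z)$ is special if it has the form $\psi\big(\mathrm{ac}(P_1(x)),\dots,\mathrm{ac}(P_p(x)),v(Q_1(x)),\dots,v(Q_q(x)),y,z\big)$ for some $L_{\mathrm{rv}}$-formula $\psi(u_1,\dots,u_p,w_1,\dots,w_q,y,z)$, with $u_i$ extra r-variables and $w_j$ extra v-variables, and differential polynomials $P_1,\dots,P_p,Q_1,\dots,Q_q\in\mathbb{Q}\{x\}$ all of whose coefficients lie in $\mathbb{Z}$. *)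

(* Defs.v *)
From HB Require Import structures.
From mathcomp Require Import all_boot all_order all_algebra finmap.
From mathcomp.multinomials Require Import monalg.

Set Implicit Arguments.
Unset Strict Implicit.
Unset Printing Implicit Defensive.

Import Order.TTheory GRing.Theory Num.Theory.
Local Open Scope ring_scope.

Record diffField := DiffField {
  dfield :> fieldType;
  der : dfield -> dfield;
  derD : forall a b, der (a + b) = der a + der b;
  derM : forall a b, der (a * b) = der a * b + a * der b;
  dfield_char0 : [pchar dfield] =i pred0
}.

Arguments der {d} _.

Definition logder (K : diffField) (a : K) : K := der a / a.

(** The ring R{Y_i : i in I} of differential polynomials: the indeterminate
    (i, j) stands for the j-th derivative of Y_i. *)
Notation dpoly R I := {malg R[{cmonom (I * nat)%type}]}.

(** f embeds the coefficients into K. *)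
Definition dpoly_eval (R : zmodType) (I : choiceType) (K : diffField)
    (f : R -> K) (P : dpoly R I) (a : I -> K) : K :=
  mmap f (fun m : {cmonom (I * nat)%type} =>
    \prod_(ij <- finsupp m) iter ij.2 der (a ij.1) ^+ m ij) P.

(** [None] is the default value oo of the sorts r and v. *)
Definition oadd (V : nmodType) (a b : option V) : option V :=
  if (a, b) is (Some a', Some b') then Some (a' + b') else None.

Definition omul (V : pzSemiRingType) (a b : option V) : option V :=
  if (a, b) is (Some a', Some b') then Some (a' * b') else None.

Definition ole (G : porderZmodType) (a b : option G) : bool :=
  match a, b with
  | _, None => true
  | None, Some _ => false
  | Some a', Some b' => a' <= b'
  end.

Definition omin (G : porderZmodType) (a b : option G) : option G :=
  if ole a b then a else b.

Record structure := Structure {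
  fsort : diffField;
  rsort : diffField;
  vsort : porderZmodType;
  residue : fsort -> option rsort;
  valuation : fsort -> option vsort;
  cmap : vsort -> rsort;
  ac : fsort -> rsort
}.

Arguments residue {s} _.
Arguments valuation {s} _.
Arguments cmap {s} _.
Arguments ac {s} _.

Definition ordered_group (G : porderZmodType) : Prop :=
  total (<=%R : rel G) /\ (forall a b c : G, a <= b -> c + a <= c + b).

Section Models.

Variable M : structure.
Local Notation K := (fsort M).
Local Notation k := (rsort M).
Local Notation G := (vsort M).

Definition valuation_axiom : Prop :=
  [/\ forall a : K, valuation a = None <-> a = 0,
      forall a b : K, valuation (a * b) = oadd (valuation a) (valuation b),
      forall a b : K,
        ole (omin (valuation a) (valuation b)) (valuation (a + b)) &
      forall g : G, exists a : K, valuation a = Some g].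

Definition in_O (a : K) : bool := ole (Some 0) (valuation a).

Definition monotone_axiom : Prop :=
  forall a : K, a != 0 -> ole (valuation a) (valuation (der a)).

Definition residue_axiom : Prop :=
  [/\ forall a : K, residue a = None <-> ~~ in_O a,
      residue (1 : K) = Some 1,
      forall a b : K, in_O a -> in_O b ->
        residue (a + b) = oadd (residue a) (residue b),
      forall a b : K, in_O a -> in_O b ->
        residue (a * b) = omul (residue a) (residue b) &
      forall a : K, in_O a -> residue (der a) = omap der (residue a)]
  /\ (forall u : k, exists a : K, residue a = Some u).

(** Coefficientwise reduction O{Y} -> k{Y}: the residue field of O is
    identified with k by means of [residue], whose kernel is the maximal ideal. *)
Definition dpoly_red (P : dpoly K unit) : dpoly k unit :=
  \sum_(m <- msupp P) << odflt 0 (residue P@_m) *g m >>.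

(** [msize] is the total degree plus one, and 0 for the zero polynomial. *)
Definition dhenselian_axiom : Prop :=
  forall P : dpoly K unit,
    (forall m, in_O P@_m) -> msize (dpoly_red P) = 2%N ->
    exists2 a : K, in_O a & dpoly_eval id P (fun=> a) = 0.

Definition cmap_axiom : Prop :=
  (forall g h : G, cmap (g + h) = cmap g + cmap h) /\
  (forall g : G, exists a : K,
     [/\ a != 0, valuation a = Some g & residue (logder a) = Some (cmap g)]).

Definition ac_axiom : Prop :=
  [/\ ac (0 : K) = 0,
      forall a : K, a != 0 -> ac a != 0 &
      forall a b : K, a != 0 -> b != 0 -> ac (a * b) = ac a * ac b] /\
  [/\ forall a : K, valuation a = Some 0 -> residue a = Some (ac a),
      forall (a : K) (g : G),
        valuation a = Some g -> valuation (der a) = Some g ->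
        ac (logder a) = logder (ac a) + cmap g &
      forall (d : K) (g : G), valuation d = Some g -> der d = 0 ->
        logder (ac d) = - cmap g].

Record is_model : Prop := IsModel {
  model_ordered_group : ordered_group G;
  model_valuation : valuation_axiom;
  model_monotone : monotone_axiom;
  model_residue : residue_axiom;
  model_dhenselian : dhenselian_axiom;
  model_cmap : cmap_axiom;
  model_ac : ac_axiom
}.

End Models.

(** Well-scoped syntax: [l], [m], [n] count the free f-, r- and v-variables. *)
Inductive fterm (l : nat) : Type :=
  | FVar of 'I_l
  | FZero
  | FOne
  | FOpp of fterm l
  | FAdd of fterm l & fterm l
  | FMul of fterm l & fterm l
  | FDer of fterm l.

Inductive vterm (l n : nat) : Type :=
  | VVar of 'I_n
  | VZero
  | VOpp of vterm l n
  | VAdd of vterm l n & vterm l n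
  | VVal of fterm l.

Inductive rterm (l m n : nat) : Type :=
  | RVar of 'I_m
  | RZero
  | ROne
  | ROpp of rterm l m n
  | RAdd of rterm l m n & rterm l m n
  | RMul of rterm l m n & rterm l m n
  | RDer of rterm l m n
  | RRes of fterm l
  | RCmap of vterm l n
  | RAc of fterm l.

(** A quantifier of a given sort binds variable 0 of that sort and shifts the
    others of that sort by one. *)
Inductive formula : nat -> nat -> nat -> Type :=
  | Top l m n : formula l m n
  | Bot l m n : formula l m n
  | EqF l m n : fterm l -> fterm l -> formula l m n
  | EqR l m n : rterm l m n -> rterm l m n -> formula l m n
  | EqV l m n : vterm l n -> vterm l n -> formula l m n
  | LeV l m n : vterm l n -> vterm l n -> formula l m n
  | Neg l m n : formula l m n -> formula l m n
  | And l m n : formula l m n -> formula l m n -> formula l m n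
  | Or l m n : formula l m n -> formula l m n -> formula l m n
  | ExF l m n : formula l.+1 m n -> formula l m n
  | ExR l m n : formula l m.+1 n -> formula l m n
  | ExV l m n : formula l m n.+1 -> formula l m n
  | AllF l m n : formula l.+1 m n -> formula l m n
  | AllR l m n : formula l m.+1 n -> formula l m n
  | AllV l m n : formula l m n.+1 -> formula l m n.

Arguments FZero {l}.
Arguments FOne {l}.
Arguments VZero {l n}.
Arguments VVar {l n} _.
Arguments VVal {l n} _.
Arguments RZero {l m n}.
Arguments ROne {l m n}.
Arguments RVar {l m n} _.
Arguments RRes {l m n} _.
Arguments RCmap {l m n} _.
Arguments RAc {l m n} _.
Arguments Top {l m n}.
Arguments Bot {l m n}.
Arguments EqF {l m n} _ _.

Definition scons (A : Type) (n : nat) (a : A) (e : 'I_n -> A) : 'I_n.+1 -> A :=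
  fun i => oapp e a (unlift ord0 i).

Section Semantics.

Variable M : structure.

Fixpoint feval l (x : 'I_l -> fsort M) (t : fterm l) : fsort M :=
  match t with
  | FVar i => x i
  | FZero => 0
  | FOne => 1
  | FOpp t => - feval x t
  | FAdd t u => feval x t + feval x u
  | FMul t u => feval x t * feval x u
  | FDer t => der (feval x t)
  end.

Fixpoint veval l n (x : 'I_l -> fsort M) (z : 'I_n -> option (vsort M))
    (t : vterm l n) : option (vsort M) :=
  match t with
  | VVar i => z i
  | VZero => Some 0
  | VOpp t => omap -%R (veval x z t)
  | VAdd t u => oadd (veval x z t) (veval x z u)
  | VVal t => valuation (feval x t)
  end.

Fixpoint reval l m n (x : 'I_l -> fsort M) (y : 'I_m -> option (rsort M))
    (z : 'I_n -> option (vsort M)) (t : rterm l m n) : option (rsort M) :=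
  match t with
  | RVar i => y i
  | RZero => Some 0
  | ROne => Some 1
  | ROpp t => omap -%R (reval x y z t)
  | RAdd t u => oadd (reval x y z t) (reval x y z u)
  | RMul t u => omul (reval x y z t) (reval x y z u)
  | RDer t => omap der (reval x y z t)
  | RRes t => residue (feval x t)
  | RCmap t => omap cmap (veval x z t)
  | RAc t => Some (ac (feval x t))
  end.

Fixpoint holds l m n (phi : formula l m n) :
    ('I_l -> fsort M) -> ('I_m -> option (rsort M)) ->
    ('I_n -> option (vsort M)) -> Prop :=
  match phi with
  | Top _ _ _ => fun _ _ _ => True
  | Bot _ _ _ => fun _ _ _ => False
  | EqF _ _ _ t u => fun x _ _ => feval x t = feval x u
  | EqR _ _ _ t u => fun x y z => reval x y z t = reval x y z u
  | EqV _ _ _ t u => fun x _ z => veval x z t = veval x z u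
  | LeV _ _ _ t u => fun x _ z => ole (veval x z t) (veval x z u)
  | Neg _ _ _ p => fun x y z => ~ holds p x y z
  | And _ _ _ p q => fun x y z => holds p x y z /\ holds q x y z
  | Or _ _ _ p q => fun x y z => holds p x y z \/ holds q x y z
  | ExF _ _ _ p => fun x y z => exists a, holds p (scons a x) y z
  | ExR _ _ _ p => fun x y z => exists a, holds p x (scons a y) z
  | ExV _ _ _ p => fun x y z => exists a, holds p x y (scons a z)
  | AllF _ _ _ p => fun x y z => forall a, holds p (scons a x) y z
  | AllR _ _ _ p => fun x y z => forall a, holds p x (scons a y) z
  | AllV _ _ _ p => fun x y z => forall a, holds p x y (scons a z)
  end.

End Semantics.

Definition T_equivalent l m n (phi psi : formula l m n) : Prop :=
  forall M : structure, is_model M ->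
  forall (x : 'I_l -> fsort M) (y : 'I_m -> option (rsort M))
         (z : 'I_n -> option (vsort M)),
    holds phi x y z <-> holds psi x y z.

Fixpoint fsubst l l' (sf : 'I_l -> fterm l') (t : fterm l) : fterm l' :=
  match t with
  | FVar i => sf i
  | FZero => FZero
  | FOne => FOne
  | FOpp t => FOpp (fsubst sf t)
  | FAdd t u => FAdd (fsubst sf t) (fsubst sf u)
  | FMul t u => FMul (fsubst sf t) (fsubst sf u)
  | FDer t => FDer (fsubst sf t)
  end.

Fixpoint vsubst l n l' n' (sf : 'I_l -> fterm l') (sv : 'I_n -> vterm l' n')
    (t : vterm l n) : vterm l' n' :=
  match t with
  | VVar i => sv i
  | VZero => VZero
  | VOpp t => VOpp (vsubst sf sv t)
  | VAdd t u => VAdd (vsubst sf sv t) (vsubst sf sv u)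
  | VVal t => VVal (fsubst sf t)
  end.

Fixpoint rsubst l m n l' m' n' (sf : 'I_l -> fterm l')
    (sr : 'I_m -> rterm l' m' n') (sv : 'I_n -> vterm l' n')
    (t : rterm l m n) : rterm l' m' n' :=
  match t with
  | RVar i => sr i
  | RZero => RZero
  | ROne => ROne
  | ROpp t => ROpp (rsubst sf sr sv t)
  | RAdd t u => RAdd (rsubst sf sr sv t) (rsubst sf sr sv u)
  | RMul t u => RMul (rsubst sf sr sv t) (rsubst sf sr sv u)
  | RDer t => RDer (rsubst sf sr sv t)
  | RRes t => RRes (fsubst sf t)
  | RCmap t => RCmap (vsubst sf sv t)
  | RAc t => RAc (fsubst sf t)
  end.

(** [f]/[r]/[v] prefix: sort of the terms; suffix: sort of the new variable. *)
Definition fshiftF l (t : fterm l) : fterm l.+1 :=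
  fsubst (fun i => FVar (lift ord0 i)) t.
Definition vshiftF l n (t : vterm l n) : vterm l.+1 n :=
  vsubst (fun i => FVar (lift ord0 i)) VVar t.
Definition vshiftV l n (t : vterm l n) : vterm l n.+1 :=
  vsubst (@FVar l) (fun i => VVar (lift ord0 i)) t.
Definition rshiftF l m n (t : rterm l m n) : rterm l.+1 m n :=
  rsubst (fun i => FVar (lift ord0 i)) RVar VVar t.
Definition rshiftR l m n (t : rterm l m n) : rterm l m.+1 n :=
  rsubst (@FVar l) (fun i => RVar (lift ord0 i)) VVar t.
Definition rshiftV l m n (t : rterm l m n) : rterm l m n.+1 :=
  rsubst (@FVar l) RVar (fun i => VVar (lift ord0 i)) t.

(** Simultaneous capture-avoiding substitution of terms for all variables. *)
Fixpoint subst l m n (phi : formula l m n) : forall l' m' n',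
    ('I_l -> fterm l') -> ('I_m -> rterm l' m' n') -> ('I_n -> vterm l' n') ->
    formula l' m' n' :=
  match phi with
  | Top _ _ _ => fun _ _ _ _ _ _ => Top
  | Bot _ _ _ => fun _ _ _ _ _ _ => Bot
  | EqF _ _ _ t u => fun _ _ _ sf _ _ => EqF (fsubst sf t) (fsubst sf u)
  | EqR _ _ _ t u => fun _ _ _ sf sr sv =>
      EqR (rsubst sf sr sv t) (rsubst sf sr sv u)
  | EqV _ _ _ t u => fun _ m' _ sf _ sv =>
      EqV m' (vsubst sf sv t) (vsubst sf sv u)
  | LeV _ _ _ t u => fun _ m' _ sf _ sv =>
      LeV m' (vsubst sf sv t) (vsubst sf sv u)
  | Neg _ _ _ p => fun _ _ _ sf sr sv => Neg (subst p sf sr sv)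
  | And _ _ _ p q => fun _ _ _ sf sr sv =>
      And (subst p sf sr sv) (subst q sf sr sv)
  | Or _ _ _ p q => fun _ _ _ sf sr sv =>
      Or (subst p sf sr sv) (subst q sf sr sv)
  | ExF _ _ _ p => fun _ _ _ sf sr sv =>
      ExF (subst p (scons (FVar ord0) (fun i => fshiftF (sf i)))
                   (fun i => rshiftF (sr i)) (fun i => vshiftF (sv i)))
  | ExR _ _ _ p => fun _ _ _ sf sr sv =>
      ExR (subst p sf (scons (RVar ord0) (fun i => rshiftR (sr i))) sv)
  | ExV _ _ _ p => fun _ _ _ sf sr sv =>
      ExV (subst p sf (fun i => rshiftV (sr i))
                   (scons (VVar ord0) (fun i => vshiftV (sv i))))
  | AllF _ _ _ p => fun _ _ _ sf sr sv =>
      AllF (subst p (scons (FVar ord0) (fun i => fshiftF (sf i)))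
                    (fun i => rshiftF (sr i)) (fun i => vshiftF (sv i)))
  | AllR _ _ _ p => fun _ _ _ sf sr sv =>
      AllR (subst p sf (scons (RVar ord0) (fun i => rshiftR (sr i))) sv)
  | AllV _ _ _ p => fun _ _ _ sf sr sv =>
      AllV (subst p sf (fun i => rshiftV (sr i))
                    (scons (VVar ord0) (fun i => vshiftV (sv i))))
  end.

Fixpoint vterm_rv l n (t : vterm l n) : bool :=
  match t with
  | VVar _ | VZero => true
  | VOpp t => vterm_rv t
  | VAdd t u => vterm_rv t && vterm_rv u
  | VVal _ => false
  end.

Fixpoint rterm_rv l m n (t : rterm l m n) : bool :=
  match t with
  | RVar _ | RZero | ROne => true
  | ROpp t | RDer t => rterm_rv t
  | RAdd t u | RMul t u => rterm_rv t && rterm_rv u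
  | RCmap t => vterm_rv t
  | RRes _ | RAc _ => false
  end.

(** Membership in the two-sorted sublanguage L_rv. *)
Fixpoint formula_rv l m n (phi : formula l m n) : bool :=
  match phi with
  | Top _ _ _ | Bot _ _ _ => true
  | EqF _ _ _ _ _ => false
  | EqR _ _ _ t u => rterm_rv t && rterm_rv u
  | EqV _ _ _ t u | LeV _ _ _ t u => vterm_rv t && vterm_rv u
  | Neg _ _ _ p => formula_rv p
  | And _ _ _ p q | Or _ _ _ p q => formula_rv p && formula_rv q
  | ExF _ _ _ _ | AllF _ _ _ _ => false
  | ExR _ _ _ p | AllR _ _ _ p => formula_rv p
  | ExV _ _ _ p | AllV _ _ _ p => formula_rv p
  end.

(** A term that evaluates to P(x), for P in Z{x_0, ..., x_(l-1)}. *)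
Definition fterm_nat l (k : nat) : fterm l := iter k (FAdd FOne) FZero.

Definition fterm_int l (a : int) : fterm l :=
  match a with Posz k => fterm_nat l k | Negz k => FOpp (fterm_nat l k.+1) end.

Definition fterm_mon l (mu : {cmonom ('I_l * nat)%type}) : fterm l :=
  foldr (fun ij t => FMul (iter (mu ij) (FMul (iter ij.2 (@FDer l) (FVar ij.1)))
                                FOne) t)
        FOne (finsupp mu).

Definition fterm_dpoly l (P : dpoly int 'I_l) : fterm l :=
  foldr (fun mu t => FAdd (FMul (fterm_int l P@_mu) (fterm_mon mu)) t)
        FZero (msupp P).

Lemma feval_dpoly (M : structure) l (P : dpoly int 'I_l) (x : 'I_l -> fsort M) :
  feval x (fterm_dpoly P) = dpoly_eval intr P x.
Proof.
have natE j : feval x (fterm_nat l j) = j%:R.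
  by elim: j => //= j ->; rewrite -natr1 addrC.
have intE a : feval x (fterm_int l a) = a%:~R.
  by case: a => j; [exact: natE | rewrite NegzE mulrNz -pmulrn -natE].
have monE mu : feval x (fterm_mon mu) =
    \prod_(ij <- finsupp mu) iter ij.2 der (x ij.1) ^+ mu ij.
  rewrite /fterm_mon; elim: (finsupp mu : seq _) => [|ij s IH] /=.
    by rewrite big_nil.
  rewrite big_cons IH; congr (_ * _).
  elim: (mu ij) => //= j ->; rewrite exprS; congr (_ * _).
  by elim: ij.2 => //= i ->.
rewrite /fterm_dpoly /dpoly_eval /mmap.
elim: (msupp P : seq _) => [|mu s IH] /=; first by rewrite big_nil.
by rewrite big_cons IH intE monE.
Qed.

(** psi(ac(P_1(x)), ..., ac(P_p(x)), v(Q_1(x)), ..., v(Q_q(x)), y, z) with psi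
    an L_rv-formula in the r-variables u, y and the v-variables w, z.  A
    polynomial in Q{x} with coefficients in Z is given as an element of Z{x}. *)
Definition special l m n (theta : formula l m n) : Prop :=
  exists (p q : nat) (psi : formula 0 (p + m) (q + n))
         (P : 'I_p -> dpoly int 'I_l) (Q : 'I_q -> dpoly int 'I_l),
    formula_rv psi /\
    theta = subst psi
      (fun i : 'I_0 => False_rect (fterm l) (notF (ltn_ord i)))
      (fun i : 'I_(p + m) => match split i with
                             | inl j => RAc (fterm_dpoly (P j))
                             | inr j => RVar j
                             end)
      (fun i : 'I_(q + n) => match split i with
                             | inl j => VVal (fterm_dpoly (Q j))
                             | inr j => VVar j
                             end).

(* Main.v *)
From HB Require Import structures.
From mathcomp Require Import all_boot all_order all_algebra finmap.
From mathcomp Require Import boolp classical_sets filter.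
From mathcomp.multinomials Require Import monalg mpoly.
From mathcomp Require Import ring.
Require Import Defs.

Set Implicit Arguments.
Unset Strict Implicit.
Unset Printing Implicit Defensive.

Import Order.TTheory GRing.Theory Num.Theory.
Local Open Scope ring_scope.

(* By induction on formulas it suffices to eliminate a quantifier over the field
   sort in front of an L_rv-formula in y, z and the terms ac(t(x)), v(t(x)).  If this
   is impossible, compactness yields two ultraproducts M, N of models with tuples
   x, y, z and x', y', z' satisfying the same such formulas, and a in M for which no
   a' in N gives the same formulas for a, x, y, z and a', x', y', z'.  Ultraproducts
   over the natural numbers are countably saturated: equality of types extends to
   an isomorphism between countable parts of the residue fields and value groups
   of M and N, and countable nests of balls in N have a common point.

   Take a countable subfield S of M containing x and a, closed under the derivation
   and under zeros of henselian polynomials.  A maximal embedding of a differential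
   subring of S into N that extends x -> x' and respects v and ac is defined on all
   of S.  Its domain represents first all residues of S, where differential
   henselianity provides images, then all values of S, where the axioms on c and ac
   match the logarithmic derivatives of the representatives.  Then S is immediate
   over the domain.  A point a of S lies in a nest of balls with centers in the
   domain.  Either every differential polynomial over the domain is dominated by its
   value on a small enough ball, and any common point of the image balls is an image
   of a; or a differential polynomial of least rank for which this fails has, by
   Newton iteration in differential-henselian form, a zero in the nest in S and in N,
   and the former can be mapped to the latter, which contradicts maximality. *)

(** The maximal embedding is kept as a subring of the product ring [K * L]: no intermediate field
    has to be built, one evaluation serves both models, and compatibility of leading terms makes the
    subring the graph of an embedding. Differential polynomials become ordinary polynomials
    evaluated at a [jet]. Monotonicity ([dle_der]) is what lets Gauss estimates control them: all
    derivatives of a small element are equally small, so a ball around a point yields a polydisc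
    around its jet. Countability comes from the ultraproducts over [nat], which realize only
    countably many conditions at a time; hence the data to be matched and the nests of balls must be
    countable. For this reason [closed_sub] asks for a single zero of each henselian polynomial.
    Only the side of [M] is restricted to such a field [S]; zeros on the side of [N] are taken in
    all of [N]. Residual and immediate extensions obey one scheme, [extension]: on a set of
    candidate pairs a polynomial either has compatible nonzero values or, if of least rank among the
    others, has a zero in both models by the same Newton step. *)

(** * Derivations and logarithmic derivatives *)

Section DerTheory.
Variable K : diffField.
Implicit Types a b : K.

Lemma der0 : der (0 : K) = 0.
Proof. by apply: (addrI (der (0 : K))); rewrite -derD !addr0. Qed.

Lemma derN a : der (- a) = - der a.
Proof. by apply: (addrI (der a)); rewrite -derD !subrr der0. Qed.

Lemma derB a b : der (a - b) = der a - der b.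
Proof. by rewrite derD derN. Qed.

Lemma der1 : der (1 : K) = 0.
Proof.
have := derM (1 : K) 1; rewrite !mulr1 mul1r => h.
by apply: (addrI (der 1)); rewrite -h addr0.
Qed.

Lemma logderM a b : a != 0 -> b != 0 -> logder (a * b) = logder a + logder b.
Proof.
move=> a0 b0; rewrite /logder derM; by field; rewrite a0 b0.
Qed.

(** Characteristic 0 is stated for primes only; a general [n] is split into a prime divisor and a
    smaller cofactor. *)
Lemma char0_natr_neq0 (n : nat) : (n != 0)%N -> n%:R != 0 :> K.
Proof.
have h := dfield_char0 K; elim/ltn_ind: n => n IH n0.
apply/negP => /eqP e; case: n n0 e IH => // n _ e IH.
case: n e IH => [/eqP|n e IH]; first by rewrite oner_eq0.
have p := pdiv_prime (ltn0Sn n : 1 < n.+2)%N.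
have dv := pdiv_dvd n.+2.
have : (pdiv n.+2)%:R != 0 :> K.
  by apply/negP => z; have := h (pdiv n.+2); rewrite inE p z.
have q0 : (n.+2 %/ pdiv n.+2 != 0)%N by rewrite -lt0n divn_gt0 ?pdiv_gt0 // dvdn_leq.
have : (n.+2 %/ pdiv n.+2)%:R != 0 :> K.
  by apply: IH q0; rewrite ltn_Pdiv // prime_gt1.
by move=> u w; have := mulf_neq0 u w; rewrite -natrM divnK // e eqxx.
Qed.

End DerTheory.

(** * Dominance, residues and angular components *)

Section Valued.
Variable M : structure.
Hypothesis hM : is_model M.
Local Notation K := (fsort M).
Local Notation k := (rsort M).
Local Notation G := (vsort M).
Local Notation v := (@valuation M).
Implicit Types a b c d : K.

(* [dle a b] is the dominance relation v(a) >= v(b). *)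
Definition dle a b : bool := ole (v b) (v a).
Definition dlt a b : bool := ~~ dle b a.
Definition deq a b : bool := dle a b && dle b a.

Let vax := model_valuation hM.
Let gax := model_ordered_group hM.

Lemma val_eqN a : (v a == None) = (a == 0).
Proof. by have [h _ _ _] := vax; apply/eqP/eqP => /h. Qed.

Lemma val0 : v 0 = None.
Proof. by apply/eqP; rewrite val_eqN. Qed.

Lemma valM a b : v (a * b) = oadd (v a) (v b).
Proof. by have [_ h _ _] := vax. Qed.

Lemma val_some a : a != 0 -> exists g, v a = Some g.
Proof. by rewrite -val_eqN; case: (v a) => // g _; exists g. Qed.

Lemma val_surj g : exists2 a, a != 0 & v a = Some g.
Proof.
by have [_ _ _ h] := vax; have [a e] := h g; exists a => //; rewrite -val_eqN e.
Qed.

Lemma ole_trans (g h i : option G) : ole g h -> ole h i -> ole g i.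
Proof. by case: g h i => [g|] [h|] [i|] //=; apply: le_trans. Qed.

Lemma ole_total (g h : option G) : ole g h || ole h g.
Proof. by case: g h => [g|] [h|] //=; have [+ _] := gax; apply. Qed.

Lemma ole_refl (g : option G) : ole g g.
Proof. by case: g => //= g; apply: lexx. Qed.

Lemma ole_anti (g h : option G) : ole g h -> ole h g -> g = h.
Proof. by case: g h => [g|] [h|] //= p q; congr Some; apply: le_anti; rewrite p. Qed.

Lemma gle_add (g h i : G) : (i + g <= i + h) = (g <= h).
Proof.
have [_ ad] := gax; apply/idP/idP => [/(ad _ _ (- i))|]; first by rewrite !addKr.
exact: ad.
Qed.

Lemma dle_refl a : dle a a. Proof. exact: ole_refl. Qed.
Hint Resolve dle_refl : core.

Lemma dle_trans b a c : dle a b -> dle b c -> dle a c.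
Proof. by move=> p q; apply: ole_trans q p. Qed.

Lemma dle_total a b : dle a b || dle b a.
Proof. exact: ole_total. Qed.

Lemma dltW a b : dlt a b -> dle a b.
Proof. by rewrite /dlt; have := dle_total a b; case: (dle b a) => //=; rewrite orbF. Qed.

Lemma dle_lt_trans b a c : dle a b -> dlt b c -> dlt a c.
Proof. by move=> p; apply: contra => q; apply: dle_trans q p. Qed.

Lemma dlt_le_trans b a c : dlt a b -> dle b c -> dlt a c.
Proof. by move=> p q; apply: contra p => r; apply: dle_trans q r. Qed.

Lemma dltNge a b : dlt a b = ~~ dle b a. Proof. by []. Qed.
Lemma dleNgt a b : dle a b = ~~ dlt b a. Proof. by rewrite /dlt negbK. Qed.

Lemma dltxx a : dlt a a = false. Proof. by rewrite /dlt dle_refl. Qed.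

Lemma dle0 b : dle 0 b. Proof. by rewrite /dle val0; case: (v b). Qed.
Hint Resolve dle0 : core.

Lemma dlex0 a : dle a 0 = (a == 0).
Proof. by rewrite /dle val0 -val_eqN; case: (v a). Qed.

Lemma dlt0x a : dlt 0 a = (a != 0).
Proof. by rewrite /dlt dlex0. Qed.

Lemma dltx0 a : dlt a 0 = false.
Proof. by rewrite /dlt dle0. Qed.

Lemma dlt_neq0 a b : dlt a b -> b != 0.
Proof. by apply: contraTneq => ->; rewrite dltx0. Qed.

Lemma dle_neq0 a b : dle a b -> a != 0 -> b != 0.
Proof. by move=> ab; apply: contraNneq => b0; rewrite -dlex0 -b0. Qed.

Lemma dleM2r c a b : c != 0 -> dle (a * c) (b * c) = dle a b.
Proof.
move=> /val_some[g e]; rewrite /dle !valM e; case: (v a) (v b) => [x|] [y|] //=.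
by rewrite ![_ + g]addrC gle_add.
Qed.

Lemma dleM2l c a b : c != 0 -> dle (c * a) (c * b) = dle a b.
Proof. by move=> c0; rewrite ![c * _]mulrC dleM2r. Qed.

Lemma dltM2r c a b : c != 0 -> dlt (a * c) (b * c) = dlt a b.
Proof. by move=> c0; rewrite /dlt dleM2r. Qed.

Lemma dltM2l c a b : c != 0 -> dlt (c * a) (c * b) = dlt a b.
Proof. by move=> c0; rewrite /dlt dleM2l. Qed.

Lemma dleM a b c d : dle a b -> dle c d -> dle (a * c) (b * d).
Proof.
move=> ab cd; have [->|c0] := eqVneq c 0; first by rewrite mulr0.
apply: (@dle_trans (b * c)); first by rewrite dleM2r.
by have [->|b0] := eqVneq b 0; rewrite ?mul0r // dleM2l.
Qed.

Lemma dlt_leM a b c d : dlt a b -> dle c d -> d != 0 -> dlt (a * c) (b * d).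
Proof.
move=> ab cd d0; apply: (@dle_lt_trans (a * d)); last by rewrite dltM2r.
exact: dleM.
Qed.

Lemma dle_pdivr a b c : c != 0 -> dle a (b / c) = dle (a * c) b.
Proof. by move=> c0; rewrite -(dleM2r _ _ c0) divfK. Qed.
Lemma dle_pdivl a b c : c != 0 -> dle (a / c) b = dle a (b * c).
Proof. by move=> c0; rewrite -(dleM2r _ _ c0) divfK. Qed.
Lemma dlt_pdivl a b c : c != 0 -> dlt (a / c) b = dlt a (b * c).
Proof. by move=> c0; rewrite /dlt dle_pdivr. Qed.

Lemma dleD a b c : dle a c -> dle b c -> dle (a + b) c.
Proof.
have [_ _ h _] := vax; rewrite /dle => p q; apply: ole_trans (h a b).
by rewrite /omin; case: ifP.
Qed.

Lemma val1 : v 1 = Some 0.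
Proof.
have [g e] := val_some (oner_neq0 K).
have := valM 1 1; rewrite mulr1 e => -[] h.
by congr Some; apply: (addrI g); rewrite addr0.
Qed.

Lemma valN1 : v (-1) = Some 0.
Proof.
have n0 : (-1 : K) != 0 by rewrite oppr_eq0 oner_neq0.
have [g e] := val_some n0.
have : v ((-1) * (-1)) = Some 0 by rewrite mulrNN mulr1 val1.
rewrite valM e => -[] h; congr Some.
(* An ordered group has no 2-torsion: adding [g] to [g <= 0] or [0 <= g] and using [g + g = 0] gives
   the other inequality. *)
have [t ad] := gax; apply: le_anti; have /orP[p|p] := t g 0; rewrite p ?andbT /=.
  by have := ad _ _ g p; rewrite h addr0.
by have := ad _ _ g p; rewrite h addr0.
Qed.

Lemma valN a : v (- a) = v a.
Proof. by rewrite -mulN1r valM valN1 /oadd; case: (v a) => // g; rewrite add0r. Qed.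

Lemma dleN a b : dle (- a) b = dle a b. Proof. by rewrite /dle valN. Qed.
Lemma dlexN a b : dle a (- b) = dle a b. Proof. by rewrite /dle valN. Qed.
Lemma dltN a b : dlt (- a) b = dlt a b. Proof. by rewrite /dlt dlexN. Qed.

Lemma dleB a b c : dle a c -> dle b c -> dle (a - b) c.
Proof. by move=> p q; apply: dleD; rewrite ?dleN. Qed.

Lemma dltD a b c : dlt a c -> dlt b c -> dlt (a + b) c.
Proof.
move=> p q; have /orP[r|r] := dle_total a b.
  by apply: dle_lt_trans q; apply: dleD.
by apply: dle_lt_trans p; apply: dleD.
Qed.

Lemma dltB a b c : dlt a c -> dlt b c -> dlt (a - b) c.
Proof. by move=> p q; apply: dltD; rewrite ?dltN. Qed.

Lemma dle_sum (I : Type) (r : seq I) (P : pred I) (F : I -> K) c :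
  (forall i, P i -> dle (F i) c) -> dle (\sum_(i <- r | P i) F i) c.
Proof. by move=> h; elim/big_ind: _ => // x y; apply: dleD. Qed.

Lemma dlt_sum (I : Type) (r : seq I) (P : pred I) (F : I -> K) c : c != 0 ->
  (forall i, P i -> dlt (F i) c) -> dlt (\sum_(i <- r | P i) F i) c.
Proof. by move=> c0 h; elim/big_ind: _ => //; [rewrite dlt0x | move=> x y; apply: dltD]. Qed.

Lemma dleX a n : dle a 1 -> dle (a ^+ n) 1.
Proof. by move=> h; elim: n => [|n IH]; rewrite ?expr0 // exprS -[1]mulr1 dleM. Qed.

Lemma dle_nat n : dle n%:R 1.
Proof. by elim: n => [|n IH]; rewrite ?dle0 // -natr1 dleD. Qed.

Lemma dle_mulrn a n c : dle a c -> dle (a *+ n) c.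
Proof. by move=> h; rewrite -mulr_natl -[c]mul1r; apply: dleM (dle_nat n) h. Qed.

Lemma deq_refl a : deq a a. Proof. by rewrite /deq dle_refl. Qed.
Lemma deqC a b : deq a b = deq b a. Proof. by rewrite /deq andbC. Qed.
Lemma deq_trans b a c : deq a b -> deq b c -> deq a c.
Proof.
by move=> /andP[p q] /andP[r s]; rewrite /deq (dle_trans p r) (dle_trans s q).
Qed.
Lemma deqE a b : deq a b <-> v a = v b.
Proof.
split; first by move=> /andP[p q]; apply: ole_anti.
by rewrite /deq /dle => ->; rewrite ole_refl.
Qed.
Lemma deqM a b c d : deq a b -> deq c d -> deq (a * c) (b * d).
Proof. by move=> /andP[p q] /andP[r s]; rewrite /deq !dleM. Qed.
Lemma deq_neq0 a b : deq a b -> (a != 0) = (b != 0).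
Proof. by move=> /deqE e; rewrite -!val_eqN e. Qed.
Lemma deqX a b n : deq a b -> deq (a ^+ n) (b ^+ n).
Proof. by move=> h; elim: n => [|n IH]; rewrite ?deq_refl // !exprS deqM. Qed.

Lemma dlt_deq a b : dlt (a - b) b -> deq a b.
Proof.
move=> h; have w := dltW h; apply/andP; split.
  by rewrite -(subrK b a); apply: dleD.
rewrite dleNgt; apply/negP => ab.
have : dlt (a - (a - b)) b by apply: dltB.
by rewrite opprB addrC subrK dltxx.
Qed.

Lemma deq_divr a b c : c != 0 -> deq (a / c) b = deq a (b * c).
Proof. by move=> c0; rewrite /deq dle_pdivl // dle_pdivr. Qed.

Lemma dle_der a : dle (der a) a.
Proof.
have [->|a0] := eqVneq a 0; first by rewrite der0.
exact: (model_monotone hM).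
Qed.

Lemma dle_iter_der n a : dle (iter n der a) a.
Proof. by elim: n => //= n; apply: dle_trans; apply: dle_der. Qed.

Let rax := model_residue hM.

Definition res a : k := odflt 0 (residue a).

Lemma in_OE a : in_O a = dle a 1.
Proof. by rewrite /in_O /dle val1. Qed.

Lemma residueE a : dle a 1 -> residue a = Some (res a).
Proof.
rewrite -in_OE /res; have [[h _ _ _ _] _] := rax; case e: (residue a) => // ia.
by have /h := e; rewrite ia.
Qed.

Lemma residueN a : ~~ dle a 1 -> residue a = None.
Proof. by rewrite -in_OE; have [[h _ _ _ _] _] := rax => /h. Qed.

Lemma res1 : res 1 = 1.
Proof. by rewrite /res; have [[_ -> _ _ _] _] := rax. Qed.

Lemma resD a b : dle a 1 -> dle b 1 -> res (a + b) = res a + res b.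
Proof.
move=> p q; rewrite {1}/res; have [[_ _ h _ _] _] := rax.
by rewrite h ?in_OE // !residueE.
Qed.

Lemma resM a b : dle a 1 -> dle b 1 -> res (a * b) = res a * res b.
Proof.
move=> p q; rewrite {1}/res; have [[_ _ _ h _] _] := rax.
by rewrite h ?in_OE // !residueE.
Qed.

Lemma res_der a : dle a 1 -> res (der a) = der (res a).
Proof.
move=> p; rewrite {1}/res; have [[_ _ _ _ h] _] := rax.
by rewrite h ?in_OE // !residueE.
Qed.

Lemma res0 : res 0 = 0.
Proof. by apply: (addrI (res 0)); rewrite -resD // !addr0. Qed.

Lemma resN a : dle a 1 -> res (- a) = - res a.
Proof. by move=> p; apply: (addrI (res a)); rewrite -resD ?dleN // !subrr res0. Qed.

Lemma resB a b : dle a 1 -> dle b 1 -> res (a - b) = res a - res b.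
Proof. by move=> p q; rewrite resD ?dleN // resN. Qed.

Lemma res_nat n : res n%:R = n%:R.
Proof. by elim: n => [|n IH]; rewrite ?res0 // -!natr1 resD ?dle_nat // IH res1. Qed.

Lemma res_surj (u : k) : exists2 a, dle a 1 & res a = u.
Proof.
have [[h _ _ _ _] s] := rax; have [a e] := s u; exists a; last by rewrite /res e.
by rewrite -in_OE; apply: contraT => /h; rewrite e.
Qed.

Lemma res_unit a : deq a 1 -> res a != 0.
Proof.
move=> e; have a0 : a != 0 by rewrite (deq_neq0 e) oner_neq0.
have /andP[p q] := e.
have ai : dle a^-1 1 by rewrite -(dleM2r _ _ a0) mulVf // mul1r.
have : res a * res a^-1 = 1 by rewrite -resM // divff // res1.
by move=> w; apply: contra_eq_neq w => ->; rewrite mul0r eq_sym oner_neq0.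
Qed.

(* The kernel of the residue map is a prime ideal whose quotient is the field k;
   comparing with a lift of the inverse shows that it is the maximal ideal. *)
Lemma res_small a : dlt a 1 -> res a = 0.
Proof.
move=> s; have p := dltW s; apply: contraTeq s => r0; rewrite -dleNgt.
have [b q e] := res_surj (res a)^-1.
have : res (a * b) = 1 by rewrite resM // e divff.
move=> ab; rewrite dleNgt; apply/negP => s.
have : deq (1 - a * b) 1.
  apply: dlt_deq; rewrite addrC addKr dltN -[1]mulr1; apply: dlt_leM => //.
  exact: oner_neq0.
have abl : dle (a * b) 1 by rewrite -[1]mulr1 dleM.
by move/res_unit; rewrite resB // res1 ab subrr eqxx.
Qed.

Lemma res_eq0 a : dle a 1 -> (res a == 0) = dlt a 1.
Proof.
move=> p; apply/idP/idP => [|/res_small ->//]; apply: contraLR.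
by rewrite -dleNgt => q; apply: res_unit; rewrite /deq p.
Qed.

Lemma deq_natr n : (n != 0)%N -> deq n%:R 1.
Proof.
move=> n0; rewrite /deq dle_nat dleNgt -res_eq0 ?dle_nat // res_nat.
exact: char0_natr_neq0.
Qed.

Lemma deq_mulrn a n : (n != 0)%N -> deq (a *+ n) a.
Proof. by move=> /deq_natr h; rewrite -mulr_natl -{2}[a]mul1r deqM ?deq_refl. Qed.

Let aax := model_ac hM.

Lemma ac0 : ac (0 : K) = 0. Proof. by have [[]] := aax. Qed.
Lemma ac_neq0 a : a != 0 -> ac a != 0. Proof. by have [[_ h _] _] := aax; apply: h. Qed.
Lemma acM a b : ac (a * b) = ac a * ac b.
Proof.
have [->|a0] := eqVneq a 0; first by rewrite mul0r ac0 mul0r.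
have [->|b0] := eqVneq b 0; first by rewrite mulr0 ac0 mulr0.
by have [[_ _ h] _] := aax; apply: h.
Qed.
Lemma ac_res a : deq a 1 -> ac a = res a.
Proof.
move=> /deqE; rewrite val1 => h; have [_ [+ _ _]] := aax => /(_ _ h).
by rewrite /res => ->.
Qed.
Lemma ac1 : ac (1 : K) = 1. Proof. by rewrite ac_res ?deq_refl // res1. Qed.
Lemma acV a : ac a^-1 = (ac a)^-1.
Proof.
have [->|a0] := eqVneq a 0; first by rewrite invr0 ac0 invr0.
by apply: (mulfI (ac_neq0 a0)); rewrite -acM !divff ?ac1 // ac_neq0.
Qed.

Lemma ac_eq0 a : (ac a == 0) = (a == 0).
Proof.
by apply/idP/idP => [|/eqP ->]; [apply: contraLR; apply: ac_neq0 | rewrite ac0].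
Qed.

Lemma ac_near a b : dlt (a - b) b -> ac a = ac b.
Proof.
move=> h; have b0 := dlt_neq0 h.
have e := dlt_deq h; have e1 : deq (a / b) 1 by rewrite deq_divr // mul1r.
have : res (a / b - 1) = 0.
  apply: res_small; rewrite -[X in _ - X](divff b0) -mulrBl dlt_pdivl // mul1r //.
rewrite resB ?dle_refl //; last by case/andP: e1.
rewrite res1 => /eqP; rewrite subr_eq0 -ac_res // acM acV => /eqP h1.
by rewrite -[ac a](@divfK _ (ac b)) ?ac_neq0 // h1 mul1r.
Qed.

(** Converse of [ac_near] within one value: valuation and angular component together determine an
    element exactly up to a factor in 1 plus the maximal ideal. This is why they carry all
    leading-term information. *)
Lemma near_ac a b : b != 0 -> deq a b -> ac a = ac b -> dlt (a - b) b.
Proof.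
move=> b0 e h; have e1 : deq (a / b) 1 by rewrite deq_divr // mul1r.
have /andP[l1 _] := e1.
have -> : a - b = (a / b - 1) * b by rewrite mulrBl divfK // mul1r.
rewrite -{3}[b]mul1r dltM2r // -res_eq0; last by apply: dleB.
by rewrite resB // res1 -ac_res // acM acV h divff ?subrr // ac_neq0.
Qed.

End Valued.

(** * Differential-henselianity for polynomials in finitely many derivatives *)

(** Total degree 1 read off single coefficients, the form that passes through the residue map and
    through ultraproducts. *)
Lemma dmsize2P (I : choiceType) (R : zmodType) (P : {malg R[{cmonom I}]}) :
  monalg.mmeasure monalg.mdeg P = 2%N <->
  (forall m, (1 < monalg.mdeg m)%N -> monalg.mcoeff m P = 0) /\
  (exists m, monalg.mdeg m = 1%N /\ monalg.mcoeff m P != 0).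
Proof.
split=> [e|[h [m [d n0]]]].
  split=> [m|].
    by rewrite ltnNge -ltnS -e -leqNgt => /monalg.msize_mdeg_ge /monalg.mcoeff_outdom.
  apply: contrapT => h; have : (monalg.mmeasure monalg.mdeg P <= 1)%N.
    rewrite monalg.msizeE big_seq; apply/bigmax_leqP_seq => m ms _.
    rewrite ltnS leqNgt; apply/negP => p; apply: h; exists m; split.
      by apply/eqP; rewrite eqn_leq p andbT -ltnS -e monalg.msize_mdeg_lt.
    by rewrite monalg.mcoeff_neq0.
  by rewrite e.
apply/eqP; rewrite eqn_leq; apply/andP; split; last first.
  by rewrite -d monalg.msize_mdeg_lt // -monalg.mcoeff_neq0.
rewrite monalg.msizeE big_seq; apply/bigmax_leqP_seq => m' ms _.
rewrite ltnNge; apply/negP => /h /eqP.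
by rewrite monalg.mcoeff_eq0 ms.
Qed.

(** [P.@[jet a]] is the value at [a] of a differential polynomial of order below [n], variable [i]
    standing for the [i]-th derivative. *)
Definition jet (K : diffField) n (a : K) (i : 'I_n) : K := iter i der a.

Lemma mcoeff_sumU (T : eqType) (I : choiceType) (R : zmodType) (s : seq T)
    (h : T -> I) (F : T -> R) (c : T) : uniq s -> injective h ->
  monalg.mcoeff (h c) (\sum_(m <- s) mkmalgU (h m) (F m)) = if c \in s then F c else 0.
Proof.
move=> us ih; rewrite raddf_sum /=; case: ifP => cs.
  rewrite (bigD1_seq c) //= monalg.mcoeffUU big1 ?addr0 // => m ne.
  by rewrite monalg.mcoeffU (inj_eq ih) (negbTE ne).
rewrite big_seq big1 // => m ms; rewrite monalg.mcoeffU (inj_eq ih).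
by case: eqP => // e; rewrite -e ms in cs.
Qed.

#[local] Hint Resolve dle_refl dle0 : core.

Lemma mcoeff_dpoly_redE (M : structure) (P : dpoly (fsort M) unit) m :
  monalg.mcoeff m (dpoly_red P) =
  if m \in monalg.msupp P then res (monalg.mcoeff m P) else 0.
Proof. by rewrite /dpoly_red (@mcoeff_sumU _ _ _ _ id) ?fset_uniq. Qed.

Section Henselian.
Variable M : structure.
Hypothesis hM : is_model M.
Local Notation K := (fsort M).
Local Notation k := (rsort M).
Local Notation dle := (@dle M).
Local Notation dlt := (@dlt M).
Local Notation deq := (@deq M).

Lemma mcoeff_dpoly_red (P : dpoly K unit) : (forall m, dle (monalg.mcoeff m P) 1) ->
  forall m, monalg.mcoeff m (dpoly_red P) = res (monalg.mcoeff m P).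
Proof.
move=> h m; rewrite mcoeff_dpoly_redE.
by case: ifPn => // ms; rewrite (monalg.mcoeff_outdom ms) (res0 hM).
Qed.

Lemma dpoly_red_size2 (P : dpoly K unit) : (forall m, dle (monalg.mcoeff m P) 1) ->
  monalg.mmeasure monalg.mdeg (dpoly_red P) = 2%N <->
  (forall m, (1 < monalg.mdeg m)%N -> dlt (monalg.mcoeff m P) 1) /\
  (exists m, monalg.mdeg m = 1%N /\ dle 1 (monalg.mcoeff m P)).
Proof.
move=> h; rewrite dmsize2P; split=> -[p [m [d q]]]; split.
- by move=> m' /p; rewrite mcoeff_dpoly_red // => /eqP; rewrite res_eq0.
- by exists m; split=> //; rewrite dleNgt -res_eq0 // -mcoeff_dpoly_red.
- by move=> m' /p; rewrite mcoeff_dpoly_red // -res_eq0 // => /eqP.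
- by exists m; split=> //; rewrite mcoeff_dpoly_red // res_eq0 // -dleNgt.
Qed.

Section Convert.
Variable n : nat.

(** Dictionary from exponents in [n] variables to monomials in the derivatives of one indeterminate:
    variable [i] becomes the pair [(tt, i)]. *)
Definition cmonom_of (m : multinom n) : {cmonom (unit * nat)%type} :=
  \big[mmul/mone]_(i < n) iter (m i) (mmul (ucm (tt, nat_of_ord i))) mone.

Lemma cmonom_ofE m j : cmonom_of m (tt, j) = if insub j is Some i then m i else 0%N.
Proof.
have e i : iter (m i) (mmul (ucm (tt, nat_of_ord i))) mone (tt, j)
    = ((i == j :> nat) * m i)%N.
  elim: (m i) => [|d IH] /=; first by rewrite monalg.cm1 muln0.
  by rewrite monalg.cmM IH monalg.cmU xpair_eqE eqxx /= mulnS.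
rewrite /cmonom_of (big_morph (fun c : {cmonom _} => c (tt, j))
  (fun a b => monalg.cmM (tt, j) a b) (monalg.cm1 (tt, j))) (eq_bigr _ (fun i _ => e i)).
case: insubP => [i _ ij|nj].
  rewrite (bigD1 i) //= ij eqxx mul1n big1 ?addn0 // => i' ne.
  by rewrite -ij -[_ == _ :> nat]/(i' == i) (negbTE ne).
by rewrite big1 // => i _; case: eqP => // ij; move: nj; rewrite -ij ltn_ord.
Qed.

Lemma cmonom_of_inj : injective cmonom_of.
Proof.
move=> m1 m2 e; apply/mnmP => i; have := cmonom_ofE m1 i; rewrite e cmonom_ofE.
by case: insubP => [j _ /val_inj -> -> //|]; rewrite ltn_ord.
Qed.

Lemma mdeg_cmonom_of m : monalg.mdeg (cmonom_of m) = mdeg m.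
Proof.
rewrite monalg.mdeg_prod mdegE; apply: eq_bigr => i _.
by elim: (m i) => [|d IH] /=; rewrite ?monalg.mdeg1 // monalg.mdegM monalg.mdegU IH.
Qed.

Lemma cmonom_of_eval (y : K) m :
  \prod_(ij <- finsupp (cmonom_of m)) iter ij.2 der y ^+ cmonom_of m ij
  = \prod_(i < n) jet y i ^+ m i.
Proof.
(* The product over the support is enlarged to all derivatives of order below [n]; the added
   exponents are 0. *)
pose D := seq_fset tt [seq (tt, nat_of_ord i) | i <- enum 'I_n].
have sub : (finsupp (cmonom_of m) `<=` D)%fset.
  apply/fsubsetP => -[[] j]; rewrite -monalg.cmE_neq0 cmonom_ofE seq_fsetE.
  case: insubP => // i _ <- _; apply/mapP; exists i => //; exact: mem_enum.
rewrite (big_fset_incl _ sub) => [|ij _]; last first.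
  by rewrite -monalg.cmE_eq0 => /eqP ->.
have us : uniq [seq (tt, nat_of_ord i) | i <- enum 'I_n].
  by rewrite map_inj_uniq ?enum_uniq // => i j [] /val_inj.
rewrite (perm_big _ (seq_fset_perm _ _)) undup_id //.
rewrite big_map big_enum; apply: eq_bigr => i _; rewrite cmonom_ofE.
by case: insubP => [j _ /val_inj ->|]; rewrite ?ltn_ord.
Qed.

Definition dpoly_of (P : mpoly n K) : dpoly K unit :=
  \sum_(m <- msupp P) mkmalgU (cmonom_of m) P@_m.

Lemma mcoeff_dpoly_of P m : monalg.mcoeff (cmonom_of m) (dpoly_of P) = P@_m.
Proof.
rewrite /dpoly_of mcoeff_sumU ?msupp_uniq //; last exact: cmonom_of_inj.
by case: ifPn => // ms; rewrite (memN_msupp_eq0 ms).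
Qed.

Lemma mcoeff_dpoly_of_out P c : (forall m, c != cmonom_of m) ->
  monalg.mcoeff c (dpoly_of P) = 0.
Proof.
move=> h; rewrite /dpoly_of raddf_sum big1 //= => m _.
by rewrite monalg.mcoeffU eq_sym (negbTE (h m)).
Qed.

Lemma dpoly_of_eval P y : dpoly_eval id (dpoly_of P) (fun=> y) = P.@[jet y].
Proof.
rewrite /dpoly_eval /dpoly_of (raddf_sum (monalg.mmap (idfun : {additive K -> K}) _)) mevalE.
by apply: eq_bigr => m _; rewrite -(cmonom_of_eval y m); exact: (@monalg.mmapU _ _ _ idfun).
Qed.

(** The hypotheses say that the reduction has total degree 1: small coefficients in degrees above 1
    and a unit among the linear ones. *)
Lemma dhens_mpoly (P : mpoly n K) :
  (forall m, dle P@_m 1) -> (forall m, (1 < mdeg m)%N -> dlt P@_m 1) ->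
  (exists i, dle 1 P@_U_(i)) -> exists2 y, dle y 1 & P.@[jet y] = 0.
Proof.
move=> h1 h2 [i h3]; have h1' c : dle (monalg.mcoeff c (dpoly_of P)) 1.
  have [[m ->]|n0] := pselect (exists m, c = cmonom_of m); first by rewrite mcoeff_dpoly_of.
  rewrite mcoeff_dpoly_of_out ?dle0 // => m; apply/eqP => e; apply: n0; by exists m.
have [] := model_dhenselian hM (P := dpoly_of P).
- by move=> m; rewrite (in_OE hM).
- apply/dpoly_red_size2 => //; split=> [c d|].
    have [[m e]|n0] := pselect (exists m, c = cmonom_of m).
      by rewrite e mcoeff_dpoly_of; apply: h2; rewrite -mdeg_cmonom_of -e.
    rewrite mcoeff_dpoly_of_out ?dlt0x ?oner_neq0 // => m.
    by apply/eqP => e; apply: n0; exists m.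
  by exists (cmonom_of U_(i)); rewrite mcoeff_dpoly_of mdeg_cmonom_of mdeg1.
- by move=> y; rewrite (in_OE hM) dpoly_of_eval; exists y.
Qed.

End Convert.
End Henselian.

(** * Affine substitution in polynomials *)

Section AffineSubstitution.
Variables (R : comNzRingType) (n : nat).
Implicit Types (P Q : mpoly n R) (e f : 'I_n -> R) (h g : R).

Lemma mpoly_ring_ind (T : mpoly n R -> Prop) :
  (forall c, T c%:MP) -> (forall i, T 'X_i) ->
  (forall p q, T p -> T q -> T (p + q)) -> (forall p q, T p -> T q -> T (p * q)) ->
  forall p, T p.
Proof.
move=> hC hX hD hM p; rewrite (mpolyE p); apply: (big_ind T) => //.
  by rewrite -(mpolyC0 n R).
move=> m _; rewrite -mul_mpolyC; apply: (hM) => //; rewrite mpolyXE_id.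
apply: (big_ind T) => [|//|i _]; first by rewrite -(mpolyC1 n R).
by elim: (m i) => [|d IH]; rewrite ?expr0 -?(mpolyC1 n R) // exprS; apply: hM.
Qed.

(** The polynomial [P(e + h X)]. Every variable is scaled by the same [h], so this differs from the
    differential substitution [h Y]; the Leibniz terms of the latter are restored in [newton]. *)
Definition msub P e h : mpoly n R :=
  mmap (@mpolyC n R) (fun i => (e i)%:MP + h%:MP * 'X_i) P.

Lemma msubC c e h : msub c%:MP e h = c%:MP.
Proof. exact: mmapC. Qed.

Lemma msubX i e h : msub 'X_i e h = (e i)%:MP + h%:MP * 'X_i.
Proof. by rewrite /msub mmapX mmap1U. Qed.

Lemma msubD P Q e h : msub (P + Q) e h = msub P e h + msub Q e h.
Proof. exact: mmapD. Qed.

Lemma msubB P Q e h : msub (P - Q) e h = msub P e h - msub Q e h.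
Proof. exact: mmapB. Qed.

Lemma msubM P Q e h : msub (P * Q) e h = msub P e h * msub Q e h.
Proof. exact: rmorphM. Qed.

Lemma meval_msub P e h x :
  (msub P e h).@[x] = P.@[fun i => e i + h * x i].
Proof.
elim/mpoly_ring_ind: P => [c|i|p q IHp IHq|p q IHp IHq].
- by rewrite msubC !mevalC.
- by rewrite msubX mevalD mevalM !mevalC !mevalXU.
- by rewrite msubD !mevalD IHp IHq.
- by rewrite msubM !mevalM IHp IHq.
Qed.

Lemma msub_msub P e h f g :
  msub (msub P e h) f g = msub P (fun i => e i + h * f i) (h * g).
Proof.
elim/mpoly_ring_ind: P => [c|i|p q IHp IHq|p q IHp IHq].
- by rewrite !msubC.
- by rewrite !msubX msubD msubM !msubC msubX mpolyCD !mpolyCM; ring.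
- by rewrite !msubD IHp IHq.
- by rewrite !msubM IHp IHq.
Qed.

Lemma eq_msub P e f h : e =1 f -> msub P e h = msub P f h.
Proof. by move=> ef; congr (msub _ _ _); apply/funext. Qed.

Lemma mderiv_msub i P e h : (msub P e h)^`M(i) = h%:MP * msub P^`M(i) e h.
Proof.
elim/mpoly_ring_ind: P => [c|j|p q IHp IHq|p q IHp IHq].
- by rewrite msubC !mderivC -(mpolyC0 n R) msubC mpolyC0 mulr0.
- rewrite msubX mderivD mderivM !mderivC mul0r !add0r !mderivX.
  rewrite !mnm1E; have [->|_] := eqVneq j i; last by rewrite !scale0r -(mpolyC0 n R) msubC.
  have -> : (U_(i) - U_(i) = 0 :> multinom n)%MM by apply/mnmP => k; rewrite mnmBE mnm0E subnn.
  by rewrite !scale1r mpolyX0 -(mpolyC1 n R) msubC.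
- by rewrite msubD !mderivD msubD IHp IHq mulrDr.
- by rewrite msubM !mderivM msubD !msubM IHp IHq; ring.
Qed.

Lemma meval0_mcoeff P : P.@[fun=> 0] = P@_0.
Proof.
elim/mpoly_ring_ind: P => [c|i|p q IHp IHq|p q IHp IHq].
- by rewrite mevalC mcoeffC eqxx mulr1.
- by rewrite mevalXU mcoeffX mnm1_eq0.
- by rewrite mevalD mcoeffD IHp IHq.
- by rewrite mevalM rmorphM /= IHp IHq.
Qed.

Lemma mcoeff0_msub P e h : (msub P e h)@_0 = P.@[e].
Proof.
rewrite -meval0_mcoeff meval_msub; apply: meval_eq => i.
by rewrite mulr0 addr0.
Qed.

Lemma mcoeff1_deriv P i : P@_U_(i) = P^`M(i).@[fun=> 0].
Proof. by rewrite meval0_mcoeff mcoeff_deriv mnm0E mulr1n add0m. Qed.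

Lemma mcoeff1_msub P e h i : (msub P e h)@_U_(i) = h * P^`M(i).@[e].
Proof.
rewrite mcoeff1_deriv mderiv_msub mevalM mevalC meval0_mcoeff.
by rewrite mcoeff0_msub.
Qed.

End AffineSubstitution.

(** * Subrings and polynomials over them *)

Definition is_subring (R : comNzRingType) (S : R -> Prop) : Prop :=
  [/\ S 1, forall a b, S a -> S b -> S (a - b) & forall a b, S a -> S b -> S (a * b)].

Definition pover (R : comNzRingType) (S : R -> Prop) n (P : mpoly n R) : Prop :=
  forall m, S P@_m.

Section Subring.
Variables (R : comNzRingType) (S : R -> Prop).
Hypothesis hS : is_subring S.

Lemma sub1 : S 1. Proof. by have [] := hS. Qed.
Lemma subB a b : S a -> S b -> S (a - b). Proof. by have [_ + _] := hS; apply. Qed.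
Lemma subM a b : S a -> S b -> S (a * b). Proof. by have [_ _ +] := hS; apply. Qed.
Lemma sub0 : S 0. Proof. by rewrite -(subrr 1); apply: subB; apply: sub1. Qed.
Lemma subN a : S a -> S (- a). Proof. by rewrite -sub0r; apply: subB sub0. Qed.
Lemma subD a b : S a -> S b -> S (a + b).
Proof. by move=> sa sb; rewrite -[b]opprK; apply: subB => //; apply: subN. Qed.
Lemma subX a k : S a -> S (a ^+ k).
Proof. by move=> sa; elim: k => [|k IH]; rewrite ?expr0 ?exprS; [apply: sub1 | apply: subM]. Qed.
Lemma subMn a k : S a -> S (a *+ k).
Proof. by move=> sa; elim: k => [|k IH]; rewrite ?mulr0n ?mulrS; [apply: sub0 | apply: subD]. Qed.
Lemma sub_sum (I : Type) (r : seq I) (P : pred I) (F : I -> R) :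
  (forall i, P i -> S (F i)) -> S (\sum_(i <- r | P i) F i).
Proof. by move=> h; apply: big_ind => //; [apply: sub0 | apply: subD]. Qed.
Lemma sub_prod (I : Type) (r : seq I) (P : pred I) (F : I -> R) :
  (forall i, P i -> S (F i)) -> S (\prod_(i <- r | P i) F i).
Proof. by move=> h; apply: big_ind => //; [apply: sub1 | apply: subM]. Qed.

Variable n : nat.
Implicit Types (P Q : mpoly n R).

Lemma pover_subring : is_subring (@pover R S n).
Proof.
split=> [m|P Q p q m|P Q p q m].
- by rewrite -(mpolyC1 n R) mcoeffC mul1r; apply: subMn sub1.
- by rewrite mcoeffB; apply: subB.
- by rewrite mcoeffM; apply: sub_sum => k _; apply: subM.
Qed.

Lemma poverC c : S c -> pover S (c%:MP : mpoly n R).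
Proof. by move=> sc m; rewrite mcoeffC; apply: subM => //; apply: subMn sub1. Qed.

Lemma poverXm m : pover S ('X_[m] : mpoly n R).
Proof. by move=> m'; rewrite mcoeffX; apply: subMn sub1. Qed.

Lemma pover_deriv P i : pover S P -> pover S P^`M(i).
Proof. by move=> p m; rewrite mcoeff_deriv; apply: subMn. Qed.

Lemma meval_sub P x : pover S P -> (forall i, S (x i)) -> S P.@[x].
Proof.
move=> p sx; rewrite mevalE; apply: sub_sum => m _; apply: subM => //.
by apply: sub_prod => i _; apply: subX.
Qed.
End Subring.

Lemma pover_mmap (R : comNzRingType) (S : R -> Prop) n l (P : mpoly n R)
    (s : 'I_n -> mpoly l R) : is_subring S ->
  pover S P -> (forall i, pover S (s i)) -> pover S (mmap (@mpolyC l R) s P).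
Proof.
move=> hS p h; have hP := pover_subring hS l; rewrite /mmap.
apply: (sub_sum hP) => m _; apply: (subM hP); first exact: poverC.
by apply: (sub_prod hP) => i _; apply: (subX hP).
Qed.

Lemma pover_msub (R : comNzRingType) (S : R -> Prop) n (P : mpoly n R) e h : is_subring S ->
  pover S P -> (forall i, S (e i)) -> S h -> pover S (msub P e h).
Proof.
move=> hS p se sh; have hP := pover_subring hS n; apply: pover_mmap => // i.
apply: (subD hP); first exact: poverC.
by apply: (subM hP); [exact: poverC | exact: poverXm].
Qed.

Lemma msub0_mcoeff (R : comNzRingType) n (P : mpoly n R) h m :
  (msub P (fun=> 0) h)@_m = h ^+ mdeg m * P@_m.
Proof.
have eX m' : mmap1 (fun i => (0 : R)%:MP + h%:MP * 'X_i) m' = (h ^+ mdeg m') *: 'X_[m'].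
  rewrite /mmap1 mpolyXE_id mdegE expr_sum -mul_mpolyC rmorph_prod -big_split /=.
  by apply: eq_bigr => i _; rewrite mpolyC0 add0r exprMn rmorphXn.
rewrite /msub /mmap raddf_sum /= [in RHS](mpolyE P) raddf_sum /= mulr_sumr.
apply: eq_bigr => m' _; rewrite eX mcoeffCM !mcoeffZ mcoeffX.
by case: eqP => [->|]; rewrite ?mulr0 // mulrCA.
Qed.

Lemma msub_scale (R : comNzRingType) n (P : mpoly n R) e h m :
  (msub P e h)@_m = h ^+ mdeg m * (msub P e 1)@_m.
Proof.
rewrite -msub0_mcoeff msub_msub mul1r.
rewrite mul1r; congr (mcoeff m _); apply: eq_msub => i; by rewrite addr0.
Qed.

(** * Gauss valuation and dominant constant terms *)

Section Gauss.
Variable M : structure.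
Hypothesis hM : is_model M.
Local Notation K := (fsort M).
Local Notation dle := (@dle M).
Local Notation dlt := (@dlt M).
Local Notation deq := (@deq M).
Variable n : nat.
Implicit Types (P Q : mpoly n K) (e x : 'I_n -> K).

Definition gle P d := forall m, dle P@_m d.
Definition glt P d := forall m, dlt P@_m d.

Lemma gleM P Q c d : gle P c -> gle Q d -> gle (P * Q) (c * d).
Proof. by move=> p q m; rewrite mcoeffM; apply: dle_sum => // k _; apply: dleM. Qed.

Lemma gleD P Q d : gle P d -> gle Q d -> gle (P + Q) d.
Proof. by move=> p q m; rewrite mcoeffD; apply: dleD. Qed.

Lemma gleB P Q d : gle P d -> gle Q d -> gle (P - Q) d.
Proof. by move=> p q m; rewrite mcoeffB; apply: dleB. Qed.

Lemma gle1C c : dle c 1 -> gle c%:MP 1.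
Proof.
by move=> h m; rewrite mcoeffC; case: (_ == _); rewrite ?mulr0 ?mulr1 // dle0.
Qed.

Lemma gle11 : gle 1 1.
Proof. by rewrite -(mpolyC1 n K); apply: gle1C. Qed.

Lemma gle1X m : gle 'X_[m] 1.
Proof. by move=> m'; rewrite mcoeffX; apply: dle_nat. Qed.

Lemma gle1_prod (I : Type) (r : seq I) (F : I -> mpoly n K) :
  (forall i, gle (F i) 1) -> gle (\prod_(i <- r) F i) 1.
Proof.
move=> h; apply: (big_ind (gle^~ 1)) => //; last by move=> p q; rewrite -{3}[1]mulr1; apply: gleM.
by rewrite -(mpolyC1 n K); apply: gle1C.
Qed.

Lemma gle1_mmap1 (s : 'I_n -> mpoly n K) m : (forall i, gle (s i) 1) -> gle (mmap1 s m) 1.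
Proof.
move=> h; apply: gle1_prod => i; elim: (m i) => [|d IH].
  by rewrite expr0 -(mpolyC1 n K); apply: gle1C.
by rewrite exprS -[1]mulr1; apply: gleM.
Qed.

Lemma gle_mmap P (s : 'I_n -> mpoly n K) d : (forall i, gle (s i) 1) ->
  gle P d -> gle (mmap (@mpolyC n K) s P) d.
Proof.
move=> hs p m; rewrite /mmap raddf_sum /=; apply: dle_sum => // m' _.
by rewrite mcoeffCM -[d]mulr1; apply: dleM => //; apply: gle1_mmap1.
Qed.

Lemma glt_mmap P (s : 'I_n -> mpoly n K) d : (forall i, gle (s i) 1) ->
  glt P d -> glt (mmap (@mpolyC n K) s P) d.
Proof.
move=> hs p m; rewrite /mmap raddf_sum /=; apply: dlt_sum => //.
  exact: dlt_neq0 (p m).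
move=> m' _; rewrite mcoeffCM -[d]mulr1; apply: dlt_leM => //; rewrite ?oner_neq0 //.
exact: gle1_mmap1.
Qed.

Lemma gle1_affine (e : 'I_n -> K) h i : (forall i, dle (e i) 1) -> dle h 1 ->
  gle ((e i)%:MP + h%:MP * 'X_i) 1.
Proof.
move=> he hh; apply: gleD; first exact: gle1C.
by rewrite -[1]mulr1; apply: gleM; [apply: gle1C | apply: gle1X].
Qed.

Lemma gle_msub P e h d : (forall i, dle (e i) 1) -> dle h 1 ->
  gle P d -> gle (msub P e h) d.
Proof. by move=> he hh; apply: gle_mmap => i; apply: gle1_affine. Qed.

Lemma glt_msub P e h d : (forall i, dle (e i) 1) -> dle h 1 ->
  glt P d -> glt (msub P e h) d.
Proof. by move=> he hh; apply: glt_mmap => i; apply: gle1_affine. Qed.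

Lemma gle_meval P x d : (forall i, dle (x i) 1) -> gle P d -> dle P.@[x] d.
Proof. by move=> hx p; rewrite -(mcoeff0_msub P x 1); apply: gle_msub. Qed.

Lemma glt_meval P x d : (forall i, dle (x i) 1) -> glt P d -> dlt P.@[x] d.
Proof. by move=> hx p; rewrite -(mcoeff0_msub P x 1); apply: glt_msub. Qed.

(** On the whole unit polydisc such a polynomial is asymptotic to its constant term ([cdom_meval]).
    Applied to [msub P (jet e) h], it says that [P] is governed by its value at [e] on the ball of
    radius [h] around [e]. *)
Definition cdom Q := Q@_0 != 0 /\ forall m, m != 0%MM -> dlt Q@_m Q@_0.

Lemma cdom_glt Q : cdom Q <-> Q@_0 != 0 /\ glt (Q - (Q@_0)%:MP) Q@_0.
Proof.
split=> -[q0 h]; split=> // m.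
  have [->|m0] := eqVneq m 0%MM.
    by rewrite mcoeffB mcoeffC eqxx mulr1 subrr dlt0x.
  by rewrite mcoeffB mcoeffC (negbTE m0) mulr0 subr0; apply: h.
by move=> m0; have := h m; rewrite mcoeffB mcoeffC (negbTE m0) mulr0 subr0.
Qed.

Lemma cdom_meval Q x : cdom Q -> (forall i, dle (x i) 1) -> dlt (Q.@[x] - Q@_0) Q@_0.
Proof.
move=> /cdom_glt[q0 h] hx; rewrite -[X in _ - X](mevalC x) -mevalB.
exact: glt_meval.
Qed.

(** Recentring alters the constant term by a smaller amount only, while all other coefficients come
    from [Q] minus its constant term. *)
Lemma cdom_msub Q e h : (forall i, dle (e i) 1) -> dle h 1 -> cdom Q ->
  cdom (msub Q e h).
Proof.
move=> he hh c; have /cdom_glt[q0 g] := c.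
have near := cdom_meval c he; rewrite -(mcoeff0_msub Q e h) in near.
have eq := dlt_deq hM near; have /andP[_ le] := eq.
have n0 : (msub Q e h)@_0 != 0 by rewrite (deq_neq0 hM eq).
split=> // m m0. apply: dlt_le_trans le.
have -> : (msub Q e h)@_m = (msub (Q - (Q@_0)%:MP) e h)@_m.
  by rewrite msubB msubC mcoeffB mcoeffC (negbTE m0) mulr0 subr0.
exact: glt_msub.
Qed.

End Gauss.

Lemma iter_derM (K : diffField) (a b : K) i :
  iter i der (a * b) =
  \sum_(j < i.+1) 'C(i, j)%:R * iter (i - j) der a * iter j der b.
Proof.
have derS (I : Type) (r : seq I) (F : I -> K) :
    der (\sum_(j <- r) F j) = \sum_(j <- r) der (F j).
  by apply: (big_morph der (@derD K) (der0 K)).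
have derC m (c : K) : der (m%:R * c) = m%:R * der c.
  elim: m => [|m IH]; first by rewrite !mul0r der0.
  by rewrite -natr1 !mulrDl derD IH !mul1r.
elim: i => [|i IH]; first by rewrite big_ord_recl big_ord0 bin0 !mul1r addr0.
rewrite iterS IH derS.
have -> : \sum_(j < i.+1) der ('C(i, j)%:R * iter (i - j) der a * iter j der b) =
   \sum_(j < i.+1) 'C(i, j)%:R * iter (i - j).+1 der a * iter j der b
   + \sum_(j < i.+1) 'C(i, j)%:R * iter (i - j) der a * iter j.+1 der b.
  by rewrite -big_split; apply: eq_bigr => j _ /=; rewrite -!mulrA derC derM mulrDr.
rewrite big_ord_recl [in RHS]big_ord_recl /= !bin0 !subn0 !mul1r -addrA; congr (_ + _).
rewrite [X in _ + X]big_ord_recr [in RHS]big_ord_recr /= /bump /= !add1n !subnn !binn addrA.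
congr (_ + _); rewrite -big_split; apply: eq_bigr => j _ /=.
by rewrite !add1n subSS binS natrD !mulrDl -(subnSK (ltn_ord j)).
Qed.

Lemma meval_mmap (R : comNzRingType) n l (P : mpoly n R) (s : 'I_n -> mpoly l R) x :
  (mmap (@mpolyC l R) s P).@[x] = P.@[fun i => (s i).@[x]].
Proof.
elim/mpoly_ring_ind: P => [c|i|p q IHp IHq|p q IHp IHq].
- by rewrite mmapC !mevalC.
- by rewrite mmapX mmap1U mevalXU.
- by rewrite mmapD !mevalD IHp IHq.
- by rewrite rmorphM !mevalM /= IHp IHq.
Qed.

(** * Newton iteration *)

Section Newton.
Variable M : structure.
Hypothesis hM : is_model M.
Local Notation K := (fsort M).
Local Notation dle := (@dle M).
Local Notation dlt := (@dlt M).
Local Notation deq := (@deq M).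

(* The zero of a henselian polynomial over [S] is only required to exist in
   [S]: countable sets can have this property. *)
Record closed_sub (S : K -> Prop) : Prop := ClosedSub {
  closed_sub_ring : is_subring S;
  closed_subV : forall a, S a -> S a^-1;
  closed_sub_der : forall a, S a -> S (der a);
  closed_sub_hens : forall n (P : mpoly n K), pover S P -> gle P 1 ->
    (forall m, (1 < mdeg m)%N -> dlt P@_m 1) -> (exists i, dle 1 P@_U_(i)) ->
    exists y, [/\ S y, dle y 1 & P.@[jet y] = 0]
}.

Lemma closed_subT : closed_sub (fun=> True).
Proof.
split=> // n P _ p1 p2 p3; have [y y1 y2] := dhens_mpoly hM p1 p2 p3.
by exists y.
Qed.

Variable S : K -> Prop.
Hypothesis hS : closed_sub S.
Let hSr := closed_sub_ring hS.

Lemma closed_sub_iter i a : S a -> S (iter i der a).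
Proof. by move=> sa; elim: i => //= i; apply: (closed_sub_der hS). Qed.

(** Newton position: at scale [h] around [a] the constant term has the size of the largest linear
    coefficient and strictly dominates the nonlinear ones. Writing the derivatives of [h y] as [h]
    times combinations of derivatives of [y], and dividing by [Q@_0], gives a polynomial to which
    differential-henselianity applies. *)
Lemma newton n (P : mpoly n K) (a h : K) (Q := msub P (jet a) h) :
  pover S P -> S a -> S h -> h != 0 -> Q@_0 != 0 ->
  (forall m, (1 < mdeg m)%N -> dlt Q@_m Q@_0) -> (forall i, dle Q@_U_(i) Q@_0) ->
  (exists j, dle Q@_0 Q@_U_(j)) ->
  exists y, [/\ S y, dle y 1 & P.@[jet (a + h * y)] = 0].
Proof.
move=> SP Sa Sh h0 q0 hq2 hq1 [j0 hj0].
(* By the Leibniz rule, [t i] takes at the jet of [y] the value of the [i]-th derivative of [h y]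
   divided by [h]. Its coefficients lie in the valuation ring because the valuation is monotone. *)
pose t i : mpoly n K :=
  \sum_(j < n | (j <= i)%N) ('C(i, j)%:R * iter (i - j) der h / h) *: 'X_j.
have tle i : gle (t i) 1.
  move=> m; rewrite raddf_sum /=; apply: dle_sum => // j _.
  rewrite mcoeffZ -[X in dle _ X]mulr1; apply: dleM => //; last exact: gle1X.
  rewrite dle_pdivl //; apply: dleM => //; first exact: dle_nat.
  exact: dle_iter_der.
have tE i j : (t i)@_U_(j) =
    if (j <= i)%N then 'C(i, j)%:R * iter (i - j) der h / h else 0.
  rewrite raddf_sum /=; case: ifP => ij.
    rewrite (bigD1 j) //= mcoeffZ mcoeffXU eqxx mulr1 big1 ?addr0 // => j' /andP[_ ne].
    by rewrite mcoeffZ mcoeffXU (negbTE ne) mulr0.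
  rewrite big1 // => j' ij'; rewrite mcoeffZ mcoeffXU; case: eqP => [e|]; rewrite ?mulr0 //.
  by rewrite -e ij' in ij.
have t2 i m : (1 < mdeg m)%N -> (t i)@_m = 0.
  move=> d; rewrite raddf_sum /= big1 // => j _; rewrite mcoeffZ mcoeffX.
  by case: eqP => [e|]; rewrite ?mulr0 // -e mdeg1 in d *.
have t0 i : (t i)@_0 = 0.
  by rewrite raddf_sum /= big1 // => j _; rewrite mcoeffZ mcoeffX mnm1_eq0 mulr0.
have tj y (i : 'I_n) : (t i).@[jet y] * h = jet (h * y) i.
  rewrite raddf_sum /= mulr_suml /jet iter_derM.
  rewrite (big_ord_widen n (fun j => 'C(i, j)%:R * iter (i - j) der h * iter j der y)) //.
  apply: eq_big => [j|j _]; first by rewrite ltnS.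
  by rewrite mevalZ mevalXU /jet mulrAC divfK // mulrAC.
pose R := mmap (@mpolyC n K) t Q.
have RE y : R.@[jet y] = P.@[jet (a + h * y)].
  rewrite meval_mmap.
  rewrite /Q meval_msub; apply: meval_eq => i.
  by rewrite mulrC tj /jet; elim: (i : nat) => //= d <-; rewrite derD.
have SR : pover S R.
  apply: pover_mmap => //.
    by apply: pover_msub => // i; apply: closed_sub_iter.
  move=> i m; rewrite raddf_sum /=; apply: (sub_sum hSr) => j _; rewrite mcoeffZ.
  apply: (subM hSr); last exact: poverXm.
  apply: (subM hSr); last exact: (closed_subV hS).
  by apply: (subM hSr); [apply: (subMn hSr); apply: sub1 | apply: closed_sub_iter].
pose L := \sum_i Q@_U_(i) *: 'X_i; pose Q2 := Q - (Q@_0)%:MP - L.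
have L0 : L@_0 = 0 by rewrite raddf_sum /= big1 // => i _; rewrite mcoeffZ mcoeffX mnm1_eq0 mulr0.
have L1 i : L@_U_(i) = Q@_U_(i).
  rewrite raddf_sum /= (bigD1 i) //= mcoeffZ mcoeffXU eqxx mulr1 big1 ?addr0 // => j ne.
  by rewrite mcoeffZ mcoeffXU (negbTE ne) mulr0.
have L2 m : (1 < mdeg m)%N -> L@_m = 0.
  move=> d; rewrite raddf_sum /= big1 // => i _; rewrite mcoeffZ mcoeffX.
  by case: eqP => [e|]; rewrite ?mulr0 // -e mdeg1 in d *.
have mcase (m : multinom n) : [\/ m = 0%MM, exists i, m = U_(i)%MM | (1 < mdeg m)%N].
  case d: (mdeg m) => [|[|k]].
  - by apply: Or31; apply/eqP; rewrite -mdeg_eq0 d.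
  - by apply: Or32; have /mdeg1P[i /eqP e] : mdeg m == 1%N by [rewrite d]; exists i.
  - by apply: Or33.
have q2 : glt Q2 Q@_0.
  move=> m; rewrite /Q2 !mcoeffB mcoeffC.
  have [->|[i ->]|d] := mcase m.
  - by rewrite eqxx mulr1 subrr L0 subr0 dlt0x.
  - by rewrite mnm1_eq0 mulr0 subr0 L1 subrr dlt0x.
  - by rewrite L2 // -mdeg_eq0 eqn0Ngt (ltnW d) /= mulr0 !subr0; apply: hq2.
have RQ2 : glt (mmap (@mpolyC n K) t Q2) Q@_0 by apply: glt_mmap.
have RD m : R@_m = Q@_0 * (m == 0%MM)%:R + \sum_i Q@_U_(i) * (t i)@_m
    + (mmap (@mpolyC n K) t Q2)@_m.
  have -> : R = (Q@_0)%:MP + \sum_i Q@_U_(i) *: t i + mmap (@mpolyC n K) t Q2.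
    have eL : mmap (@mpolyC n K) t L = \sum_i Q@_U_(i) *: t i.
      rewrite raddf_sum /=; apply: eq_bigr => i _.
      by rewrite mmapZ mmapX mmap1U mul_mpolyC.
    have -> : R = mmap (@mpolyC n K) t ((Q@_0)%:MP + L + Q2).
      by rewrite /R /Q2 addrC -[Q - _ - L]addrA -opprD subrK.
    by rewrite !mmapD mmapC eL.
  rewrite !mcoeffD mcoeffC; congr (_ + _ + _).
  by rewrite raddf_sum /=; apply: eq_bigr => i _; rewrite mcoeffZ.
have SQ0 : S Q@_0.
  by rewrite mcoeff0_msub; apply: meval_sub => // i; exact: closed_sub_iter.
move: RQ2 RD; move: (mmap _ _ Q2) => W RQ2 RD.
clear L L0 L1 L2 Q2 q2 tj; clearbody R Q t.
pose N := (Q@_0)^-1 *: R.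
have NE m : N@_m = R@_m / Q@_0 by rewrite mcoeffZ mulrC.
have NJ y : N.@[jet y] = P.@[jet (a + h * y)] / Q@_0 by rewrite mevalZ RE mulrC.
have SN : pover S N.
  by move=> m; rewrite mcoeffZ; apply: (subM hSr) => //; exact: (closed_subV hS).
clearbody N.
have [y [Sy y1 y0]] : exists y, [/\ S y, dle y 1 & N.@[jet y] = 0].
  apply: (closed_sub_hens hS).
  - exact: SN.
  - move=> m; rewrite NE dle_pdivl // mul1r RD; apply: (dleD hM); last exact: dltW.
    apply: (dleD hM).
      by rewrite -[X in dle _ X]mulr1; apply: (dleM hM); [exact: dle_refl | exact: dle_nat].
    apply: (dle_sum hM) => i _; rewrite -[X in dle _ X]mulr1.
    by apply: (dleM hM); [exact: hq1 | exact: tle].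
  - move=> m d; rewrite NE dlt_pdivl // mul1r RD -mdeg_eq0 eqn0Ngt (ltnW d) /= mulr0 add0r.
    by rewrite big1 ?add0r // => i _; rewrite t2 ?mulr0.
  (* Take the last [j] whose linear coefficient is maximal. As [t i] involves only variables up to
     [i], the coefficient of [U_(j)] in [R] receives, besides [Q@_U_(j)], only contributions of
     later [i] and of the nonlinear part, which are smaller. *)
  - pose p := [pred j : 'I_n | dle Q@_0 Q@_U_(j)].
    have [j pj jmax] := @arg_maxnP _ j0 p (fun j => j : nat) hj0.
    exists j; rewrite NE dle_pdivr // mul1r RD mnm1_eq0 mulr0 add0r (bigD1 j) //=.
    rewrite tE leqnn binn subnn mul1r /= divff // mulr1.
    suff : dlt (\sum_(i < n | i != j) Q@_U_(i) * (t i)@_U_(j) +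
              W@_U_(j)) Q@_U_(j).
      move=> s; apply: (dle_trans pj).
      have := @dlt_deq _ hM (Q@_U_(j) + (\sum_(i < n | i != j) Q@_U_(i) * (t i)@_U_(j) +
              W@_U_(j))) Q@_U_(j).
      by rewrite [X in dlt X _]addrC addKr addrA => /(_ s)/andP[].
    apply: dlt_le_trans pj; apply: dltD => //.
    apply: dlt_sum => // i ne; rewrite tE.
    case: ifP => ij; last by rewrite mulr0 dlt0x.
    rewrite -[X in dlt _ X]mulr1; apply: dlt_leM; rewrite ?oner_neq0 //.
      rewrite dltNge; apply/negP => /jmax ji; case/negP: ne.
      by rewrite -val_eqE eqn_leq ij andbT; exact: ji.
    by have := tle i U_(j)%MM; rewrite tE ij.
exists y; split=> //; move: y0; rewrite NJ => /eqP.
by rewrite mulf_eq0 invr_eq0 (negbTE q0) orbF => /eqP.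
Qed.

(** The scale is the value [P.@[jet a]] itself: linear coefficients then have at most its size, one
    of them exactly, and coefficients of degree at least 2 contain its square. *)
Lemma newton_simple n (P : mpoly n K) (a : K) :
  pover S P -> S a -> gle P 1 -> dle a 1 -> dlt P.@[jet a] 1 ->
  (exists j, dle 1 P^`M(j).@[jet a]) ->
  exists b, [/\ S b, dle (b - a) P.@[jet a] & P.@[jet b] = 0].
Proof.
move=> SP Sa P1 a1 Pa [j hj].
have [e|h0] := eqVneq P.@[jet a] 0.
  by exists a; split=> //; rewrite subrr dle0.
set h := P.@[jet a] in Pa h0 *.
have Ja i : dle (jet a i) 1 by apply: dle_trans a1; apply: dle_iter_der.
have SJ i : S (jet a i) by apply: closed_sub_iter.
have G : gle (msub P (jet a) 1) 1 by apply: gle_msub.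
have hD i : dle P^`M(i).@[jet a] 1.
  by apply: gle_meval => // m; rewrite mcoeff_deriv; apply: dle_mulrn.
have [] := @newton _ P a h SP Sa.
- exact: meval_sub.
- by [].
- by rewrite mcoeff0_msub.
- move=> m; rewrite mcoeff0_msub -/h msub_scale.
  case: (mdeg m) => [|[|d]] // _; rewrite exprS -mulrA -[X in dlt _ X]mulr1.
  rewrite dltM2l // -[X in dlt _ X]mulr1; apply: (dlt_leM hM); [|exact: G|exact: oner_neq0].
  rewrite exprS -[X in dlt _ X]mulr1; apply: (dlt_leM hM); [exact: Pa| |exact: oner_neq0].
  by apply: (dleX hM); apply: (dltW hM).
- by move=> i; rewrite mcoeff0_msub mcoeff1_msub -/h -[X in dle _ X]mulr1; apply: (dleM hM); [exact: dle_refl | exact: hD].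
- by exists j; rewrite mcoeff0_msub mcoeff1_msub -/h -[X in dle X _]mulr1; apply: (dleM hM); [exact: dle_refl | exact: hj].
move=> y [Sy y1 y0]; exists (a + h * y); split=> //.
  by apply: (subD hSr) => //; apply: (subM hSr) => //; exact: meval_sub.
by rewrite addrC addKr -[X in dle _ X]mulr1; apply: (dleM hM); [exact: dle_refl | exact: y1].
Qed.

End Newton.

(** * Adjusting logarithmic derivatives and roots *)

Section ModelLemmas.
Variable M : structure.
Hypothesis hM : is_model M.
Local Notation K := (fsort M).
Local Notation dle := (@dle M).
Local Notation dlt := (@dlt M).
Local Notation deq := (@deq M).

Lemma dle_logder (a : K) : a != 0 -> dle (logder a) 1.
Proof. by move=> a0; rewrite /logder dle_pdivl // mul1r; apply: dle_der. Qed.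

Section Closed.
Variable S : K -> Prop.
Hypothesis hS : closed_sub S.
Let hSr := closed_sub_ring hS.

(** Put [x1 = x (1 + y)]. The requirement becomes the linear equation [y' = e (1 + y)] with [e] in
    the maximal ideal, solved approximately by [y = 0]. *)
Lemma adjust_logder (x t : K) : S x -> S t -> x != 0 -> dlt (logder x - t) 1 ->
  exists x1, [/\ S x1, dlt (x1 - x) x & logder x1 = t].
Proof.
move=> Sx St x0 h; set e := t - logder x.
have e1 : dlt e 1 by rewrite /e -(opprB (logder x)) (dltN hM).
have Se : S e.
  by apply: (subB hSr) => //; apply: (subM hSr); [apply: (closed_sub_der hS) | apply: (closed_subV hS)].
pose i0 : 'I_2 := ord0; pose i1 : 'I_2 := ord_max.
pose P : mpoly 2 K := 'X_i1 - e%:MP * (1 + 'X_i0).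
have j0 (y : K) : P.@[jet y] = der y - e * (1 + y).
  by rewrite mevalB mevalM mevalC mevalD meval1 !mevalXU.
have [] := @newton_simple M hM S hS 2 P 0.
- apply: (subB (pover_subring hSr 2)); first exact: poverXm.
  apply: (subM (pover_subring hSr 2)); first exact: poverC.
  by apply: (subD (pover_subring hSr 2)); [exact: (sub1 (pover_subring hSr 2)) | exact: poverXm].
- exact: sub0.
- apply: (gleB hM); first exact: gle1X.
  rewrite -[X in gle _ X]mulr1; apply: (gleM hM); first by apply: gle1C => //; apply: dltW.
  by apply: (gleD hM); [exact: gle11 | exact: gle1X].
- exact: dle0.
- by rewrite j0 der0 addr0 mulr1 sub0r (dltN hM).
- exists i1; rewrite mderivB mderivM mderivC mul0r add0r mderivD -(mpolyC1 2 K) mderivC !mderivX.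
  rewrite !mnm1E /= scale0r addr0 mulr0 subr0 scale1r.
  have -> : (U_(i1) - U_(i1) = 0 :> multinom 2)%MM by apply/mnmP => k; rewrite mnmBE mnm0E subnn.
  by rewrite mpolyX0 meval1.
move=> y [Sy]; rewrite subr0 !j0 der0 addr0 mulr1 sub0r dlexN // => ye /eqP; rewrite subr_eq0 => /eqP ey.
have y1 : dlt y 1 by apply: dle_lt_trans ye e1.
have n1 : deq (1 + y) 1 by apply: (dlt_deq hM); rewrite addrC addKr.
have y0 : 1 + y != 0 by rewrite (deq_neq0 hM n1) oner_neq0.
exists (x * (1 + y)); split.
- by apply: (subM hSr) => //; apply: (subD hSr) => //; apply: sub1.
- by rewrite mulrDr mulr1 addrC addKr -[X in dlt _ X]mulr1 (dltM2l hM).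
- by rewrite logderM // {2}/logder derD der1 add0r ey mulfK // addrC subrK.
Qed.

(** Put [x1 = x (1 + y)]. The equation [(1 + y) ^+ n = 1 + e] has order 0, and its derivative [n] at
    [y = 0] is a unit in residue characteristic 0. *)
Lemma adjust_root (x b : K) n : S x -> S b -> x != 0 -> (0 < n)%N ->
  dlt (x ^+ n - b) b -> exists x1, [/\ S x1, dlt (x1 - x) x & x1 ^+ n = b].
Proof.
move=> Sx Sb x0 n0 h; have b0 := dlt_neq0 hM h.
have xn0 : x ^+ n != 0 by rewrite expf_neq0.
set e := b / x ^+ n - 1.
have e1 : dlt e 1.
  have -> : e = - ((x ^+ n - b) / x ^+ n) by rewrite /e -mulNr opprB mulrBl divff.
  rewrite (dltN hM) (dlt_pdivl hM) // mul1r; have /andP[_ p] := dlt_deq hM h.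
  exact: dlt_le_trans p.
have Se : S e.
  apply: (subB hSr); last exact: sub1.
  by apply: (subM hSr) => //; apply: (closed_subV hS); apply: subX.
pose P : mpoly 1 K := (1 + 'X_ord0) ^+ n - (1 + e)%:MP.
have j0 (y : K) : P.@[jet y] = (1 + y) ^+ n - (1 + e).
  by rewrite mevalB mevalC rmorphXn /= mevalD meval1 mevalXU.
have X1 : gle (1 + 'X_ord0 : mpoly 1 K) 1 by apply: (gleD hM); [exact: gle11 | exact: gle1X].
have D1 k : ((1 + 'X_ord0 : mpoly 1 K) ^+ k)^`M(ord0) = (1 + 'X_ord0) ^+ k.-1 *+ k.
  have dx : (1 + 'X_ord0 : mpoly 1 K)^`M(ord0) = 1.
    rewrite mderivD -(mpolyC1 1 K) mderivC add0r mderivX mnm1E eqxx scale1r.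
    have -> : (U_(ord0) - U_(ord0) = 0 :> multinom 1)%MM by apply/mnmP => i; rewrite mnmBE mnm0E subnn.
    by rewrite mpolyX0 mpolyC1.
  elim: k => [|k IH]; first by rewrite expr0 -(mpolyC1 1 K) mderivC.
  rewrite exprS mderivM dx mul1r IH mulrS; congr (_ + _).
  by case: k {IH} => [|k]; rewrite ?mulr0n ?mulr0 // mulrnAr exprS.
have [] := @newton_simple M hM S hS 1 P 0.
- apply: (subB (pover_subring hSr 1)).
    apply: (subX (pover_subring hSr 1)).
    by apply: (subD (pover_subring hSr 1)); [exact: (sub1 (pover_subring hSr 1)) | exact: poverXm].
  by apply: poverC => //; apply: (subD hSr) => //; apply: sub1.
- exact: sub0.
- apply: (gleB hM).
    elim: (n) => [|k IH]; first by rewrite expr0; apply: gle11.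
    by rewrite exprS -[X in gle _ X]mulr1; apply: (gleM hM).
  by apply: gle1C => //; apply: (dleD hM); [exact: dle_refl | exact: dltW].
- exact: dle0.
- by rewrite j0 addr0 expr1n opprD addrA subrr sub0r (dltN hM).
- exists ord0; rewrite mderivB mderivC subr0 D1 mevalMn rmorphXn /= mevalD meval1 mevalXU /jet /= addr0 expr1n.
  by have : deq n%:R 1 by [apply: deq_natr => //; rewrite -lt0n]; case/andP.
move=> y [Sy]; rewrite subr0 [P.@[jet 0]]j0 addr0 expr1n opprD addrA subrr sub0r dlexN // => ye.
rewrite j0 => /eqP; rewrite subr_eq0 => /eqP ey; have y1 : dlt y 1 by apply: dle_lt_trans ye e1.
exists (x * (1 + y)); split.
- by apply: (subM hSr) => //; apply: (subD hSr) => //; apply: sub1.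
- by rewrite mulrDr mulr1 addrC addKr -[X in dlt _ X]mulr1 (dltM2l hM).
- by rewrite exprMn ey /e addrC subrK mulrC divfK.
Qed.
End Closed.

(* The two clauses relating ac to logarithmic derivatives, merged: an element
   with logarithmic derivative in the maximal ideal is asymptotic to a constant. *)
Lemma res_logder (a : K) g : valuation a = Some g ->
  res (logder a) = logder (ac a) + cmap g.
Proof.
move=> e; have a0 : a != 0 by rewrite -(val_eqN hM) e.
have [_ [_ h1 h2]] := model_ac hM.
have [s|s] := boolP (dlt (logder a) 1); last first.
  have q : deq (der a) a.
    by move: s; rewrite dltNge negbK /logder dle_pdivr // mul1r => s; rewrite /deq s dle_der.
  rewrite -h1 //; last by rewrite -e; apply/deqE.
  by rewrite (ac_res hM) // /logder deq_divr // mul1r.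
have sa : dlt (logder a - 0) 1 by rewrite subr0.
have [d [_ dx d0]] := @adjust_logder (fun=> True) (closed_subT hM) a 0 I I a0 sa.
have dn0 : d != 0.
  by rewrite (deq_neq0 hM (dlt_deq hM dx)).
have d0' : der d = 0.
  by move/eqP: d0; rewrite /logder mulf_eq0 invr_eq0 (negbTE dn0) orbF => /eqP.
rewrite (res_small hM s) -(ac_near hM dx) (h2 _ g) ?addNr //.
by rewrite -e; apply/deqE => //; apply: dlt_deq.
Qed.

End ModelLemmas.

(** * Degree in the highest derivative *)

Section LastVariable.
Variables (R : comNzRingType) (n : nat).
Implicit Types (P Q : mpoly n.+1 R) (I : mpoly n R).

Lemma pover_ind (S : R -> Prop) l (T : mpoly l R -> Prop) : is_subring S ->
  (forall c, S c -> T c%:MP) -> (forall i, T 'X_i) ->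
  (forall p q, T p -> T q -> T (p + q)) -> (forall p q, T p -> T q -> T (p * q)) ->
  forall p, pover S p -> T p.
Proof.
move=> hS hC hX hD hM p hp; rewrite (mpolyE p); apply: (big_ind T) => //.
  by rewrite -(mpolyC0 l R); apply: hC; apply: sub0.
move=> m _; rewrite -mul_mpolyC; apply: (hM); first exact: hC.
have T1 : T 1 by rewrite -(mpolyC1 l R); apply: hC; apply: sub1.
rewrite mpolyXE_id; apply: (big_ind T) => // i _.
by elim: (m i) => [|d IH]; rewrite ?expr0 // exprS; apply: hM.
Qed.

(** A bound rather than a degree: the zero polynomial is then the case [d = 0]. *)
Definition dlast P d := forall m : multinom n.+1, (d <= m ord_max)%N -> P@_m = 0.

Lemma dlast0 P : dlast P 0 -> P = 0.
Proof. by move=> h; apply/mpolyP => m; rewrite mcoeff0; apply: h. Qed.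

Lemma dlastS P d e : (d <= e)%N -> dlast P d -> dlast P e.
Proof. by move=> de h m em; apply: h; apply: leq_trans em. Qed.

Lemma dlast_ex P : exists d, dlast P d.
Proof.
exists (msize P) => m h; apply: memN_msupp_eq0; apply: msize_mdeg_ge.
by apply: (leq_trans h); rewrite mdegE (bigD1 ord_max) //= leq_addr.
Qed.

Lemma dlastB P Q d : dlast P d -> dlast Q d -> dlast (P - Q) d.
Proof. by move=> p q m h; rewrite mcoeffB p ?q ?subr0. Qed.

Lemma dlastM P Q d e : dlast P d -> dlast Q e.+1 -> dlast (P * Q) (d + e).
Proof.
move=> p q m h; rewrite mcoeffM big1 // => k /eqP em.
have [dk|dk] := leqP d ((k.1 : multinom _) ord_max); first by rewrite p ?mul0r.
rewrite q ?mulr0 //; move: h; have -> := congr1 (fun m : multinom n.+1 => m ord_max) em.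
rewrite mnmDE => h; rewrite -(ltn_add2l d); apply: leq_ltn_trans h _.
by rewrite ltn_add2r.
Qed.

Lemma dlastX d : dlast ('X_ord_max ^+ d) d.+1.
Proof.
move=> m h; rewrite mpolyXn mcoeffX; case: eqP => // e; move: h.
by rewrite -e mulmnE mnm1E eqxx mul1n ltnn.
Qed.

Definition widen_mpoly I : mpoly n.+1 R :=
  mmap (@mpolyC n.+1 R) (fun i => 'X_(widen_ord (leqnSn n) i)) I.

Lemma dlast_widen I : dlast (widen_mpoly I) 1.
Proof.
elim/mpoly_ring_ind: I => [c|i|p q IHp IHq|p q IHp IHq].
- rewrite /widen_mpoly mmapC => m h; rewrite mcoeffC; case: eqP => [e|]; rewrite ?mulr0 //.
  by move: h; rewrite e mnm0E.
- rewrite /widen_mpoly mmapX mmap1U => m h; rewrite mcoeffX; case: eqP => // e.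
  move: h; rewrite -e mnm1E; case: eqP => // /(congr1 val) /= e'.
  by have := ltn_ord i; rewrite e' ltnn.
- by move=> m h; rewrite /widen_mpoly mmapD mcoeffD (IHp _ h) (IHq _ h) addr0.
- by rewrite /widen_mpoly rmorphM; apply: (@dlastM _ _ 1 0).
Qed.

Definition mnm_restr (m : multinom n.+1) : multinom n :=
  [multinom m (widen_ord (leqnSn n) i) | i < n].

Lemma widen_mnm_restr m :
  widen_mpoly 'X_[mnm_restr m] * 'X_ord_max ^+ (m ord_max) = 'X_[m].
Proof.
rewrite /widen_mpoly mmapX [in RHS]mpolyXE_id big_ord_recr /=; congr (_ * _).
by apply: eq_bigr => i _; rewrite mnmE.
Qed.

(** [I] is the initial of differential algebra: the coefficient of the top power of the highest
    derivative, a polynomial in the lower ones. *)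
Lemma dlast_lead (S : R -> Prop) P d : is_subring S -> pover S P -> dlast P d.+1 ->
  exists I P1, [/\ pover S I, pover S P1, dlast P1 d,
     P = widen_mpoly I * 'X_ord_max ^+ d + P1 & I = 0 -> dlast P d].
Proof.
move=> hS SP hd; have hr l := pover_subring hS l.
pose I := \sum_(m <- msupp P | m ord_max == d) P@_m *: 'X_[mnm_restr m].
pose P1 := \sum_(m <- msupp P | m ord_max != d) P@_m *: 'X_[m].
have SZ l c (m : multinom l) : S c -> pover S (c *: 'X_[m]).
  by move=> sc; rewrite -mul_mpolyC; apply: (subM (hr l)); [apply: poverC | apply: poverXm].
have d1 : dlast P1 d.
  move=> m dm; rewrite raddf_sum /= big1 // => m' ne; rewrite mcoeffZ mcoeffX.
  case: eqP => [e|]; rewrite ?mulr0 // e in ne *; rewrite hd ?mul0r //.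
  by rewrite ltn_neqAle eq_sym ne.
have eP : P = widen_mpoly I * 'X_ord_max ^+ d + P1.
  rewrite {1}(mpolyE P) (bigID (fun m : multinom n.+1 => m ord_max == d)) /=; congr (_ + _).
  rewrite /widen_mpoly raddf_sum /= mulr_suml; apply: eq_bigr => m /eqP <-.
  by rewrite -[X in _ *: X]widen_mnm_restr mmapZ scalerAl mul_mpolyC.
exists I, P1; split=> //.
- by apply: (sub_sum (hr n)) => m _; apply: SZ.
- by apply: (sub_sum (hr n.+1)) => m _; apply: SZ.
- by move=> I0; rewrite eP I0 /widen_mpoly raddf0 mul0r add0r.
Qed.

Lemma dlast_deriv P d : dlast P d.+1 -> dlast P^`M(ord_max) d.
Proof.
move=> h m dm; rewrite mcoeff_deriv h ?mul0rn //.
by rewrite mnmDE mnm1E eqxx addn1.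
Qed.

Lemma dlast_deriv_le P d i : dlast P d -> dlast P^`M(i) d.
Proof.
move=> h m dm; rewrite mcoeff_deriv h ?mul0rn //.
by rewrite mnmDE; apply: leq_trans dm (leq_addr _ _).
Qed.

Lemma msize_deriv l (P : mpoly l R) i : P^`M(i) != 0 -> (msize P^`M(i) < msize P)%N.
Proof.
move=> n0; have [m ms e] : exists2 m, m \in msupp P^`M(i) & msize P^`M(i) = (mdeg m).+1.
  by exists (mlead P^`M(i)); [apply: mlead_supp | rewrite mlead_deg].
rewrite e; move: ms; rewrite mcoeff_msupp mcoeff_deriv => h.
have : (m + U_(i))%MM \in msupp P.
  by rewrite mcoeff_msupp; apply: contra_neq h => ->; rewrite mul0rn.
by move/msize_mdeg_lt; rewrite mdegD mdeg1 addn1.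
Qed.

End LastVariable.

(** * Partial embeddings as subrings of the product *)

Section Embedding.
Variables M N : structure.
Hypotheses (hM : is_model M) (hN : is_model N).
Local Notation K := (fsort M).
Local Notation L := (fsort N).
Local Notation A := (K * L)%type.
Implicit Types (a b : A).

Definition pder a : A := (der a.1, der a.2).
Definition pinv a : A := (a.1^-1, a.2^-1).

Lemma pderD a b : pder (a + b) = pder a + pder b.
Proof. by rewrite /pder /= !derD. Qed.
Lemma pderM a b : pder (a * b) = pder a * b + a * pder b.
Proof. by rewrite /pder /= !derM. Qed.
Lemma pder0 : pder 0 = 0. Proof. by rewrite /pder !der0. Qed.
Lemma pder1 : pder 1 = 0. Proof. by rewrite /pder !der1. Qed.
Lemma pderN a : pder (- a) = - pder a.
Proof. by rewrite /pder /= !derN. Qed.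
Lemma pderB a b : pder (a - b) = pder a - pder b.
Proof. by rewrite pderD pderN. Qed.

(* [Rk] and [RG] are the graphs of partial isomorphisms between the residue
   fields and between the value groups. *)
Record rv_iso (S : K -> Prop) (Rk : rsort M -> rsort N -> Prop)
    (RG : vsort M -> vsort N -> Prop) : Prop := RvIso {
  rv_sub : closed_sub S;
  rv_inj : forall u u' w w', Rk u u' -> Rk w w' -> (u = w <-> u' = w');
  rv_ring : is_subring (fun p : rsort M * rsort N => Rk p.1 p.2);
  rv_inv : forall u u', Rk u u' -> Rk u^-1 u'^-1;
  rv_der : forall u u', Rk u u' -> Rk (der u) (der u');
  rv_le : forall g g' h h', RG g g' -> RG h h' -> (g <= h) = (g' <= h');
  rv_add : forall g g' h h', RG g g' -> RG h h' -> RG (g + h) (g' + h');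
  rv_opp : forall g g', RG g g' -> RG (- g) (- g');
  rv_cmap : forall g g', RG g g' -> Rk (cmap g) (cmap g');
  rv_domk : forall x, S x -> exists u', Rk (ac x) u';
  rv_domG : forall x g, S x -> valuation x = Some g -> exists g', RG g g'
}.

Variables (S : K -> Prop) (Rk : rsort M -> rsort N -> Prop)
  (RG : vsort M -> vsort N -> Prop).
Hypothesis rv : rv_iso S Rk RG.
Let hS := rv_sub rv.
Let hSr := closed_sub_ring hS.

(** Only the leading terms of the two coordinates are compared. The condition [S a.1] keeps the
    domain of every embedding inside [S]. *)
Definition compat a : Prop := S a.1 /\
  ((a.1 = 0 /\ a.2 = 0) \/ exists g g',
    [/\ valuation a.1 = Some g, valuation a.2 = Some g', RG g g' & Rk (ac a.1) (ac a.2)]).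

Lemma rk1 : Rk 1 1. Proof. exact: (sub1 (rv_ring rv)). Qed.
Lemma rk0 : Rk 0 0. Proof. exact: (sub0 (rv_ring rv)). Qed.
Lemma rkM u u' w w' : Rk u u' -> Rk w w' -> Rk (u * w) (u' * w').
Proof. exact: (@subM _ _ (rv_ring rv) (u, u') (w, w')). Qed.
Lemma rkD u u' w w' : Rk u u' -> Rk w w' -> Rk (u + w) (u' + w').
Proof. exact: (@subD _ _ (rv_ring rv) (u, u') (w, w')). Qed.
Lemma rkN u u' : Rk u u' -> Rk (- u) (- u').
Proof. exact: (@subN _ _ (rv_ring rv) (u, u')). Qed.

Lemma rg0 : RG 0 0.
Proof.
have [g' h] := rv_domG rv (sub1 hSr) (val1 hM).
by rewrite -(subrr 0) -(subrr g'); apply: (rv_add rv) => //; apply: (rv_opp rv).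
Qed.

(** Applied to differences: an additive group of compatible pairs is the graph of an injective
    function. *)
Lemma compat_eq0 a : compat a -> (a.1 == 0) = (a.2 == 0).
Proof.
case=> _ [[-> ->]|[g [g' [e e' _ _]]]]; first by rewrite !eqxx.
by rewrite -(val_eqN hM) -(val_eqN hN) e e'.
Qed.

Lemma compat_zero a : compat a -> a.1 = 0 -> a = 0.
Proof.
by case: a => a1 a2 /compat_eq0 /= e /eqP z; move: z (z); rewrite {1}e => /eqP -> /eqP ->.
Qed.

Lemma compat0 : compat 0.
Proof. by split; [exact: (sub0 hSr) | left]. Qed.

Lemma compat1 : compat 1.
Proof.
split; first exact: (sub1 hSr).
by right; exists 0, 0; rewrite (val1 hM) (val1 hN) (ac1 hM) (ac1 hN); split=> //; [exact: rg0 | exact: rk1].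
Qed.

Lemma compatM a b : compat a -> compat b -> compat (a * b).
Proof.
move=> [Sa ca] [Sb cb]; split; first exact: (subM hSr).
case: ca => [[a1 a2]|[g [g' [p1 p2 p3 p4]]]]; first by left; rewrite /= a1 a2 !mul0r.
case: cb => [[b1 b2]|[h [h' [q1 q2 q3 q4]]]]; first by left; rewrite /= b1 b2 !mulr0.
right; exists (g + h), (g' + h'); split.
- by rewrite (valM hM) p1 q1.
- by rewrite (valM hN) p2 q2.
- exact: (rv_add rv).
- by rewrite (acM hM) (acM hN); apply: rkM.
Qed.

Lemma valV (M0 : structure) (h0 : is_model M0) (x : fsort M0) g :
  valuation x = Some g -> valuation x^-1 = Some (- g).
Proof.
move=> e; have x0 : x != 0 by rewrite -(val_eqN h0) e.
have : valuation (x * x^-1) = Some 0 by rewrite divff // (val1 h0).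
have [h eh] : exists h, valuation x^-1 = Some h by apply: (val_some h0); rewrite invr_eq0.
rewrite (valM h0) e eh /oadd => -[] gh; congr Some; apply: (addrI g).
by rewrite gh subrr.
Qed.

Lemma compatV a : compat a -> compat (pinv a).
Proof.
case=> Sa [[a1 a2]|[g [g' [p1 p2 p3 p4]]]].
  by split; [apply: (closed_subV hS) | left; rewrite /= a1 a2 !invr0].
split; first exact: (closed_subV hS).
right; exists (- g), (- g'); split.
- exact: (valV hM).
- exact: (valV hN).
- exact: (rv_opp rv).
- by rewrite (acV hM) (acV hN); apply: (rv_inv rv).
Qed.

Lemma compatX a i : compat a -> compat (a ^+ i).
Proof.
by move=> h; elim: i => [|i IH]; rewrite ?expr0 ?exprS; [exact: compat1 | exact: compatM].
Qed.

(** Values and angular components see only leading terms, so compatibility is inherited by any pair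
    with the same ones. *)
Lemma compat_near a b : compat a -> S b.1 -> dlt (b.1 - a.1) a.1 ->
  dlt (b.2 - a.2) a.2 -> compat b.
Proof.
move=> [_ ca] Sb h1 h2; split=> //; case: ca => [[a1 a2]|[g [g' [p1 p2 p3 p4]]]].
  by move: h1; rewrite a1 (dltx0 hM).
right; exists g, g'; rewrite (ac_near hM h1) (ac_near hN h2); split=> //.
- by rewrite -p1; apply/deqE/(dlt_deq hM).
- by rewrite -p2; apply/deqE/(dlt_deq hN).
Qed.

Lemma compat_dle a b : compat a -> compat b -> dle a.1 b.1 = dle a.2 b.2.
Proof.
case=> _ [[-> ->]|[g [g' [p1 p2 p3 p4]]]]; first by rewrite (dle0 hM) (dle0 hN).
case=> _ [[-> ->]|[h [h' [q1 q2 q3 q4]]]].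
  by rewrite (dlex0 hM) (dlex0 hN) -(val_eqN hM) -(val_eqN hN) p1 p2.
by rewrite /dle p1 p2 q1 q2 /=; apply: (rv_le rv).
Qed.

Lemma compat_dlt a b : compat a -> compat b -> dlt a.1 b.1 = dlt a.2 b.2.
Proof. by move=> ca cb; rewrite /dlt (compat_dle cb ca). Qed.

Lemma compat_deq a b : compat a -> compat b -> deq a.1 b.1 = deq a.2 b.2.
Proof. by move=> ca cb; rewrite /deq !(compat_dle cb ca, compat_dle ca cb). Qed.

Lemma compat_ac a : compat a -> Rk (ac a.1) (ac a.2).
Proof.
by case=> _ [[-> ->]|[g [g' []]]] //; rewrite (ac0 hM) (ac0 hN); exact: rk0.
Qed.

Lemma pdiv_mul a b : b.1 != 0 -> b.2 != 0 -> a * b * pinv b = a.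
Proof. by move=> b1 b2; case: a => x y; rewrite /pinv; congr (_, _) => /=; rewrite mulfK. Qed.

(* Partial embeddings are represented by their graphs, subrings of the product
   ring; compatibility makes them functional and injective. *)
Definition good (F : A -> Prop) : Prop :=
  [/\ is_subring F, forall a, F a -> F (pder a) & forall a, F a -> compat a].

Definition frac (W : A -> Prop) a : Prop :=
  exists p q, [/\ W p, W q, q.1 != 0 & a = p * pinv q].

Section Frac.
Variable W : A -> Prop.
Hypothesis hW : is_subring W.
Hypothesis cW : forall a, W a -> compat a.

Let neq2 q : W q -> q.1 != 0 -> q.2 != 0.
Proof. by move=> /cW /compat_eq0 ->. Qed.

Lemma frac_sub a : W a -> frac W a.
Proof.
move=> wa; exists a, 1; split=> //; [exact: sub1 | exact: oner_neq0 | ].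
by case: a {wa} => x y; rewrite /pinv; congr (_, _); rewrite /= invr1 mulr1.
Qed.

Lemma frac_ring : is_subring (frac W).
Proof.
have q0 q : W q -> q.1 != 0 -> [/\ q.1 != 0 & q.2 != 0].
  by move=> wq q1; split=> //; apply: neq2.
split; first by apply: frac_sub; apply: sub1.
- move=> _ _ [p [q [wp wq q1 ->]]] [r [s [wr ws s1 ->]]].
  have [q1' q2'] := q0 _ wq q1; have [s1' s2'] := q0 _ ws s1.
  exists (p * s - r * q), (q * s); split.
  + by apply: (subB hW); apply: (subM hW).
  + exact: (subM hW).
  + exact: mulf_neq0.
  + case: p q r s {wp wq wr ws q1 s1} q1' q2' s1' s2' => [p p'] [q q'] [r r'] [s s'] /= *.
    by congr (_, _) => /=; field; apply/andP.
- move=> _ _ [p [q [wp wq q1 ->]]] [r [s [wr ws s1 ->]]].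
  exists (p * r), (q * s); split; [exact: (subM hW)|exact: (subM hW)|exact: mulf_neq0|].
  case: p q r s {wp wq wr ws q1 s1} => [p p'] [q q'] [r r'] [s s'].
  by congr (_, _) => /=; rewrite invfM mulrACA.
Qed.

Lemma frac_pinv q : W q -> q.1 != 0 -> frac W (pinv q).
Proof. by move=> wq q1; exists 1, q; split=> //; [exact: sub1 | rewrite mul1r]. Qed.

(** The quotient rule. Derivatives of [W] may be proper fractions; this is the case for the
    polynomial ring in the jet of a root, where the separant enters the denominator. *)
Lemma frac_good : (forall a, W a -> frac W (pder a)) -> good (frac W).
Proof.
move=> dW; split; first exact: frac_ring.
- move=> _ [p [q [wp wq q1 ->]]]; have q2 := neq2 wq q1.
  have hf := frac_ring; have fi := frac_pinv wq q1.
  have -> : pder (p * pinv q) = pder p * pinv q - p * (pder q * (pinv q * pinv q)).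
    rewrite pderM; congr (_ + _); rewrite -mulrN; congr (_ * _).
    have dV (K0 : diffField) (x : K0) : x != 0 -> der x^-1 = - (der x * (x^-1 * x^-1)).
      move=> x0; have := congr1 der (divff x0); rewrite der1 derM => /eqP.
      rewrite addrC addr_eq0 => /eqP e; apply: (mulfI x0); rewrite e; by field.
    by rewrite /pder /pinv /= !dV.
  apply: (subB hf); first by apply: (subM hf) => //; apply: dW.
  apply: (subM hf); first exact: frac_sub.
  by apply: (subM hf); [apply: dW | apply: (subM hf)].
- by move=> _ [p [q [wp wq q1 ->]]]; apply: compatM; [apply: cW | apply/compatV/cW].
Qed.
End Frac.

Definition max_good (F : A -> Prop) : Prop :=
  good F /\ forall F', good F' -> (forall a, F a -> F' a) -> forall a, F' a -> F a.

Section Maximal.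
Variable F : A -> Prop.
Hypothesis mF : max_good F.

Lemma mF_ring : is_subring F. Proof. by have [[]] := mF. Qed.
Lemma mF_der a : F a -> F (pder a). Proof. by have [[_ + _]] := mF => h _; apply: h. Qed.
Lemma mF_compat a : F a -> compat a. Proof. by have [[_ _ +]] := mF => h _; apply: h. Qed.

(** All extension arguments end here: a ring of compatible pairs around [F] whose derivatives are
    fractions is absorbed by maximality. *)
Lemma mF_absorb W : is_subring W -> (forall a, F a -> W a) ->
  (forall a, W a -> compat a) -> (forall a, W a -> frac W (pder a)) ->
  forall a, W a -> F a.
Proof.
move=> hW FW cW dW a wa; have [_ mx] := mF.
apply: (mx (frac W)); first exact: frac_good.
  by move=> b fb; apply: frac_sub => //; apply: FW.
exact: frac_sub.
Qed.

Lemma mF_inv a : F a -> F (pinv a).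
Proof.
move=> fa; have [a1|a1] := eqVneq a.1 0.
  have -> : pinv a = 0 by rewrite (compat_zero (mF_compat fa) a1) /pinv !invr0.
  exact: (sub0 mF_ring).
have [_ mx] := mF; apply: (mx (frac F)).
- by apply: frac_good; [exact: mF_ring|exact: mF_compat|move=> b fb; apply: frac_sub; [exact: mF_ring|exact: mF_der]].
- by move=> b; apply: frac_sub; exact: mF_ring.
- by apply: frac_pinv => //; exact: mF_ring.
Qed.

Lemma mF_iter i a : F a -> F (iter i pder a).
Proof. by move=> fa; elim: i => //= i; apply: mF_der. Qed.

End Maximal.
End Embedding.

(** * The embedding theorem *)

Section Extension.
Variables M N : structure.
Hypotheses (hM : is_model M) (hN : is_model N).
Local Notation K := (fsort M).
Local Notation L := (fsort N).
Local Notation A := (K * L)%type.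
Variables (S : K -> Prop) (Rk : rsort M -> rsort N -> Prop)
  (RG : vsort M -> vsort N -> Prop).
Hypothesis rv : rv_iso S Rk RG.
Local Notation compat := (compat S Rk RG).
Variable F : A -> Prop.
Hypothesis mF : max_good S Rk RG F.
Let hF := mF_ring mF.

Definition pjet n (b : A) (i : 'I_n) : A := iter i (@pder M N) b.

Lemma pjetE n b (i : 'I_n) : pjet b i = (jet b.1 i, jet b.2 i).
Proof.
rewrite /pjet /jet; elim: (i : nat) => [|d IH] /=; first by case: b.
by rewrite IH.
Qed.

Lemma meval_widen n (I : mpoly n A) b : (widen_mpoly I).@[pjet b] = I.@[pjet b].
Proof. by rewrite meval_mmap; apply: meval_eq => i; rewrite mevalXU. Qed.

Lemma pmulrn_eq0 (a : A) n : a *+ n.+1 = 0 -> a = 0.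
Proof.
have h (k : diffField) (x : k) : x *+ n.+1 = 0 -> x = 0.
  move=> /eqP; rewrite -mulr_natr mulf_eq0 => /orP[/eqP//|].
  by rewrite (negbTE (char0_natr_neq0 k _)).
case: a => x y e.
have e1 : x *+ n.+1 = 0 by rewrite -[RHS]/(fst (0 : A)) -e (raddfMn (fst : A -> K)).
have e2 : y *+ n.+1 = 0 by rewrite -[RHS]/(snd (0 : A)) -e (raddfMn (snd : A -> L)).
by rewrite (h _ _ e1) (h _ _ e2).
Qed.

(** Common scheme of the residual and the immediate case. [Z] holds the candidates for a new pair. A
    stable polynomial has compatible nonzero values on all of [Z]; an unstable one whose partial
    derivatives are stable or zero vanishes at some candidate, by a Newton step in both models. *)
Variables (Z : A -> Prop) (stab : forall n, mpoly n A -> Prop).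
Hypothesis stab_eval : forall n (P : mpoly n A), pover F P -> stab P ->
  forall b, Z b -> compat P.@[pjet b] /\ (P.@[pjet b]).1 != 0.
Hypothesis stab_root : forall n (P : mpoly n A), pover F P -> P != 0 -> ~ stab P ->
  (forall i, P^`M(i) = 0 \/ stab P^`M(i)) -> exists b, Z b /\ P.@[pjet b] = 0.
Hypothesis Z_ex : exists b, Z b.

(** With no unstable polynomial a candidate is differentially transcendental over [F] in both
    coordinates, so any candidate serves. *)
Lemma transcendental_extension :
  (forall n (P : mpoly n A), pover F P -> P != 0 -> stab P) -> exists b, Z b /\ F b.
Proof.
move=> tr; have [b Zb] := Z_ex; exists b; split=> //.
pose W a := exists n (P : mpoly n A), pover F P /\ a = P.@[pjet b].
have up n (P : mpoly n A) m : pover F P -> (n <= m)%N ->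
    exists P' : mpoly m A, pover F P' /\ P.@[pjet b] = P'.@[pjet b].
  move=> FP; elim: m => [|m IH]; first by rewrite leqn0 => /eqP e; subst n; exists P.
  rewrite leq_eqVlt => /orP[/eqP e|/IH[P' [FP' ->]]]; first by subst n; exists P.
  exists (widen_mpoly P'); split; last by rewrite meval_widen.
  by apply: pover_mmap => // i; apply: poverXm.
have W2 a c : W a -> W c -> exists n (P Q : mpoly n A),
    [/\ pover F P, pover F Q, a = P.@[pjet b] & c = Q.@[pjet b]].
  move=> [n [P [FP ->]]] [m [Q [FQ ->]]].
  have [P' [FP' ->]] := up n P (maxn n m) FP (leq_maxl _ _).
  have [Q' [FQ' ->]] := up m Q (maxn n m) FQ (leq_maxr _ _).
  by exists (maxn n m), P', Q'.
have FW a : F a -> W a.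
  by move=> fa; exists 0, a%:MP; rewrite mevalC; split=> //; apply: poverC.
have WX i : W (iter i (@pder M N) b).
  by exists i.+1, 'X_(ord_max); rewrite mevalXU; split=> //; apply: poverXm.
have hW : is_subring W.
  split; first by apply: FW; apply: sub1.
    move=> a c Wa Wc; have [n [P [Q [FP FQ -> ->]]]] := W2 _ _ Wa Wc.
    by exists n, (P - Q); rewrite mevalB; split=> //; apply: (subB (pover_subring hF n)).
  move=> a c Wa Wc; have [n [P [Q [FP FQ -> ->]]]] := W2 _ _ Wa Wc.
  by exists n, (P * Q); rewrite mevalM; split=> //; apply: (subM (pover_subring hF n)).
have cW a : W a -> compat a.
  move=> [n [P [FP ->]]]; have [->|P0] := eqVneq P 0; first by rewrite meval0; apply: compat0 rv.
  by have [] := stab_eval FP (tr _ _ FP P0) Zb.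
apply: (mF_absorb hM hN rv mF hW FW cW _ (WX 0%N)) => a [n [P [FP ->]]].
apply: (frac_sub hW).
suff [//] : W P.@[pjet b] /\ W (pder P.@[pjet b]).
(* The pairs lying in [W] together with their derivatives form a subring, so it is enough to
   consider coefficients and entries of the jet. *)
apply: (@meval_sub _ (fun a => W a /\ W (pder a))).
- split; first by rewrite pder1; split; [apply: FW; apply: sub1 | apply: FW; apply: sub0].
    by move=> x y [x1 x2] [y1 y2]; rewrite pderB; split; apply: (subB hW).
  move=> x y [x1 x2] [y1 y2]; rewrite pderM; split; first exact: (subM hW).
  by apply: (subD hW); apply: (subM hW).
- by move=> m; split; apply: FW => //; apply: (mF_der mF).
- by move=> i; split; [exact: WX | exact: (WX i.+1)].
Qed.

(* A root [b] of a polynomial [G] of least rank: evaluation at [b] is governed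
   by pseudo-division by [G] in the last variable, and the separant of [G]
   expresses the next derivative of [b] as a fraction. *)
Lemma algebraic_extension n (G I G1 : mpoly n.+1 A) (I0 : mpoly n A) d b :
  Z b -> pover F G -> pover F I0 -> pover F G1 -> dlast G1 d ->
  I = widen_mpoly I0 -> G = I * 'X_ord_max ^+ d + G1 -> G.@[pjet b] = 0 ->
  compat I0.@[pjet b] -> (I0.@[pjet b]).1 != 0 ->
  (forall R : mpoly n.+1 A, pover F R -> dlast R d -> R != 0 ->
     compat R.@[pjet b] /\ (R.@[pjet b]).1 != 0) ->
  G^`M(ord_max) != 0 -> F b.
Proof.
move=> Zb FG FI0 FG1 dG1 IE GE G0 cI I1 low S0.
have hr l := pover_subring hF l.
have FI : pover F I.
  by rewrite IE; apply: pover_mmap => // i; apply: poverXm.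
have Ib : I.@[pjet b] = I0.@[pjet b] by rewrite IE meval_widen.
pose W a := exists P : mpoly n.+1 A, pover F P /\ a = P.@[pjet b].
have FW a : F a -> W a.
  by move=> fa; exists a%:MP; rewrite mevalC; split=> //; apply: poverC.
have hW : is_subring W.
  split; first by apply: FW; apply: sub1.
    move=> _ _ [P [FP ->]] [Q [FQ ->]]; exists (P - Q); rewrite mevalB.
    by split=> //; apply: (subB (hr _)).
  move=> _ _ [P [FP ->]] [Q [FQ ->]]; exists (P * Q); rewrite mevalM.
  by split=> //; apply: (subM (hr _)).
have WX (i : 'I_n.+1) : W (pjet b i).
  by exists 'X_i; rewrite mevalXU; split=> //; apply: poverXm.
(* Pseudo-division by [G]: after multiplication by the initial, the top power of the last variable
   is replaced by means of [G.@[pjet b] = 0], and the degree bound drops. *)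
have division j (P : mpoly n.+1 A) : pover F P -> dlast P j ->
    exists k (R : mpoly n.+1 A), [/\ pover F R, dlast R d & I0.@[pjet b] ^+ k * P.@[pjet b] = R.@[pjet b]].
  elim: j P => [|j IH] P FP dP.
    by exists 0, P; split=> //; [exact: dlastS dP | rewrite expr0 mul1r].
  have [jd|dj] := leqP j.+1 d.
    by exists 0, P; split=> //; [exact: dlastS dP | rewrite expr0 mul1r].
  have [c [P1 [Fc FP1 dP1 PE _]]] := dlast_lead hF FP dP.
  have Fc' : pover F (widen_mpoly c) by apply: pover_mmap => // i; apply: poverXm.
  have FX : pover F ('X_ord_max ^+ (j - d) : mpoly n.+1 A).
    by apply: (subX (hr _)); apply: poverXm.
  pose P2 := I * P1 - widen_mpoly c * 'X_ord_max ^+ (j - d) * G1.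
  have [||k [R [FR dR e]]] := IH P2.
  - apply: (subB (hr _)); first by apply: (subM (hr _)).
    by apply: (subM (hr _)) => //; apply: (subM (hr _)).
  - apply: dlastB.
      by rewrite mulrC -[j]addn0; apply: dlastM => //; rewrite IE; apply: dlast_widen.
    rewrite mulrC; apply: (@dlastS _ _ _ (d + (j - d))); first by rewrite subnKC.
    by apply: dlastM => //; apply: (@dlastM _ _ _ _ 1); [exact: dlast_widen | exact: dlastX].
  exists k.+1, R; split=> //; rewrite -e exprSr -mulrA; congr (_ * _).
  have G1E : G1.@[pjet b] = - (I.@[pjet b] * ('X_ord_max ^+ d : mpoly n.+1 A).@[pjet b]).
    by apply/eqP; rewrite -addr_eq0 addrC -mevalM -mevalD -GE G0.
  rewrite PE mevalB !mevalM G1E mevalD mevalM -Ib !rmorphXn /= -{1}(subnKC (dj : (d <= j)%N)) exprD.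
  by ring.
have cW a : W a -> compat a.
  move=> [P [FP ->]]; have [j dj] := dlast_ex P.
  have [k [R [FR dR e]]] := division j P FP dj.
  have cR : compat R.@[pjet b].
    have [->|R0] := eqVneq R 0; first by rewrite meval0; apply: compat0 rv.
    by have [] := low _ FR dR R0.
  have cIk := compatX hM hN rv k cI.
  have Ik1 : (I0.@[pjet b] ^+ k).1 != 0.
    by rewrite (rmorphXn (fst : A -> K)) expf_neq0.
  rewrite -(pdiv_mul P.@[pjet b] Ik1) -?(compat_eq0 hM hN cIk) //.
  rewrite mulrC in e; rewrite e; apply: (compatM hM hN rv) => //.
  exact: (compatV hM hN rv).
have FS : pover F G^`M(ord_max) by apply: pover_deriv.
have dS : dlast G^`M(ord_max) d.
  apply: dlast_deriv; rewrite GE => m dm; rewrite mcoeffD dG1 ?addr0; last exact: ltnW.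
  have := @dlastM _ _ (I : mpoly n.+1 A) ('X_ord_max ^+ d) 1 d.
  by rewrite IE add1n; apply=> //; [exact: dlast_widen | exact: dlastX].
have [cS S1] := low _ FS dS S0.
have hfr := frac_ring hM hN hW cW.
(* Differentiating an element of [W] can leave [W] only through the derivative of the highest entry
   of the jet, which occurs with the last partial derivative as factor. *)
have last_der (P : mpoly n.+1 A) : pover F P -> [/\ W P.@[pjet b], W P^`M(ord_max).@[pjet b] &
    exists w, W w /\ pder P.@[pjet b] = w + P^`M(ord_max).@[pjet b] * pder (pjet b (@ord_max n))].
  move: P; refine (@pover_ind A F n.+1 (fun P : mpoly n.+1 A =>
    [/\ W P.@[pjet b], W P^`M(ord_max).@[pjet b] & exists w, W w /\
      pder P.@[pjet b] = w + P^`M(ord_max).@[pjet b] * pder (pjet b (@ord_max n))]) hF _ _ _ _).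
  - move=> c fc; rewrite mderivC meval0 mevalC; split; [exact: FW|exact: (sub0 hW)|].
    by exists (pder c); rewrite mul0r addr0; split=> //; apply: FW; apply: (mF_der mF).
  - move=> i; rewrite mevalXU mderivX mnm1E; have [->|ne] := eqVneq i ord_max.
      have -> : (U_(ord_max) - U_(ord_max) = 0 :> multinom n.+1)%MM.
        by apply/mnmP => k; rewrite mnmBE mnm0E subnn.
      rewrite scale1r mpolyX0 meval1; split; [exact: WX|exact: (sub1 hW)|].
      by exists 0; rewrite add0r mul1r; split=> //; exact: (sub0 hW).
    rewrite scale0r meval0; split; [exact: WX|exact: (sub0 hW)|].
    exists (pder (pjet b i)); rewrite mul0r addr0; split=> //.
    have lt : (i.+1 < n.+1)%N.
      by rewrite ltnS ltn_neqAle -ltnS ltn_ord andbT; apply: contra ne => /eqP e; apply/eqP/val_inj.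
    exact: (WX (Ordinal lt)).
  - move=> p q [p1 p2 [w [Ww pE]]] [q1 q2 [w' [Ww' qE]]].
    rewrite mderivD !mevalD pderD; split; [exact: (subD hW)|exact: (subD hW)|].
    exists (w + w'); split; first exact: (subD hW).
    by rewrite pE qE; ring.
  - move=> p q [p1 p2 [w [Ww pE]]] [q1 q2 [w' [Ww' qE]]].
    rewrite mderivM mevalD !mevalM pderM; split; [exact: (subM hW)|by apply: (subD hW); apply: (subM hW)|].
    exists (w * q.@[pjet b] + p.@[pjet b] * w'); split.
      by apply: (subD hW); apply: (subM hW).
    by rewrite pE qE; ring.
have last_frac : frac W (pder (pjet b (@ord_max n))).
  have [_ WS [w [Ww]]] := last_der G FG.
  rewrite G0 pder0 => /esym/eqP; rewrite addrC addr_eq0 => /eqP e.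
  exists (- w), G^`M(ord_max).@[pjet b]; split=> //; first exact: (subN hW).
  rewrite -e [_ * pder _]mulrC pdiv_mul // -(compat_eq0 hM hN cS) //.
apply: (mF_absorb hM hN rv mF hW FW cW _ (WX ord0)) => a [P [FP ->]].
have [_ WS [w [Ww ->]]] := last_der P FP.
apply: (subD hfr); first exact: frac_sub.
by apply: (subM hfr) => //; exact: frac_sub.
Qed.

(** Rank is minimized in three stages: number of variables, degree in the last variable, total size.
    The third makes every partial derivative of the minimal unstable polynomial stable or zero, as
    [stab_root] demands, even one that lowers neither of the first two. *)
Lemma extension : exists b, Z b /\ F b.
Proof.
have [h|] := pselect (exists n (P : mpoly n A), [/\ pover F P, P != 0 & ~ stab P]); last first.
  move=> h; apply: transcendental_extension => n P FP P0; apply: contrapT => nS.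
  by apply: h; exists n, P.
pose p1 n := `[< exists P : mpoly n A, [/\ pover F P, P != 0 & ~ stab P] >].
have ex1 : exists n, p1 n by case: h => n h; exists n; apply/asboolP.
case: (ex_minnP ex1) => n /asboolP[P0 [FP0 P0n nP0]] minn.
have minn' k (P : mpoly k A) : (k < n)%N -> pover F P -> P != 0 -> stab P.
  move=> kn FP Pn; apply: contrapT => nP.
  by have : p1 k by [apply/asboolP; exists P]; move/minn; rewrite leqNgt kn.
case: n P0 FP0 P0n nP0 minn' {minn} => [|n] P0 FP0 P0n nP0 low1.
  have [[]//|b [Zb]] := stab_root FP0 P0n nP0.
  by rewrite [P0]nvar0_mpolyC mevalC => e; move: P0n; rewrite [P0]nvar0_mpolyC e mpolyC0 eqxx.
pose p2 d := `[< exists P : mpoly n.+1 A, [/\ pover F P, P != 0, ~ stab P & dlast P d] >].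
have ex2 : exists d, p2 d.
  by have [d hd] := dlast_ex P0; exists d; apply/asboolP; exists P0.
case: (ex_minnP ex2) => d /asboolP[P1 [FP1 P1n nP1 dP1]] mind.
have low2 e (P : mpoly n.+1 A) : (e < d)%N -> dlast P e -> pover F P -> P != 0 -> stab P.
  move=> ed de FP Pn; apply: contrapT => nP.
  by have : p2 e by [apply/asboolP; exists P]; move/mind; rewrite leqNgt ed.
pose p3 s := `[< exists P : mpoly n.+1 A,
  [/\ pover F P, P != 0, ~ stab P, dlast P d & msize P = s] >].
have ex3 : exists s, p3 s by exists (msize P1); apply/asboolP; exists P1.
case: (ex_minnP ex3) => s /asboolP[G [FG Gn nG dG sG]] mins.
have derG i : G^`M(i) = 0 \/ stab G^`M(i).
  have [->|Dn] := eqVneq G^`M(i) 0; [by left|right; apply: contrapT => nD].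
  have : p3 (msize G^`M(i)).
    by apply/asboolP; exists G^`M(i); split=> //; [apply: pover_deriv | apply: dlast_deriv_le].
  by move/mins; rewrite -sG leqNgt msize_deriv.
have [b [Zb Gb]] := stab_root FG Gn nG derG; exists b; split=> //.
case: d dG low2 {mind p3 ex3 mins ex2 dP1} => [/dlast0 e|d dG low2].
  by rewrite e eqxx in Gn.
have [I0 [G1 [FI0 FG1 dG1 GE I00]]] := dlast_lead hF FG dG.
have I0n : I0 != 0.
  by apply/eqP => /I00 dG'; apply: nG; apply: (low2 d).
have sI0 : stab I0 by apply: low1.
have [cI I1] := stab_eval FI0 sI0 Zb.
apply: (@algebraic_extension n G _ G1 I0 d b) => //.
  by move=> R FR dR Rn; apply: stab_eval => //; apply: (low2 d).
(* In characteristic 0 a vanishing separant means that the last variable does not occur. Then [G] is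
   its own initial, whose value at [b] is nonzero. *)
apply/eqP => D0.
have d1 : dlast G 1.
  move=> m m1; apply/eqP/negP => /negP Gm.
  have := congr1 (mcoeff (m - U_(ord_max))%MM) D0.
  rewrite mcoeff_deriv mcoeff0 submK; last by rewrite lep1mP -lt0n.
  by move/pmulrn_eq0 => /eqP; rewrite (negbTE Gm).
case: d dG low2 dG1 GE {I00} => [|d] dG low2 dG1 GE; last first.
  by apply: nG; apply: (low2 1%N).
move: Gb; rewrite GE (dlast0 dG1) addr0 expr0 mulr1 meval_widen => e.
by move: I1; rewrite e eqxx.
Qed.

End Extension.

Lemma map_msub (R R' : comNzRingType) (f : {rmorphism R -> R'}) n (P : mpoly n R) e h :
  map_mpoly f (msub P e h) = msub (map_mpoly f P) (fun i => f (e i)) (f h).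
Proof.
elim/mpoly_ring_ind: P => [c|i|p q IHp IHq|p q IHp IHq].
- by rewrite msubC !map_mpolyC msubC.
- rewrite msubX rmorphD rmorphM /= !map_mpolyC map_mpolyX.
  by rewrite -[in RHS](map_mpolyX f U_(i)) map_mpolyX msubX.
- by rewrite msubD !rmorphD /= msubD IHp IHq.
- by rewrite msubM !rmorphM /= msubM IHp IHq.
Qed.

Lemma map_meval (R R' : comNzRingType) (f : {rmorphism R -> R'}) n (P : mpoly n R) x :
  f P.@[x] = (map_mpoly f P).@[fun i => f (x i)].
Proof.
elim/mpoly_ring_ind: P => [c|i|p q IHp IHq|p q IHp IHq].
- by rewrite map_mpolyC !mevalC.
- by rewrite map_mpolyX !mevalXU.
- by rewrite mevalD !raddfD /= IHp IHq.
- by rewrite mevalM !rmorphM /= IHp IHq.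
Qed.

Lemma map_mderiv (R R' : comNzRingType) (f : {rmorphism R -> R'}) n (P : mpoly n R) i :
  (map_mpoly f P)^`M(i) = map_mpoly f P^`M(i).
Proof. by apply/mpolyP => m; rewrite mcoeff_deriv !mcoeff_map_mpoly /= mcoeff_deriv raddfMn. Qed.

(** * Extending the residues *)

Section ResidueExtension.
Variables M N : structure.
Hypotheses (hM : is_model M) (hN : is_model N).
Local Notation K := (fsort M).
Local Notation L := (fsort N).
Local Notation A := (K * L)%type.
Variables (S : K -> Prop) (Rk : rsort M -> rsort N -> Prop)
  (RG : vsort M -> vsort N -> Prop).
Hypothesis rv : rv_iso S Rk RG.
Local Notation compat := (compat S Rk RG).
Let hS := rv_sub rv.
Let hSr := closed_sub_ring hS.
Variable F : A -> Prop.
Hypothesis mF : max_good S Rk RG F.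
Let hF := mF_ring mF.

Local Notation fst1 := (fst : {rmorphism A -> K}).
Local Notation snd2 := (snd : {rmorphism A -> L}).
Local Notation P1 P := (map_mpoly fst1 P).
Local Notation P2 P := (map_mpoly snd2 P).

Lemma pmulVK (a b : A) : b.1 != 0 -> b.2 != 0 -> b * (pinv b * a) = a.
Proof. by move=> b1 b2; rewrite mulrCA mulrC [b * a]mulrC pdiv_mul. Qed.

Lemma pmeval1 n (P : mpoly n A) b : (P.@[@pjet M N n b]).1 = (P1 P).@[jet b.1].
Proof. by rewrite (map_meval fst1); apply: meval_eq => i; rewrite pjetE. Qed.

Lemma pmeval2 n (P : mpoly n A) b : (P.@[@pjet M N n b]).2 = (P2 P).@[jet b.2].
Proof. by rewrite (map_meval snd2); apply: meval_eq => i; rewrite pjetE. Qed.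

Lemma pmcoeff1 n (P : mpoly n A) m : (P1 P)@_m = (P@_m).1.
Proof. by rewrite mcoeff_map_mpoly. Qed.

Lemma pmcoeff2 n (P : mpoly n A) m : (P2 P)@_m = (P@_m).2.
Proof. by rewrite mcoeff_map_mpoly. Qed.

Lemma mF_S a : F a -> S a.1.
Proof. by move=> /(mF_compat mF) []. Qed.

Lemma pover_S n (P : mpoly n A) : pover F P -> pover S (P1 P).
Proof. by move=> FP m; rewrite pmcoeff1; apply: mF_S. Qed.

(** Weaker than compatibility, since nothing relates the values of two small coordinates, but closed
    under addition and derivation. For units compatibility is recovered in [integral_compat]. *)
Definition integral_pair (a : A) : Prop :=
  [/\ dle a.1 1, dle a.2 1 & Rk (res a.1) (res a.2)].

Lemma integral_pair_ring : is_subring integral_pair.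
Proof.
split.
- by split; rewrite ?dle_refl // (res1 hM) (res1 hN); apply: (rk1 rv).
- move=> a b [a1 a2 a3] [b1 b2 b3]; split; [exact: dleB|exact: dleB|].
  by rewrite (resB hM) // (resB hN) //; apply: (rkD rv) => //; apply: (rkN rv).
- move=> a b [a1 a2 a3] [b1 b2 b3]; split.
  + by rewrite -[1]mulr1; apply: dleM.
  + by rewrite -[1]mulr1; apply: dleM.
  + by rewrite (resM hM) // (resM hN) //; apply: (rkM rv).
Qed.

Lemma integral_pair_der a : integral_pair a -> integral_pair (pder a).
Proof.
move=> [a1 a2 a3]; split.
- by apply: dle_trans a1; apply: dle_der.
- by apply: dle_trans a2; apply: dle_der.
- by rewrite (res_der hM) // (res_der hN) //; apply: (rv_der rv).
Qed.

Lemma integral_pair_unit a : integral_pair a -> dle 1 a.1 <-> dle 1 a.2.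
Proof.
move=> [a1 a2 a3]; have := rv_inj rv a3 (rk0 rv).
have h (M0 : structure) (h0 : is_model M0) (x : fsort M0) : dle x 1 -> (res x = 0) <-> ~ dle 1 x.
  move=> x1; split=> [/eqP|]; first by rewrite (res_eq0 h0) // /dlt => /negP.
  by move=> nx; apply/eqP; rewrite (res_eq0 h0) //; apply/negP.
rewrite (h _ hM) // (h _ hN) // => e.
by split=> l; apply: contrapT => nl; [apply: ((e.2 nl) l) | apply: ((e.1 nl) l)].
Qed.

Lemma compat_integral a : compat a -> dle a.1 1 -> integral_pair a.
Proof.
move=> ca a1; have a2 : dle a.2 1 by rewrite -(compat_dle hM hN rv ca (compat1 hM hN rv)).
split=> //; have [s|s] := boolP (dlt a.1 1).
  have s2 : dlt a.2 1 by rewrite -(compat_dlt hM hN rv ca (compat1 hM hN rv)).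
  by rewrite (res_small hM s) (res_small hN s2); apply: (rk0 rv).
have e1 : deq a.1 1 by rewrite /deq a1 (dleNgt 1).
have e2 : deq a.2 1 by rewrite -(compat_deq hM hN rv ca (compat1 hM hN rv)).
by rewrite -(ac_res hM e1) -(ac_res hN e2); apply: (compat_ac hM hN rv).
Qed.

Lemma integral_compat a : S a.1 -> integral_pair a -> dle 1 a.1 -> compat a.
Proof.
move=> Sa ia l1; have l2 := (integral_pair_unit ia).1 l1; case: ia => a1 a2 a3.
have e1 : deq a.1 1 by rewrite /deq a1 l1.
have e2 : deq a.2 1 by rewrite /deq a2 l2.
split=> //; right; exists 0, 0; split; last by rewrite (ac_res hM) // (ac_res hN).
- by rewrite -(val1 hM); apply/deqE.
- by rewrite -(val1 hN); apply/deqE.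
- exact: (rg0 hM rv).
Qed.

Lemma compat_sim a b : compat a -> compat b -> dlt (a.1 - b.1) b.1 -> dlt (a.2 - b.2) b.2.
Proof.
move=> ca cb h; have b1 := dlt_neq0 hM h.
have b2 : b.2 != 0 by rewrite -(compat_eq0 hM hN cb).
apply: (near_ac hN) => //.
  by rewrite -(compat_deq hM hN rv ca cb); apply: dlt_deq.
have ra := compat_ac hM hN rv ca; have rb := compat_ac hM hN rv cb.
by apply/(rv_inj rv ra rb); apply: ac_near.
Qed.

Lemma ex_max_coeff n (P : mpoly n A) : P != 0 ->
  exists m0, P@_m0 != 0 /\ forall m, dle (P@_m).1 (P@_m0).1.
Proof.
move=> P0; have h : forall s : seq (multinom n), s != [::] ->
    exists2 m0, m0 \in s & forall m, m \in s -> dle (P@_m).1 (P@_m0).1.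
  elim=> // m s IH _; have [->|/IH[m0 ms mx]] := eqVneq s [::].
    by exists m; rewrite ?inE ?eqxx // => m'; rewrite inE => /eqP ->; apply: dle_refl.
  have /orP[l|l] := dle_total hM (P@_m).1 (P@_m0).1.
    exists m0; first by rewrite inE ms orbT.
    by move=> m'; rewrite inE => /orP[/eqP -> //|/mx].
  exists m; first by rewrite inE eqxx.
  move=> m'; rewrite inE => /orP[/eqP ->|/mx h]; [exact: dle_refl|exact: dle_trans h l].
have [m0 ms mx] : exists2 m0, m0 \in msupp P & forall m, m \in msupp P -> dle (P@_m).1 (P@_m0).1.
  by apply: h; rewrite msupp_eq0.
exists m0; split; first by rewrite -mcoeff_msupp.
move=> m; have [/mx //|/memN_msupp_eq0 ->] := boolP (m \in msupp P); exact: dle0.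
Qed.

(** All candidates in [Z] have the same residue, so after normalization the residue of the value of
    [P] at a candidate depends on [P] alone. Stability means that it is nonzero: the reduction of
    [P] does not vanish at the residue of [x]. *)
Lemma residue_extension x : S x -> deq x 1 ->
  exists a, [/\ F a, deq a.1 1 & dlt (a.1 - x) 1].
Proof.
move=> Sx x1; have [u' Ru] := rv_domk rv Sx.
have u0 : u' != 0.
  apply/eqP => e; rewrite e in Ru; have := (rv_inj rv Ru (rk0 rv)).2 erefl => /eqP.
  by rewrite (ac_eq0 hM); apply/negP; rewrite (deq_neq0 hM x1) oner_neq0.
have [y y1 ry] := res_surj hN u'.
have /andP[x1l x1g] := x1.
pose Z (b : A) := [/\ S b.1, dlt (b.1 - x) 1 & dlt (b.2 - y) 1].
have Zint b : Z b -> integral_pair b.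
  move=> [_ h1 h2].
  have b1 : dle b.1 1 by rewrite -(subrK x b.1); apply: (dleD hM) => //; apply: dltW.
  have b2 : dle b.2 1 by rewrite -(subrK y b.2); apply: (dleD hN) => //; apply: dltW.
  split=> //; suff [-> ->] : res b.1 = ac x /\ res b.2 = u' by [].
  rewrite -ry (ac_res hM x1); split; apply/eqP; rewrite -subr_eq0.
    by rewrite -(resB hM) // (res_small hM).
  by rewrite -(resB hN) // (res_small hN).
have ZP n (P : mpoly n A) b : Z b -> pover F P -> (forall m, dle (P@_m).1 1) ->
    integral_pair P.@[@pjet M N n b].
  move=> Zb FP P1; apply: (meval_sub integral_pair_ring).
    by move=> m; apply: compat_integral => //; apply: (mF_compat mF).
  move=> i; rewrite /pjet; elim: (i : nat) => [|d IH] /=; first exact: Zint.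
  exact: integral_pair_der.
have ZS n (P : mpoly n A) b : Z b -> pover F P -> S (P.@[@pjet M N n b]).1.
  move=> [Sb _ _] FP; rewrite pmeval1; apply: (meval_sub hSr); first exact: pover_S.
  by move=> i; apply: (closed_sub_iter hS).
pose stab n (P : mpoly n A) := exists m0, [/\ P@_m0 != 0, forall m, dle (P@_m).1 (P@_m0).1 &
  forall b, Z b -> dle (P@_m0).1 (P.@[@pjet M N n b]).1].
have F0 a : F a -> a != 0 -> a.1 != 0 /\ a.2 != 0.
  move=> fa a0; rewrite -(compat_eq0 hM hN (mF_compat mF fa)).
  suff : a.1 != 0 by []. 
  by apply/eqP => e; move: a0; rewrite (compat_zero hM hN (mF_compat mF fa) e) eqxx.
have norm n (P : mpoly n A) m0 : pover F P -> P@_m0 != 0 ->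
    (forall m, dle (P@_m).1 (P@_m0).1) ->
    let Q := (pinv P@_m0)%:MP * P in [/\ pover F Q, forall m, Q@_m = pinv P@_m0 * P@_m &
      forall m, dle (Q@_m).1 1].
  move=> FP Pn mx Q; have [p1 p2] := F0 _ (FP m0) Pn.
  have E m : Q@_m = pinv P@_m0 * P@_m by rewrite mcoeffCM.
  split=> // m; rewrite E; first by apply: (subM hF); [apply: (mF_inv hM hN rv mF) | ].
  by rewrite /= mulrC (dle_pdivl hM) // mul1r.
have [b [[Sb b1 b2] Fb]] : exists b, Z b /\ F b; last first.
  exists b; split=> //; rewrite (deq_trans _ x1) //.
  by apply: (dlt_deq hM); apply: dlt_le_trans x1g.
apply: (@extension M N hM hN S Rk RG rv F mF Z stab).
- move=> n P FP [m0 [Pn mx hb]] b Zb; have [p1 p2] := F0 _ (FP m0) Pn.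
  have [FQ QE Q1] := norm n P m0 FP Pn mx; set Q := _ * P in FQ QE Q1.
  have PQ : P.@[@pjet M N n b] = P@_m0 * Q.@[pjet b].
    by rewrite mevalM mevalC pmulVK.
  have cQ : compat Q.@[pjet b].
    apply: integral_compat; [exact: ZS|exact: ZP|].
    rewrite -(dleM2l hM _ _ p1) mulr1; have := hb _ Zb; rewrite PQ.
    exact.
  split; first by rewrite PQ; apply: (compatM hM hN rv) => //; apply: (mF_compat mF).
  exact: (dle_neq0 hM (hb _ Zb)).
- move=> n G FG Gn nG dG; have [m0 [Gm0 mx]] := ex_max_coeff Gn.
  have [g1 g2] := F0 _ (FG m0) Gm0.
  have [b [Zb hb]] : exists b, Z b /\ dlt (G.@[@pjet M N n b]).1 (G@_m0).1.
    apply: contrapT => h; apply: nG; exists m0; split=> // b Zb.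
    by rewrite (dleNgt (G@_m0).1); apply/negP => l; apply: h; exists b.
  have [FQ QE Q1] := norm n G m0 FG Gm0 mx; set Q := _ * G in FQ QE Q1.
  have GQ c : G.@[@pjet M N n c] = G@_m0 * Q.@[pjet c].
    by rewrite mevalM mevalC pmulVK.
  have iQ := ZP n Q b Zb FQ Q1.
  have Qb1 : dlt (Q.@[@pjet M N n b]).1 1.
    by rewrite -(dltM2l hM _ _ g1) mulr1; move: hb; rewrite GQ.
  have Qb2 : dlt (Q.@[@pjet M N n b]).2 1.
    by rewrite /dlt; apply/negP => /(integral_pair_unit iQ) l; move: Qb1; rewrite /dlt l.
  have Qm0 : Q@_m0 = 1.
    by rewrite QE mulrC -{1}[_@_m0]mul1r pdiv_mul.
  (* Otherwise the constant term dominates and [Q] is not small at [b]. *)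
  have [m [mn hm]] : exists m, m != 0%MM /\ dle 1 (Q@_m).1.
    apply: contrapT => h; have h' m : m != 0%MM -> dlt (Q@_m).1 1.
      by move=> mn; rewrite /dlt; apply/negP => l; apply: h; exists m.
    have Q0 : Q@_0 = 1.
      have [<- //|m0n] := eqVneq m0 0%MM.
      by have := h' _ m0n; rewrite Qm0 dltxx.
    have cQ : cdom (P1 Q).
      split=> [|m mn]; rewrite ?pmcoeff1 Q0 ?oner_neq0 //; exact: h'.
    have jb (i : 'I_n) : dle (jet b.1 i) 1.
      by have [b1 _ _] := Zint _ Zb; apply: dle_trans b1; apply: dle_iter_der.
    have := dlt_deq hM (cdom_meval hM cQ jb); rewrite pmcoeff1 Q0 -pmeval1 => /andP[_ l].
    by move: Qb1; rewrite /dlt l.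
  have [i mi] : exists i : 'I_n, m i != 0%N.
    apply: contrapT => h; case/eqP: mn; apply/mnmP => i; rewrite mnm0E.
    by apply/eqP/negP => /negP z; apply: h; exists i.
  have mE : (m - U_(i) + U_(i) = m)%MM by rewrite submK // lep1mP.
  have DQ : Q^`M(i) = (pinv G@_m0)%:MP * G^`M(i) by rewrite mderivM mderivC mul0r add0r.
  (* The exponent [m i] is a unit in residue characteristic 0, so this partial derivative has a
     coefficient of full size; being stable, it takes a unit value at [b]. *)
  have dQm : deq (Q^`M(i)@_(m - U_(i))).1 1.
    rewrite mcoeff_deriv mE (raddfMn fst1); apply: (deq_trans (deq_mulrn hM _ _)) => //.
    by rewrite /deq Q1 hm.
  have [D0|[m1 [D1 D2 D3]]] := dG i.
    move: dQm; rewrite DQ D0 mulr0 mcoeff0 /deq => /andP[_].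
    by rewrite (dlex0 hM) oner_eq0.
  have dQb : dle 1 (Q^`M(i).@[@pjet M N n b]).1.
    rewrite DQ mevalM mevalC /= mulrC (dle_pdivr hM) // mul1r.
    apply: dle_trans (D3 _ Zb); apply: dle_trans (D2 (m - U_(i))%MM).
    have /andP[_] := dQm; rewrite DQ mcoeffCM /= mulrC (dle_pdivr hM) // mul1r.
    exact.
  have FD : pover F Q^`M(i) by apply: pover_deriv.
  have iD : integral_pair Q^`M(i).@[@pjet M N n b].
    by apply: ZP => // m'; rewrite mcoeff_deriv (raddfMn fst1); apply: (dle_mulrn hM); exact: Q1.
  have [Sb hb1 hb2] := Zb; have [ib1 ib2 _] := Zint _ Zb.
  have [c1 [Sc1 lc1 ec1]] : exists c, [/\ S c, dle (c - b.1) (P1 Q).@[jet b.1] & (P1 Q).@[jet c] = 0].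
    apply: (newton_simple hM hS) => //.
    + exact: pover_S.
    + by move=> m'; rewrite pmcoeff1.
    + by rewrite -pmeval1.
    + by exists i; rewrite map_mderiv -pmeval1.
  have [c2 [_ lc2 ec2]] : exists c, [/\ True, dle (c - b.2) (P2 Q).@[jet b.2] & (P2 Q).@[jet c] = 0].
    apply: (newton_simple hN (closed_subT hN)) => //.
    + move=> m'; rewrite pmcoeff2.
      by have [] := compat_integral (mF_compat mF (FQ m')) (Q1 m').
    + by rewrite -pmeval2.
    + by exists i; rewrite map_mderiv -pmeval2; apply/(integral_pair_unit iD).
  exists (c1, c2); split.
    split=> //=.
      rewrite -(subrK b.1 c1) -addrA; apply: (dltD hM) => //.
      by apply: dle_lt_trans lc1 _; rewrite -pmeval1.
    rewrite -(subrK b.2 c2) -addrA; apply: (dltD hN) => //.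
    by apply: dle_lt_trans lc2 _; rewrite -pmeval2.
  rewrite GQ; have -> : Q.@[@pjet M N n (c1, c2)] = 0; last by rewrite mulr0.
  by apply/eqP; rewrite -pair_eqE /pair_eq /= pmeval1 pmeval2 ec1 ec2 !eqxx.
- by exists (x, y); split; rewrite ?subrr ?(dlt0x hM) ?(dlt0x hN) ?oner_neq0.
Qed.

End ResidueExtension.

(** * Extending the values *)

Section ValueGroupExtension.
Variables M N : structure.
Hypotheses (hM : is_model M) (hN : is_model N).
Local Notation K := (fsort M).
Local Notation L := (fsort N).
Local Notation A := (K * L)%type.
Variables (S : K -> Prop) (Rk : rsort M -> rsort N -> Prop)
  (RG : vsort M -> vsort N -> Prop).
Hypothesis rv : rv_iso S Rk RG.
Local Notation compat := (compat S Rk RG).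
Let hS := rv_sub rv.
Let hSr := closed_sub_ring hS.
Variable F : A -> Prop.
Hypothesis mF : max_good S Rk RG F.
Let hF := mF_ring mF.

(* Terms of equal valuation in a sum of elements of [F xi^i] can be merged,
   after which the sum is asymptotic to its largest term. *)
Lemma compat_monomial_sum (xi : A) : compat xi -> xi.1 != 0 ->
  (forall j a, F a -> deq (xi.1 ^+ j) a.1 -> F (xi ^+ j)) ->
  forall s : seq (A * nat), (forall p, p \in s -> F p.1) ->
    compat (\sum_(p <- s) p.1 * xi ^+ p.2).
Proof.
move=> cx x0 hx s; have [l] := ubnP (size s); elim: l s => // l IH s sl Fs.
pose t (p : A * nat) : A := p.1 * xi ^+ p.2.
have ct p : p \in s -> compat (t p).
  by move=> ps; apply: (compatM hM hN rv); [apply: (mF_compat mF); apply: Fs | apply: (compatX hM hN rv)].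
have [->|sn] := eqVneq s [::]; first by rewrite big_nil; apply: (compat0 rv).
have [p [ps pm]] : exists p, p \in s /\ forall q, q \in s -> dle (t q).1 (t p).1.
  elim: s sn {sl Fs ct} => // p s IHs _; have [->|/IHs[q [qs qm]]] := eqVneq s [::].
    by exists p; rewrite inE eqxx; split=> // q; rewrite inE => /eqP ->; exact: dle_refl.
  have /orP[le|le] := dle_total hM (t p).1 (t q).1.
    by exists q; rewrite inE qs orbT; split=> // r; rewrite inE => /orP[/eqP ->|/qm].
  exists p; rewrite inE eqxx; split=> // r; rewrite inE => /orP[/eqP ->|/qm h].
    exact: dle_refl.
  exact: dle_trans h le.
have pe := perm_to_rem ps.
have sr : (size (rem p s) < l)%N.
  by rewrite size_rem // prednK // -has_predT; apply/hasP; exists p.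
have rs q : q \in rem p s -> q \in s by apply: mem_rem.
rewrite (perm_big _ pe) big_cons /=.
have [z|tp0] := eqVneq (t p).1 0.
  rewrite -/(t p) (compat_zero hM hN (ct _ ps) z) add0r big_seq big1.
    exact: (compat0 rv).
  move=> q qs; apply: (compat_zero hM hN (ct _ (rs _ qs))); apply/eqP.
  by rewrite -(dlex0 hM) -z; apply: pm; apply: rs.
have [[q [qs qe]]|no] := pselect (exists q, q \in rem p s /\ dle (t p).1 (t q).1); last first.
  set r := \sum_(_ <- _) _.
  have small q : q \in rem p s -> dlt (t q).1 (t p).1.
    by move=> qs; rewrite /dlt; apply/negP => le; apply: no; exists q.
  have r1 : dlt r.1 (t p).1.
    rewrite (raddf_sum (fst : {additive A -> K})) big_seq; apply: (dlt_sum hM) => //.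
  have r2 : dlt r.2 (t p).2.
    rewrite (raddf_sum (snd : {additive A -> L})) big_seq; apply: (dlt_sum hN) => //.
      by rewrite -(compat_eq0 hM hN (ct _ ps)).
    move=> q qs; rewrite -(compat_dlt hM hN rv (ct _ (rs _ qs)) (ct _ ps)); exact: small.
  rewrite -/(t p); apply: (compat_near hM hN (ct _ ps)).
  - rewrite /=; apply: (subD hSr); first by have [] := ct _ ps.
    rewrite (raddf_sum (fst : {additive A -> K})) big_seq; apply: (sub_sum hSr) => q qs.
    by have [] := ct _ (rs _ qs).
  - by rewrite /= addrC addKr.
  - by rewrite /= addrC addKr.
(* Two terms of equal value differ by a power of [xi] whose value is taken in [F]. By [hx] this
   power lies in [F], so the two terms become one and the sum gets shorter. *)
have merge (p' q' : A * nat) s' : (size s' < l.-1)%N -> F p'.1 -> F q'.1 ->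
    (forall r, r \in s' -> F r.1) -> deq (t p').1 (t q').1 -> (t q').1 != 0 -> (p'.2 <= q'.2)%N ->
    compat (t p' + t q' + \sum_(r <- s') t r).
  move=> ss Fp Fq Fs' eq q0 pq.
  have q1 : q'.1.1 != 0 by apply: contraNneq q0 => z; rewrite /= z mul0r.
  have Fd : F (xi ^+ (q'.2 - p'.2)).
    apply: (hx _ (p'.1 * pinv q'.1)); first by apply: (subM hF) => //; apply: (mF_inv hM hN rv mF).
    rewrite deqC /= deq_divr //.
    have xp : xi.1 ^+ p'.2 != 0 by rewrite expf_neq0.
    move: eq; rewrite /t /= !(rmorphXn (fst : {rmorphism A -> K})) /= -{1}(subnKC pq) exprD.
    by rewrite mulrCA mulrC /deq !(dleM2l hM) // mulrC.
  have := IH ((p'.1 + q'.1 * xi ^+ (q'.2 - p'.2), p'.2) :: s').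
  rewrite big_cons /=; have -> : (p'.1 + q'.1 * xi ^+ (q'.2 - p'.2)) * xi ^+ p'.2 = t p' + t q'.
    by rewrite mulrDl -mulrA -exprD subnK.
  apply; first by rewrite ltnS in sl; move: ss; case: (l) => [|[|]].
  move=> r; rewrite inE => /orP[/eqP ->|/Fs' //] /=.
  by apply: (subD hF) => //; apply: (subM hF).
have pe2 := perm_to_rem qs; rewrite (perm_big _ pe2) big_cons /=.
have Fp := Fs _ ps; have Fq := Fs _ (rs _ qs).
have eqt : deq (t p).1 (t q).1 by rewrite /deq qe pm //; apply: rs.
have tq0 : (t q).1 != 0 by rewrite -(deq_neq0 hM eqt).
have ss : (size (rem q (rem p s)) < l.-1)%N.
  have r0 : (0 < size (rem p s))%N by case: (rem p s) qs.
  by rewrite size_rem // -ltnS !prednK //; apply: leq_ltn_trans sr.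
have Fr r : r \in rem q (rem p s) -> F r.1 by move=> /mem_rem/mem_rem; apply: Fs.
rewrite -/(t p) -/(t q) addrA; have /orP[pq|qp] := leq_total p.2 q.2; first exact: merge.
by rewrite [t p + _]addrC; apply: merge => //; rewrite deqC.
Qed.

(** The relation [pder xi = tau * xi] makes the ordinary polynomial ring in [xi] over [F] stable
    under derivation: no further derivatives have to be adjoined. *)
Lemma monomial_extension (xi tau : A) : compat xi -> xi.1 != 0 -> F tau ->
  pder xi = tau * xi ->
  (forall j a, F a -> deq (xi.1 ^+ j) a.1 -> F (xi ^+ j)) -> F xi.
Proof.
move=> cx x0 Ft dx hx.
pose W a := exists P : mpoly 1 A, pover F P /\ a = P.@[fun=> xi].
have hr := pover_subring hF 1.
have FW a : F a -> W a.
  by move=> fa; exists a%:MP; rewrite mevalC; split=> //; apply: poverC.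
have hW : is_subring W.
  split; first by apply: FW; apply: sub1.
    move=> _ _ [P [FP ->]] [Q [FQ ->]]; exists (P - Q); rewrite mevalB.
    by split=> //; apply: (subB hr).
  move=> _ _ [P [FP ->]] [Q [FQ ->]]; exists (P * Q); rewrite mevalM.
  by split=> //; apply: (subM hr).
have Wx : W xi by exists 'X_ord0; rewrite mevalXU; split=> //; apply: poverXm.
apply: (mF_absorb hM hN rv mF hW FW _ _ Wx).
  move=> _ [P [FP ->]]; rewrite mevalE.
  pose s := [seq (P@_m, m ord0) | m <- msupp P].
  have := @compat_monomial_sum xi cx x0 hx s.
  rewrite big_map; under [in X in _ -> X]eq_bigr => m _ do rewrite big_ord1.
  by apply=> p /mapP[m _ ->]; apply: FP.
move=> _ [P [FP ->]]; apply: (frac_sub hW).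
suff [//] : W P.@[fun=> xi] /\ W (pder P.@[fun=> xi]).
apply: (@meval_sub _ (fun a => W a /\ W (pder a))).
- split; first by rewrite pder1; split; [apply: FW; apply: sub1 | apply: FW; apply: sub0].
    by move=> x y [x1 x2] [y1 y2]; rewrite pderB; split; apply: (subB hW).
  move=> x y [x1 x2] [y1 y2]; rewrite pderM; split; first exact: (subM hW).
  by apply: (subD hW); apply: (subM hW).
- by move=> m; split; apply: FW => //; apply: (mF_der mF).
- by move=> _; split=> //; rewrite dx; apply: (subM hW) => //; apply: FW.
Qed.

Hypothesis res_full : forall x, S x -> deq x 1 ->
  exists a, [/\ F a, deq a.1 1 & dlt (a.1 - x) 1].

(** An element of the right value is corrected by a unit of the right residue. *)
Lemma compat_lift x : S x -> x != 0 -> exists y, compat (x, y).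
Proof.
move=> Sx x0; have [g gE] := val_some hM x0.
have [g' Rg] := rv_domG rv Sx gE; have [u' Ru] := rv_domk rv Sx.
have [y y0 yE] := val_surj hN g'; have [z z1 zE] := res_surj hN (u' / ac y).
have u0 : u' != 0.
  apply/eqP => e; rewrite e in Ru; have := (rv_inj rv Ru (rk0 rv)).2 erefl => /eqP.
  by rewrite (ac_eq0 hM) (negbTE x0).
have ze : deq z 1.
  rewrite /deq z1 /= dleNgt; apply/negP => /(res_small hN) r0; move: zE; rewrite r0 => /esym/eqP.
  by rewrite mulf_eq0 invr_eq0 (ac_eq0 hN) (negbTE u0) (negbTE y0).
exists (y * z); split=> //=; right; exists g, g'; split=> //.
  by rewrite (valM hN) yE (deqE z 1).1 // (val1 hN) /oadd addr0.
by rewrite (acM hN) (ac_res hN ze) zE mulrC divfK // (ac_eq0 hN).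
Qed.

(** Whether some positive power of [x] has a value in [F] decides how [x] is corrected. Without such
    a power, [xi] receives a logarithmic derivative from [F]; otherwise, for the least exponent [n],
    [xi ^+ n] is made an element of [F]. Either way [monomial_extension] applies. *)
Lemma value_extension x : S x -> x != 0 -> exists a, F a /\ deq a.1 x.
Proof.
move=> Sx x0; have [y cxy] := compat_lift Sx x0.
have y0 : y != 0 by rewrite -(compat_eq0 hM hN cxy).
pose T j := `[< (0 < j)%N /\ exists a, F a /\ deq (x ^+ j) a.1 >].
suff [xi [tau [cx xx Ft dx hx]]] : exists xi tau, [/\ compat xi, dlt (xi.1 - x) x, F tau,
    pder xi = tau * xi & forall j, (0 < j)%N -> (exists a, F a /\ deq (xi.1 ^+ j) a.1) -> F (xi ^+ j)].
  have e := dlt_deq hM xx; exists xi; split=> //.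
  apply: (monomial_extension cx _ Ft dx); first by rewrite (deq_neq0 hM e).
  move=> [|j] a Fa h; first by rewrite expr0; apply: (sub1 hF).
  by apply: hx => //; exists a.
have near_compat x1 y1 : S x1 -> dlt (x1 - x) x -> dlt (y1 - y) y -> compat (x1, y1).
  by move=> Sx1 h1 h2; apply: (compat_near hM hN cxy).
have [[j0 Tj0]|noT] := pselect (exists j, T j); last first.
  have lx1 := dle_logder hM x0.
  have [tau [Ft ht]] : exists tau, F tau /\ dlt (logder x - tau.1) 1.
    have [s|s] := boolP (dlt (logder x) 1).
      by exists 0; rewrite subr0; split=> //; apply: (sub0 hF).
    have Sl : S (logder x) by apply: (subM hSr); [apply: (closed_sub_der hS)|apply: (closed_subV hS)].
    have [|a [Fa _ ha]] := res_full Sl; first by rewrite /deq lx1 (dleNgt 1).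
    by exists a; split=> //; rewrite -opprB (dltN hM).
  have [g [g' [vx vy Rg Ra]]] : exists g g', [/\ valuation x = Some g, valuation y = Some g', RG g g' & Rk (ac x) (ac y)].
    by case: cxy => _ [[/= z]|//]; rewrite z eqxx in x0.
  have t1 : dle tau.1 1.
    by rewrite -(subrK (logder x) tau.1); apply: (dleD hM) => //; rewrite -opprB (dleN hM); apply: dltW.
  have [_ t2 Rt] := compat_integral hM hN rv (mF_compat mF Ft) t1.
  have ly1 := dle_logder hN y0.
  (* By [res_logder] the residue of a logarithmic derivative is computed from angular component and
     value, both matched by the partial isomorphisms. *)
  have ht2 : dlt (logder y - tau.2) 1.
    have rx := res_logder hM vx; have ry := res_logder hN vy.
    have Rl : Rk (res (logder x)) (res (logder y)).
      rewrite rx ry; apply: (rkD rv); last exact: (rv_cmap rv).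
      by apply: (rkM rv); [apply: (rv_der rv) | apply: (rv_inv rv)].
    rewrite -(res_eq0 hN); last exact: dleB.
    rewrite (resB hN) // subr_eq0; apply/eqP/(rv_inj rv Rl Rt)/eqP.
    by rewrite -subr_eq0 -(resB hM) // (res_eq0 hM) //; apply: dleB.
  have St : S tau.1 by apply: (mF_S mF).
  have [x1 [Sx1 nx1 lx]] := adjust_logder hM hS Sx St x0 ht.
  have [y1 [_ ny1 ly]] := adjust_logder hN (closed_subT hN) I I y0 ht2.
  exists (x1, y1), tau; split=> //=; first exact: near_compat.
  - have x10 : x1 != 0 by rewrite (deq_neq0 hM (dlt_deq hM nx1)).
    have y10 : y1 != 0 by rewrite (deq_neq0 hN (dlt_deq hN ny1)).
    by case: tau {Ft ht t1 t2 Rt ht2 St} lx ly => t t' /= <- <-; congr (_, _); rewrite /logder divfK.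
  - move=> j j0 [a [Fa ha]]; case: noT; exists j; apply/asboolP; split=> //; exists a; split=> //.
    by apply: deq_trans ha; apply: deqX => //; rewrite deqC; apply: dlt_deq.
case: (ex_minnP (ex_intro _ j0 Tj0)) => n /asboolP[n0 [a [Fa ha]]] minn.
have a1 : a.1 != 0 by rewrite -(deq_neq0 hM ha) expf_neq0.
have a2 : a.2 != 0 by rewrite -(compat_eq0 hM hN (mF_compat mF Fa)).
(* Residues of [S] are represented in [F], so [x ^+ n] is even asymptotic to an element of [F]. *)
have [e [Fe he]] : exists e, F e /\ dlt (x ^+ n - e.1) e.1.
  have Sq : S (x ^+ n / a.1).
    by apply: (subM hSr); [apply: (subX hSr) | apply: (closed_subV hS); apply: (mF_S mF)].
  have [|k [Fk k1 hk]] := res_full Sq; first by rewrite deq_divr // mul1r.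
  exists (a * k); split; first exact: (subM hF).
  have /andP[_ kl] := k1.
  have -> : x ^+ n - (a * k).1 = - (a.1 * (k.1 - x ^+ n / a.1)).
    by rewrite mulrBr mulrCA divff // mulr1 opprB.
  by rewrite (dltN hM) (dltM2l hM) //; apply: dlt_le_trans hk kl.
have e1 : e.1 != 0 := dlt_neq0 hM he.
have e2 : e.2 != 0 by rewrite -(compat_eq0 hM hN (mF_compat mF Fe)).
have he2 : dlt (y ^+ n - e.2) e.2.
  have := compat_sim hM hN rv (compatX hM hN rv n cxy) (mF_compat mF Fe).
  by rewrite (rmorphXn (fst : {rmorphism A -> K})) (rmorphXn (snd : {rmorphism A -> L})); apply.
have Se : S e.1 by apply: (mF_S mF).
have [x1 [Sx1 nx1 px]] := adjust_root hM hS Sx Se x0 n0 he.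
have [y1 [_ ny1 py]] := adjust_root hN (closed_subT hN) I I y0 n0 he2.
have x10 : x1 != 0 by rewrite (deq_neq0 hM (dlt_deq hM nx1)).
have y10 : y1 != 0 by rewrite (deq_neq0 hN (dlt_deq hN ny1)).
have pxi : (x1, y1) ^+ n = e :> A.
  apply/eqP; rewrite -pair_eqE /pair_eq (rmorphXn (fst : {rmorphism A -> K})) /= px.
  by rewrite (rmorphXn (snd : {rmorphism A -> L})) /= py !eqxx.
have Fn : F (pinv n%:R) by apply: (mF_inv hM hN rv mF); apply: (subMn hF); apply: (sub1 hF).
(* Since [xi ^+ n = e], the logarithmic derivative of [xi] is that of [e] divided by [n]. *)
exists (x1, y1), (pder e * pinv e * pinv n%:R); split=> //=; first exact: near_compat.
- by apply: (subM hF) => //; apply: (subM hF); [apply: (mF_der mF) | apply: (mF_inv hM hN rv mF)].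
- have h (K0 : diffField) (z w : K0) : z != 0 -> z ^+ n = w -> der z = der w / w / n%:R * z.
    move=> z0 <-; have nn : n%:R != 0 :> K0 by rewrite char0_natr_neq0 // -lt0n.
    have -> : der (z ^+ n) = n%:R * (z ^+ n / z) * der z.
      have dX k : der (z ^+ k.+1) = k.+1%:R * z ^+ k * der z.
        elim: k => [|k IHk]; first by rewrite expr1 expr0 !mul1r.
        by rewrite exprS derM IHk -[k.+2%:R]natr1 !exprS; ring.
      by case: (n) n0 => // k _; rewrite dX exprSr mulfK.
    field.
    by rewrite nn expf_neq0 ?z0.
  congr (_, _) => /=; rewrite ?(raddfMn (fst : {additive A -> K})) ?(raddfMn (snd : {additive A -> L})).
    exact: h px.
  exact: h py.
move=> j jp [b [Fb hb]].
(* Exponents whose power has a value in [F] are closed under remainders by [n]. Minimality of [n]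
   makes them multiples of it, and then the power of [xi] is a power of [e]. *)
have dvd : (n %| j)%N.
  rewrite /dvdn; apply/negPn/negP; rewrite -lt0n => r0.
  have : T (j %% n)%N.
    apply/asboolP; split=> //; exists (b * pinv (e ^+ (j %/ n))); split.
      by apply: (subM hF) => //; apply: (mF_inv hM hN rv mF); apply: (subX hF).
    rewrite /= (rmorphXn (fst : {rmorphism A -> K})) /= deqC deq_divr ?expf_neq0 // deqC.
    apply: deq_trans hb => /=; rewrite [in X in deq _ X](divn_eq j n) exprD mulnC exprM px mulrC.
    by apply: deqM => //; [exact: deq_refl | apply: deqX => //; rewrite deqC; apply: dlt_deq].
  by move/minn; rewrite leqNgt ltn_mod n0.
by rewrite -(divnK dvd) mulnC exprM pxi; apply: (subX hF).
Qed.

End ValueGroupExtension.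

(** * Newton position along a nest of balls *)

Section Centers.
Variable M : structure.
Hypothesis hM : is_model M.
Local Notation K := (fsort M).
Variable S : K -> Prop.
Hypothesis hS : closed_sub S.
Let hSr := closed_sub_ring hS.

(** By monotonicity all derivatives of [x - e] are bounded by [h]: the jet of [x] lies in the
    polydisc of radius [h] around the jet of [e], and [cdom_msub] applies. *)
Lemma cdom_move n (P : mpoly n K) (e x h g : K) : h != 0 ->
  dle (x - e) h -> dle g h -> cdom (msub P (jet e) h) -> cdom (msub P (jet x) g).
Proof.
move=> h0 xe gh c.
have -> : msub P (jet x) g = msub (msub P (jet e) h) (fun i => (jet x i - jet e i) / h) (g / h).
  rewrite msub_msub [h * (g / h)]mulrC (divfK h0); apply: eq_msub => i.
  by rewrite mulrC (divfK h0) addrC subrK.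
apply: (cdom_msub hM) => //; last by rewrite dle_pdivl // mul1r.
move=> i; rewrite dle_pdivl // mul1r; apply: dle_trans xe.
have -> : jet x i - jet e i = iter i der (x - e).
  by rewrite /jet; elim: (i : nat) => //= d <-; rewrite derB.
exact: dle_iter_der.
Qed.

Lemma cdom_near n (P : mpoly n K) (e x h : K) : h != 0 ->
  dle (x - e) h -> cdom (msub P (jet e) h) -> dlt (P.@[jet x] - P.@[jet e]) P.@[jet e].
Proof.
move=> h0 xe c.
have -> : P.@[jet x] = (msub P (jet e) h).@[fun i => (jet x i - jet e i) / h].
  by rewrite meval_msub; apply: meval_eq => i; rewrite mulrC (divfK h0) addrC subrK.
rewrite -(mcoeff0_msub P (jet e) h); apply: (cdom_meval hM) => // i.
rewrite dle_pdivl // mul1r; apply: dle_trans xe.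
have -> : jet x i - jet e i = iter i der (x - e).
  by rewrite /jet; elim: (i : nat) => //= d <-; rewrite derB.
exact: dle_iter_der.
Qed.

Lemma mcoeff_deriv_msub n (P : mpoly n K) (a h : K) i (m : multinom n) : m i != 0%N ->
  deq (h * (msub P^`M(i) (jet a) h)@_(m - U_(i))) (msub P (jet a) h)@_m.
Proof.
move=> mi; rewrite -mcoeffCM -mderiv_msub mcoeff_deriv.
have -> : (m - U_(i) + U_(i) = m)%MM by rewrite submK // lep1mP.
by apply: deq_mulrn.
Qed.

(* If all partial derivatives of [P] are dominated by their constant terms near
   [a] and [P] is not, at each scale [h] of a set [C], then [P] is in Newton
   position at [a] with a root closer to [a] than all these scales. *)
Lemma newton_center n (P : mpoly n K) (a h1 : K) (C : K -> Prop) :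
  pover S P -> S a -> h1 != 0 -> C h1 ->
  (forall i, P^`M(i) = 0 \/ cdom (msub P^`M(i) (jet a) h1)) ->
  (forall h, C h -> [/\ h != 0, dle h h1 & ~ cdom (msub P (jet a) h)]) ->
  exists b, [/\ S b, P.@[jet b] = 0 & forall h, C h -> dle (b - a) h].
Proof.
move=> SP Sa h10 Ch1 dP nP.
have [e|p0] := eqVneq P.@[jet a] 0.
  by exists a; split=> // h _; rewrite subrr dle0.
pose D i := P^`M(i).@[jet a].
(* A nonconstant coefficient at scale [h] has the size of [h] times a coefficient of a partial
   derivative, which is zero or dominated by the constant term [D i]. *)
have bound h (m : multinom n) i : h != 0 -> dle h h1 -> m i != 0%N ->
    dle (msub P (jet a) h)@_m (h * D i) /\
    ((1 < mdeg m)%N -> (msub P (jet a) h)@_m != 0 -> dlt (msub P (jet a) h)@_m (h * D i)).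
  move=> h0 hh1 mi; have /andP[e1 e2] := mcoeff_deriv_msub P a h mi.
  have [z|c] := dP i.
    have Q0 : (msub P (jet a) h)@_m = 0.
      apply/eqP; rewrite -(dlex0 hM); apply: dle_trans e2 _.
      by rewrite z /msub raddf0 mcoeff0 mulr0.
    by rewrite Q0 dle0 // eqxx.
  have c' : cdom (msub P^`M(i) (jet a) h).
    by apply: cdom_move c => //; rewrite subrr dle0.
  have [n0 cm] := c'; rewrite mcoeff0_msub in n0 cm.
  have [m0|mn] := eqVneq (m - U_(i))%MM 0%MM.
    split; first by apply: dle_trans e2 _; rewrite m0 mcoeff0_msub.
    have : mdeg m = 1%N by rewrite -(@submK _ U_(i)%MM m) ?m0 ?lep1mP // add0m mdeg1.
    by move=> ->.
  have lt : dlt (msub P (jet a) h)@_m (h * D i).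
    by apply: dle_lt_trans e2 _; rewrite dltM2l //; apply: cm.
  by split=> //; apply: dltW.
have maxD : n != 0%N -> exists j, forall i, dle (D i) (D j).
  move=> n0; have h : forall s : seq 'I_n, s != [::] -> exists j, forall i, i \in s -> dle (D i) (D j).
    elim=> // i s IH _; have [->|/IH[j hj]] := eqVneq s [::].
      by exists i => i'; rewrite inE => /eqP ->; apply: dle_refl.
    have /orP[l|l] := dle_total hM (D i) (D j).
      by exists j => i'; rewrite inE => /orP[/eqP -> //|/hj].
    exists i => i'; rewrite inE => /orP[/eqP ->|/hj h]; [exact: dle_refl|exact: dle_trans h l].
  have [|j hj] := h (enum 'I_n); first by rewrite -size_eq0 size_enum_ord.
  by exists j => i; apply: hj; rewrite mem_enum.
(* As the constant term does not dominate at scale [h], some linear bound [h * D i] reaches it. *)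
have large h : C h -> exists i, dle P.@[jet a] (h * D i).
  move=> Ch; have [h0 hh1 nc] := nP _ Ch; apply: contrapT => no; apply: nc.
  split; first by rewrite mcoeff0_msub.
  move=> m mn; rewrite mcoeff0_msub.
  have [i mi] : exists i : 'I_n, m i != 0%N.
    apply: contrapT => h'; case/eqP: mn; apply/mnmP => i; rewrite mnm0E.
    by apply/eqP/negP => /negP z; apply: h'; exists i.
  have [le _] := bound h m i h0 hh1 mi; apply: dle_lt_trans le _.
  by rewrite /dlt; apply/negP => l; apply: no; exists i.
have [i0 _] := large _ Ch1.
have [j hj] : exists j, forall i, dle (D i) (D j).
  by apply: maxD; apply/eqP => n0; have := ltn_ord i0; rewrite {2}n0.
have large' h : C h -> dle P.@[jet a] (h * D j).
  move=> Ch; have [i le] := large _ Ch; apply: dle_trans le _.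
  by have [h0 _ _] := nP _ Ch; rewrite dleM2l.
have Dj0 : D j != 0.
  by apply: contraNneq p0 => z; have := large' _ Ch1; rewrite z mulr0 (dlex0 hM).
(* At this scale the constant term balances the largest linear one; it is dominated by every scale
   in [C]. *)
pose h := P.@[jet a] / D j.
have h0 : h != 0 by rewrite mulf_neq0 // invr_eq0.
have hC g : C g -> dle h g by move=> /large'; rewrite /h dle_pdivl.
have hE : h * D j = P.@[jet a] by rewrite /h divfK.
have SJ i : S (jet a i) by apply: (closed_sub_iter hS).
have Sh : S h.
  apply: (subM hSr); first exact: (meval_sub hSr).
  by apply: (closed_subV hS); apply: (meval_sub hSr) => //; apply: pover_deriv.
have [||||y [Sy y1 y0]] := newton hM hS SP Sa Sh h0.
- by rewrite mcoeff0_msub.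
- move=> m dm; rewrite mcoeff0_msub.
  have [z|nz] := eqVneq (msub P (jet a) h)@_m 0; first by rewrite z dlt0x.
  have [i mi] : exists i : 'I_n, m i != 0%N.
    apply: contrapT => h'; move: dm; rewrite mdegE big1 // => i _.
    by apply/eqP/negP => /negP z; apply: h'; exists i.
  have [_ lt] := bound h m i h0 (hC _ Ch1) mi; apply: dlt_le_trans (lt dm nz) _.
  by rewrite -hE dleM2l.
- by move=> i; rewrite mcoeff0_msub mcoeff1_msub -hE dleM2l //; exact: hj.
- by exists j; rewrite mcoeff0_msub mcoeff1_msub -/(D j) hE; apply: dle_refl.
exists (a + h * y); split=> //; first by apply: (subD hSr) => //; apply: (subM hSr).
move=> g /hC hg; rewrite addrC addKr; apply: dle_trans hg.
by rewrite -[X in dle _ X]mulr1 dleM2l.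
Qed.

End Centers.

(** * Immediate extensions *)

Section ImmediateExtension.
Variables M N : structure.
Hypotheses (hM : is_model M) (hN : is_model N).
Local Notation K := (fsort M).
Local Notation L := (fsort N).
Local Notation A := (K * L)%type.
Variables (S : K -> Prop) (Rk : rsort M -> rsort N -> Prop)
  (RG : vsort M -> vsort N -> Prop).
Hypothesis rv : rv_iso S Rk RG.
Local Notation compat := (compat S Rk RG).
Let hS := rv_sub rv.
Let hSr := closed_sub_ring hS.
Variable F : A -> Prop.
Hypothesis mF : max_good S Rk RG F.
Let hF := mF_ring mF.
Local Notation fst1 := (fst : {rmorphism A -> K}).
Local Notation snd2 := (snd : {rmorphism A -> L}).
Local Notation P1 P := (map_mpoly fst1 P).
Local Notation P2 P := (map_mpoly snd2 P).

Hypothesis full : forall x, S x -> x != 0 -> exists a, F a /\ dlt (a.1 - x) x.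
Hypothesis S_countable : exists f : nat -> K, forall x, S x -> exists n, f n = x.
Hypothesis N_complete : forall c r : nat -> L,
  (forall s, exists x, forall i, (i <= s)%N -> dle (x - c i) (r i)) ->
  exists x, forall i, dle (x - c i) (r i).

(** All coefficients involved lie in [F], so dominance of the constant term can be read off in
    either model. *)
Lemma cdom_pair n (P : mpoly n A) e h : pover F P -> F e -> F h ->
  cdom (msub (P1 P) (jet e.1) h.1) <-> cdom (msub (P2 P) (jet e.2) h.2).
Proof.
move=> FP Fe Fh.
have FQ : pover F (msub P (@pjet M N n e) h).
  by apply: (pover_msub hF) => // i; apply: (mF_iter mF).
have E1 : msub (P1 P) (jet e.1) h.1 = P1 (msub P (@pjet M N n e) h).
  by rewrite map_msub; apply: eq_msub => i; rewrite pjetE.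
have E2 : msub (P2 P) (jet e.2) h.2 = P2 (msub P (@pjet M N n e) h).
  by rewrite map_msub; apply: eq_msub => i; rewrite pjetE.
have c m := mF_compat mF (FQ m).
rewrite E1 E2; split=> -[q0 qm]; split.
- by rewrite pmcoeff2 -(compat_eq0 hM hN (c _)); rewrite pmcoeff1 in q0.
- by move=> m /qm; rewrite !pmcoeff1 !pmcoeff2 (compat_dlt hM hN rv (c _) (c _)).
- by rewrite pmcoeff1 (compat_eq0 hM hN (c _)); rewrite pmcoeff2 in q0.
- by move=> m /qm; rewrite !pmcoeff1 !pmcoeff2 (compat_dlt hM hN rv (c _) (c _)).
Qed.

Lemma immediate_extension a : S a -> exists b, F b /\ b.1 = a.
Proof.
move=> Sa; apply: contrapT => na.
have ne e : F e -> a - e.1 != 0.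
  by move=> Fe; rewrite subr_eq0; apply/eqP => z; apply: na; exists e.
(* The smallest ball around [e] containing [a], with its radius represented in [F]. Any two such
   balls are nested, and the second coordinates give the corresponding nest in [N]. *)
pose ball e h := [/\ F e, F h & deq h.1 (a - e.1)].
have ball_ex e : F e -> exists h, ball e h.
  move=> Fe; have [|h [Fh hh]] := full _ (ne _ Fe).
    by apply: (subB hSr) => //; apply: (mF_S mF).
  by exists h; split=> //; apply: dlt_deq.
have ball0 e h : ball e h -> h.1 != 0 /\ h.2 != 0.
  move=> [Fe Fh hh]; rewrite -(compat_eq0 hM hN (mF_compat mF Fh)).
  by rewrite (deq_neq0 hM hh) ne.
have ball_dist e h e' h' : ball e h -> ball e' h' -> dle h'.1 h.1 ->
    dle (e'.1 - e.1) h.1 /\ dle (e'.2 - e.2) h.2.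
  move=> [Fe Fh /andP[h1 h2]] [Fe' Fh' /andP[h1' h2']] le.
  suff l : dle (e'.1 - e.1) h.1.
    split=> //; have := compat_dle hM hN rv (mF_compat mF (subB hF Fe' Fe)) (mF_compat mF Fh).
    by rewrite /= => <-.
  have -> : e'.1 - e.1 = (a - e.1) - (a - e'.1) by ring.
  by apply: (dleB hM) => //; apply: dle_trans h2' le.
have ball_le e h e' h' : ball e h -> ball e' h' -> dle h.1 h'.1 = dle h.2 h'.2.
  by move=> [_ Fh _] [_ Fh' _]; apply: (compat_dle hM hN rv); apply: (mF_compat mF).
pose Z (b : A) := S b.1 /\ forall e h, ball e h -> dle (b.1 - e.1) h.1 /\ dle (b.2 - e.2) h.2.
have F0 : F 0 := sub0 hF.
have [h0 b00] := ball_ex 0 F0.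
have [f fS] := S_countable.
have Z_ex : exists b, Z b.
  (* The radii lie in the countable set [S], and a ball of the nest is determined by the value of
     its radius: one ball for each such value is enough. The default [(0, h0)] covers the remaining
     indices. *)
  have /choice[g hg] : forall i : nat, exists p : A * A, ball p.1 p.2 /\
      ((exists q : A * A, ball q.1 q.2 /\ deq q.2.1 (f i)) -> deq p.2.1 (f i)).
    move=> i; have [[q [bq dq]]|no] := pselect (exists q : A * A, ball q.1 q.2 /\ deq q.2.1 (f i)).
      by exists q.
    by exists (0, h0).
  have [a' ha'] : exists x, forall i, dle (x - (g i).1.2) (g i).2.2.
    apply: N_complete => s.
    have [p [bp hp]] : exists p : A * A, ball p.1 p.2 /\ forall i, (i <= s)%N -> dle p.2.1 (g i).2.1.
      elim: s => [|s [p [bp hp]]].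
        by exists (g 0%N); split; [have [] := hg 0%N|move=> i; rewrite leqn0 => /eqP ->; apply: dle_refl].
      have [bg _] := hg s.+1; have /orP[l|l] := dle_total hM p.2.1 (g s.+1).2.1.
        by exists p; split=> // i; rewrite leq_eqVlt => /orP[/eqP -> //|]; apply: hp.
      exists (g s.+1); split=> // i; rewrite leq_eqVlt => /orP[/eqP ->|/hp h].
        exact: dle_refl.
      exact: dle_trans l h.
    by exists p.1.2 => i /hp le; have [bg _] := hg i; have [] := ball_dist _ _ _ _ bg bp le.
  exists (a, a'); split=> //= e h bh; have [Fe Fh hh] := bh.
  split; first by case/andP: hh.
  have [i fi] := fS h.1 (mF_S mF Fh).
  have [bg dg] := hg i.
  have e1 : deq (g i).2.1 h.1 by rewrite -fi; apply: dg; exists (e, h); rewrite /= fi deq_refl.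
  have /andP[le _] := e1; have le2 := le; rewrite (ball_le _ _ _ _ bg bh) in le2.
  have -> : a' - e.2 = (a' - (g i).1.2) + ((g i).1.2 - e.2) by ring.
  apply: (dleD hN); first exact: dle_trans (ha' i) le2.
  by have [] := ball_dist _ _ _ _ bh bg le.
pose stab n (P : mpoly n A) := exists e h, ball e h /\ cdom (msub (P1 P) (jet e.1) h.1).
have [b [Zb Fb]] : exists b, Z b /\ F b; last first.
  (* an element of [F] in all balls is closer to [a] than itself *)
  have [h bh] := ball_ex _ Fb; have [h10 h20] := ball0 _ _ bh; have [_ Fh hh] := bh.
  have [|k [Fk hk]] := full _ (ne _ Fb).
    by apply: (subB hSr) => //; apply: (mF_S mF).
  have Fb2 : F (b + k) by apply: (subD hF).
  have [h2 bh2] := ball_ex _ Fb2; have [_ _ /andP[le _]] := bh2.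
  have [/= + _] := Zb.2 _ _ bh2; rewrite opprD addrA subrr sub0r (dleN hM) => lk.
  have /andP[_ l2] := dlt_deq hM hk.
  have : dlt k.1 (a - b.1).
    apply: dle_lt_trans (dle_trans lk le) _; rewrite /= opprD addrA -opprB (dltN hM).
    exact: hk.
  by rewrite /dlt l2.
apply: (@extension M N hM hN S Rk RG rv F mF Z stab) => //.
- move=> n P FP [e [h [bh c]]] b [Sb Zb]; have [le1 le2] := Zb _ _ bh.
  have [Fe Fh _] := bh; have [h1 h2] := ball0 _ _ bh.
  have n1 := cdom_near hM h1 le1 c.
  have n2 := cdom_near hN h2 le2 ((cdom_pair FP Fe Fh).1 c).
  split; last by rewrite pmeval1 (deq_neq0 hM (dlt_deq hM n1)); apply: (dlt_neq0 hM n1).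
  have FPe : F P.@[@pjet M N n e] by apply: (meval_sub hF) => // i; apply: (mF_iter mF).
  apply: (compat_near hM hN (mF_compat mF FPe)); rewrite ?pmeval1 ?pmeval2 //.
  by apply: (meval_sub hSr); [apply: (pover_S mF) | move=> i; apply: (closed_sub_iter hS)].
move=> n G FG Gn nG dG.
(* Finitely many partial derivatives are dominated on one common ball, the smallest of theirs. *)
have [e1 [h1 [b1 hp]]] : exists e h, ball e h /\ forall i, G^`M(i) = 0 \/
    cdom (msub (P1 G^`M(i)) (jet e.1) h.1).
  have h (s : seq 'I_n) : exists e h, ball e h /\ forall i, i \in s -> G^`M(i) = 0 \/
      cdom (msub (P1 G^`M(i)) (jet e.1) h.1).
    have move_ball i e h e' h' : ball e h -> ball e' h' -> dle h'.1 h.1 ->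
        cdom (msub (P1 G^`M(i)) (jet e.1) h.1) -> cdom (msub (P1 G^`M(i)) (jet e'.1) h'.1).
      move=> bh bh' le; have [n1 _] := ball0 _ _ bh; have [d1 _] := ball_dist _ _ _ _ bh bh' le.
      exact: (cdom_move hM).
    elim: s => [|i s [e [h [bh hs]]]]; first by exists 0, h0.
    have [z|[e' [h' [bh' c']]]] := dG i.
      by exists e, h; split=> // j; rewrite inE => /orP[/eqP ->|/hs //]; left.
    have /orP[l|l] := dle_total hM h.1 h'.1.
      exists e, h; split=> // j; rewrite inE => /orP[/eqP ->|/hs //]; right.
      exact: (move_ball _ _ _ _ _ bh' bh l).
    exists e', h'; split=> // j; rewrite inE => /orP[/eqP ->|/hs [->|c]]; [by right|by left|right].
    exact: (move_ball _ _ _ _ _ bh bh' l).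
  have [e [h' [bh hs]]] := h (enum 'I_n).
  by exists e, h'; split=> // i; apply: hs; rewrite mem_enum.
have [c [Sc Zc]] := Z_ex; have [Fe1 Fh1 _] := b1; have [h11 h12] := ball0 _ _ b1.
have [c1 c2] := Zc _ _ b1.
(* The scales for [newton_center] are the radii of all balls inside the one given by [e1] and [h1].
   Since [G] is unstable, its constant term dominates at none of them. *)
pose C1 (h : K) := exists e g, [/\ ball e g, dle g.1 h1.1 & h = g.1].
pose C2 (h : L) := exists e g, [/\ ball e g, dle g.1 h1.1 & h = g.2].
have [x [Sx x0 xC]] : exists x, [/\ S x, (P1 G).@[jet x] = 0 & forall h, C1 h -> dle (x - c.1) h].
  apply: (@newton_center M hM S hS n (P1 G) c.1 h1.1 C1).
  - exact: (pover_S mF).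
  - exact: Sc.
  - exact: h11.
  - by exists e1, h1; split=> //; apply: dle_refl.
  - move=> i; rewrite map_mderiv; have [->|cd] := hp i; [left|right].
      by rewrite raddf0.
    by apply: (cdom_move hM) cd => //; apply: dle_refl.
  - move=> _ [e [g [bg lg ->]]]; have [g1 _] := ball0 _ _ bg; split=> // cd.
    apply: nG; exists e, g; split; first exact: bg.
    apply: (cdom_move hM g1 _ (dle_refl _) cd).
    by rewrite -opprB (dleN hM); have [] := Zc _ _ bg.
have [y [_ y0 yC]] : exists y, [/\ True, (P2 G).@[jet y] = 0 & forall h, C2 h -> dle (y - c.2) h].
  apply: (@newton_center N hN _ (closed_subT hN) n (P2 G) c.2 h1.2 C2).
  - by [].
  - by [].
  - exact: h12.
  - by exists e1, h1; split=> //; apply: dle_refl.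
  - move=> i; rewrite map_mderiv; have [->|cd] := hp i; [left|right].
      by rewrite raddf0.
    have FD : pover F G^`M(i) by apply: pover_deriv.
    move/(cdom_pair FD Fe1 Fh1) in cd.
    by apply: (cdom_move hN) cd => //; apply: dle_refl.
  - move=> _ [e [g [bg lg ->]]]; have [_ g2] := ball0 _ _ bg; have [Fe Fg _] := bg.
    split=> //; first by rewrite -(ball_le _ _ _ _ bg b1).
    move=> cd; apply: nG; exists e, g; split; first exact: bg.
    apply/(cdom_pair FG Fe Fg); apply: (cdom_move hN g2 _ (dle_refl _) cd).
    by rewrite -opprB (dleN hN); have [] := Zc _ _ bg.
exists (x, y); split; last first.
  by apply/eqP; rewrite -pair_eqE /pair_eq /= pmeval1 pmeval2 x0 y0 !eqxx.
split=> //= e g bg; have [d1 d2] := Zc _ _ bg.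
have -> : x - e.1 = (x - c.1) + (c.1 - e.1) by ring.
have -> : y - e.2 = (y - c.2) + (c.2 - e.2) by ring.
(* A ball of the nest with a larger radius contains the chosen one, so closeness at radius [h1] is
   enough. *)
have /orP[l|l] := dle_total hM g.1 h1.1.
  by split; [apply: (dleD hM) => //; apply: xC | apply: (dleD hN) => //; apply: yC]; exists e, g.
have l2 := l; rewrite (ball_le _ _ _ _ b1 bg) in l2.
split; [apply: (dleD hM) => //; apply: dle_trans l; apply: xC | apply: (dleD hN) => //; apply: dle_trans l2; apply: yC];
  by exists e1, h1; split=> //; apply: dle_refl.
Qed.

End ImmediateExtension.

(** * Maximal embeddings are total *)

Section EmbeddingTheorem.
Variables M N : structure.
Hypotheses (hM : is_model M) (hN : is_model N).
Local Notation K := (fsort M).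
Local Notation L := (fsort N).
Local Notation A := (K * L)%type.
Variables (S : K -> Prop) (Rk : rsort M -> rsort N -> Prop)
  (RG : vsort M -> vsort N -> Prop).
Hypothesis rv : rv_iso S Rk RG.
Hypothesis S_countable : exists f : nat -> K, forall x, S x -> exists n, f n = x.
Hypothesis N_complete : forall c r : nat -> L,
  (forall s, exists x, forall i, (i <= s)%N -> dle (x - c i) (r i)) ->
  exists x, forall i, dle (x - c i) (r i).

Lemma max_good_ex (F0 : A -> Prop) : good S Rk RG F0 ->
  exists F, max_good S Rk RG F /\ forall a, F0 a -> F a.
Proof.
(* Adding [F0] to [X] inside [T] covers the empty chain: its union together with [F0] is [F0], which
   is good. *)
move=> g0; pose T (X : set A) := good S Rk RG (fun a => F0 a \/ X a).
have [|X [TX mX]] := @Zorn_bigcup A T.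
  move=> C CT tC.
  have pick a b : (F0 a \/ (\bigcup_(X in C) X)%classic a) ->
      (F0 b \/ (\bigcup_(X in C) X)%classic b) ->
      exists F, [/\ good S Rk RG F, F a, F b &
        forall c, F c -> F0 c \/ (\bigcup_(X in C) X)%classic c].
    move=> [a0|[X CX Xa]] [b0|[Y CY Yb]].
    - by exists F0; split=> // c; left.
    - exists (fun a => F0 a \/ Y a); split; [exact: CT|by left|by right|].
      by move=> c [|Yc]; [left | right; exists Y].
    - exists (fun a => F0 a \/ X a); split; [exact: CT|by right|by left|].
      by move=> c [|Xc]; [left | right; exists X].
    - have [XY|YX] := tC _ _ CX CY.
        exists (fun a => F0 a \/ Y a); split; [exact: CT|by right; apply: XY|by right|].
        by move=> c [|Yc]; [left | right; exists Y].
      exists (fun a => F0 a \/ X a); split; [exact: CT|by right|by right; apply: YX|].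
      by move=> c [|Xc]; [left | right; exists X].
  split; first split.
  - by left; case: g0 => -[].
  - move=> a b ha hb; have [F [[[_ h _] _ _] Fa Fb Fs]] := pick _ _ ha hb.
    by apply: Fs; apply: h.
  - move=> a b ha hb; have [F [[[_ _ h] _ _] Fa Fb Fs]] := pick _ _ ha hb.
    by apply: Fs; apply: h.
  - move=> a ha; have [F [[_ h _] Fa _ Fs]] := pick _ _ ha ha.
    by apply: Fs; apply: h.
  - by move=> a ha; have [F [[_ _ h] Fa _ _]] := pick _ _ ha ha; apply: h.
exists (fun a => F0 a \/ X a); split; last by move=> a; left.
split=> // F' gF' sF' a Fa'; apply: contrapT => na.
have := mX F'; apply; last first.
  have e : (fun a => F0 a \/ F' a) = F'.
    by apply/funext => b; apply/propext; split=> [[h|//]|]; [apply: sF'; left|right].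
  by rewrite /T e.
split; last by move=> h; apply: na; right; apply: h.
by move=> b Xb; apply: sF'; right.
Qed.

Theorem embedding (F0 : A -> Prop) : good S Rk RG F0 ->
  exists F, [/\ good S Rk RG F, forall a, F0 a -> F a &
    forall x, S x -> exists y, F (x, y)].
Proof.
move=> g0; have [F [mF F0F]] := max_good_ex g0.
have hF := mF_ring mF.
have hS := rv_sub rv; have hSr := closed_sub_ring hS.
have full1 := residue_extension hM hN rv mF.
have full2 := value_extension hM hN rv mF full1.
(* Every leading term of [S] is the product of a represented value and a represented residue. *)
have full x : S x -> x != 0 -> exists a, F a /\ dlt (a.1 - x) x.
  move=> Sx x0; have [a [Fa ax]] := full2 x Sx x0.
  have a0 : a.1 != 0 by rewrite (deq_neq0 hM ax).
  have Sq : S (x / a.1).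
    by apply: (subM hSr) => //; apply: (closed_subV hS); apply: (mF_S mF).
  have [|k [Fk k1 hk]] := full1 _ Sq; first by rewrite deq_divr // mul1r deqC.
  exists (a * k); split; first exact: (subM hF).
  have /andP[ax1 _] := ax.
  have -> : (a * k).1 - x = a.1 * (k.1 - x / a.1).
    by rewrite mulrBr mulrCA divff // mulr1.
  have /andP[_ xa] := ax; apply: dlt_le_trans ax1.
  by rewrite -[X in dlt _ X]mulr1 (dltM2l hM).
exists F; split=> //; first by case: mF.
move=> x Sx; have [[y z] [Fb /= <-]] := immediate_extension hM hN rv mF full S_countable N_complete Sx.
by exists z.
Qed.

End EmbeddingTheorem.

(** * Ultraproducts *)

Lemma free_ultrafilter_ex : exists U : set_system nat,
  UltraFilter U /\ forall n, U [set m | (n <= m)%N]%classic.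
Proof.
have [U [uU sU]] := ultraFilterLemma eventually_filter.
by exists U; split=> // n; apply: sU; exists n.
Qed.

(** Truth almost everywhere for one nonprincipal ultrafilter, fixed once so that all ultraproducts
    share it. *)
Definition ae (P : nat -> Prop) : Prop := sval (cid free_ultrafilter_ex) P.

Section AlmostEverywhere.
Implicit Types P Q : nat -> Prop.
Let U := sval (cid free_ultrafilter_ex).
Let hU : UltraFilter U := proj1 (svalP (cid free_ultrafilter_ex)).
Let pU : ProperFilter U := @ultra_proper _ _ hU.
Let fU : Filter U := @filter_filter _ _ pU.

Lemma aeS P Q : (forall n, P n -> Q n) -> ae P -> ae Q.
Proof. by move=> h; apply: (@filterS _ _ fU). Qed.

Lemma aeI P Q : ae P -> ae Q -> ae (fun n => P n /\ Q n).
Proof. exact: (@filterI _ _ fU). Qed.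

Lemma aeT P : (forall n, P n) -> ae P.
Proof. by move=> h; apply: (@aeS (fun=> True)) => //; exact: (@filterT _ _ fU). Qed.

Lemma ae2 P Q T : ae P -> ae Q -> (forall n, P n -> Q n -> T n) -> ae T.
Proof. by move=> p q h; apply: aeS (aeI p q) => n []; apply: h. Qed.

Lemma ae_ge n : ae (fun m => (n <= m)%N).
Proof. by have [_ h] := svalP (cid free_ultrafilter_ex); apply: h. Qed.

Lemma aeF : ~ ae (fun=> False).
Proof.
have e : (fun=> False) = set0 :> set nat by apply/funext => n.
by rewrite /ae e; apply: (@filter_not_empty _ _ pU).
Qed.

Lemma ae_ex P : ae P -> exists n, P n.
Proof.
by move=> h; apply: contrapT => nP; apply: aeF; apply: aeS h => n Pn; apply: nP; exists n.
Qed.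

Lemma aeN P : ae (fun n => ~ P n) <-> ~ ae P.
Proof.
split=> [n p|n]; first by apply: aeF; apply: (ae2 n p).
by have [//|h] := in_ultra_setVsetC (P : set nat) hU.
Qed.

Lemma ae_or P Q : ae (fun n => P n \/ Q n) -> ae P \/ ae Q.
Proof.
move=> h; have [|/aeN n] := pselect (ae P); first by left.
by right; apply: (ae2 h n) => k [].
Qed.

Lemma ae_all_seq (T : eqType) (s : seq T) (R : T -> nat -> Prop) :
  (forall x, x \in s -> ae (R x)) -> ae (fun n => forall x, x \in s -> R x n).
Proof.
elim: s => [|x s IH] h; first exact: aeT.
apply: (ae2 (h x (mem_head _ _)) (IH _)) => [y ys|n rx rs y].
  by apply: h; rewrite inE ys orbT.
by rewrite inE => /orP[/eqP ->|/rs].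
Qed.

(* Countable saturation: choose at [n] a witness of the first [s(n)] conditions,
   where [s(n)] is the largest [s <= n] for which there is one. *)
Lemma ae_saturation (T : nat -> Type) (C : nat -> forall n, T n -> Prop) :
  (forall n, inhabited (T n)) ->
  (forall s, ae (fun n => exists w, forall i, (i <= s)%N -> C i n w)) ->
  exists w : forall n, T n, forall i, ae (fun n => C i n (w n)).
Proof.
move=> inh h.
pose ok n s := exists w, forall i, (i <= s)%N -> C i n w.
have pick n : exists w : T n, forall s, (s <= n)%N -> ok n s -> forall i, (i <= s)%N -> C i n w.
  have : forall k, exists w : T n, forall s, (s <= k)%N -> ok n s -> forall i, (i <= s)%N -> C i n w.
    elim=> [|k [w hw]].
      have [[w hw]|no] := pselect (ok n 0%N).
        by exists w => s; rewrite leqn0 => /eqP -> _.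
      by have [w] := inh n; exists w => s; rewrite leqn0 => /eqP ->.
    have [[w' hw']|no] := pselect (ok n k.+1).
      by exists w' => s sk _ i si; apply: hw'; apply: leq_trans si sk.
    by exists w => s; rewrite leq_eqVlt => /orP[/eqP ->|/hw].
  exact.
exists (fun n => sval (cid (pick n))) => i.
apply: (ae2 (h i) (ae_ge i)) => n oki ni.
by apply: (svalP (cid (pick n)) i ni oki).
Qed.

End AlmostEverywhere.

Section Ultraproduct.
Variable T : nat -> Type.
Implicit Types f g : forall n, T n.

(** The quotient by equality almost everywhere. Elements are the equivalence classes themselves,
    given as predicates, so that equivalent sequences yield equal elements. *)
Definition uprod : Type := {C : (forall n, T n) -> Prop | exists f, C = (fun g => ae (fun n => f n = g n))}.

Definition upi f : uprod := exist _ _ (ex_intro _ f erefl).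
Definition urep (x : uprod) : forall n, T n := sval (cid (svalP x)).

Lemma urepK x : upi (urep x) = x.
Proof.
case: x => C hC; apply: eq_exist; rewrite /urep.
by case: (cid _) => f /= ->.
Qed.

Lemma upiP f g : upi f = upi g <-> ae (fun n => f n = g n).
Proof.
split=> [[]|h].
  move=> /(congr1 (fun C => C g)) e; rewrite e; exact: aeT.
apply: eq_exist; apply/funext => k; apply/propext; split=> e; by apply: (ae2 h e) => n ->.
Qed.

Lemma urep_pi f : ae (fun n => urep (upi f) n = f n).
Proof. by apply/upiP; rewrite urepK. Qed.

Lemma upi_ind (P : uprod -> Prop) : (forall f, P (upi f)) -> forall x, P x.
Proof. by move=> h x; rewrite -(urepK x). Qed.

End Ultraproduct.

Definition umap (T T' : nat -> Type) (F : forall n, T n -> T' n) (x : uprod T) : uprod T' :=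
  upi (fun n => F n (urep x n)).
Definition umap2 (T T' T'' : nat -> Type) (F : forall n, T n -> T' n -> T'' n)
    (x : uprod T) (y : uprod T') : uprod T'' := upi (fun n => F n (urep x n) (urep y n)).

Lemma umapE (T T' : nat -> Type) (F : forall n, T n -> T' n) f :
  umap F (upi f) = upi (fun n => F n (f n)).
Proof. by apply/upiP; apply: aeS (urep_pi f) => n ->. Qed.

Lemma umap2E (T T' T'' : nat -> Type) (F : forall n, T n -> T' n -> T'' n) f g :
  umap2 F (upi f) (upi g) = upi (fun n => F n (f n) (g n)).
Proof. by apply/upiP; apply: (ae2 (urep_pi f) (urep_pi g)) => n -> ->. Qed.

Section UltraZmod.
Variable V : nat -> zmodType.
Definition uzmod : Type := uprod (fun n => V n : Type).
HB.instance Definition _ := gen_eqMixin uzmod.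
HB.instance Definition _ := gen_choiceMixin uzmod.

Let add : uzmod -> uzmod -> uzmod := umap2 (fun n => @GRing.add (V n)).
Let opp : uzmod -> uzmod := umap (fun n => @GRing.opp (V n)).
Let zero : uzmod := upi (fun n => 0 : V n).

Let addE f g : add (upi f) (upi g) = upi (fun n => f n + g n : V n) := umap2E _ f g.
Let addA : associative add.
Proof.
elim/upi_ind => f; elim/upi_ind => g; elim/upi_ind => h.
by rewrite !addE; apply/upiP/aeT => n; rewrite addrA.
Qed.
Let addC : commutative add.
Proof.
by elim/upi_ind => f; elim/upi_ind => g; rewrite /add !umap2E; apply/upiP/aeT => n; rewrite addrC.
Qed.
Let add0 : left_id zero add.
Proof. by elim/upi_ind => f; rewrite /add umap2E; apply/upiP/aeT => n; rewrite add0r. Qed.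
Let addN : left_inverse zero opp add.
Proof. by elim/upi_ind => f; rewrite /add /opp umapE umap2E; apply/upiP/aeT => n; rewrite addNr. Qed.

HB.instance Definition _ := GRing.isZmodule.Build uzmod addA addC add0 addN.

Definition uz (f : forall n, V n) : uzmod := upi (fun n => f n : (fun n => V n : Type) n).

Lemma uzP f g : uz f = uz g <-> ae (fun n => f n = g n).
Proof. exact: upiP. Qed.
Lemma uz_ind (P : uzmod -> Prop) : (forall f, P (uz f)) -> forall x, P x.
Proof. exact: upi_ind. Qed.
Lemma uzD f g : uz f + uz g = uz (fun n => f n + g n).
Proof. exact: (umap2E (fun n => @GRing.add (V n))). Qed.
Lemma uzN f : - uz f = uz (fun n => - f n).
Proof. exact: (umapE (fun n => @GRing.opp (V n))). Qed.
Lemma uz0 : 0 = uz (fun n => 0).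
Proof. by []. Qed.
Lemma uz_neq0 f : uz f != 0 <-> ae (fun n => f n != 0).
Proof.
split=> [h|h].
  have : ~ ae (fun n => f n = 0) by move/uzP => e; rewrite e -uz0 eqxx in h.
  by move/aeN; apply: aeS => n /eqP.
by apply/eqP; rewrite uz0 => /uzP e; apply: aeF; apply: (ae2 h e) => n /eqP.
Qed.
End UltraZmod.

Section UltraField.
Variable R : nat -> fieldType.
Definition ufield : Type := uzmod (fun n => R n : zmodType).
HB.instance Definition _ := GRing.Zmodule.on ufield.

Let mul : ufield -> ufield -> ufield := umap2 (fun n => @GRing.mul (R n)).
Let inv : ufield -> ufield := umap (fun n => @GRing.inv (R n)).
Let one : ufield := upi (fun n => 1 : R n).

Let mulE f g : mul (upi f) (upi g) = upi (fun n => f n * g n : R n) := umap2E _ f g.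
Let mulA : associative mul.
Proof.
elim/upi_ind => f; elim/upi_ind => g; elim/upi_ind => h.
by rewrite !mulE; apply/upiP/aeT => n; rewrite mulrA.
Qed.
Let mulC : commutative mul.
Proof.
by elim/upi_ind => f; elim/upi_ind => g; rewrite /mul !umap2E; apply/upiP/aeT => n; rewrite mulrC.
Qed.
Let mul1 : left_id one mul.
Proof. by elim/upi_ind => f; rewrite /mul umap2E; apply/upiP/aeT => n; rewrite mul1r. Qed.
Let mulDl : left_distributive mul +%R.
Proof.
elim/uz_ind => f; elim/uz_ind => g; elim/uz_ind => h.
rewrite uzD /mul !umap2E -[RHS]/(uz _ + uz _) uzD.
by apply/upiP/aeT => n; rewrite mulrDl.
Qed.
Let one_neq0 : one != 0.
Proof. by apply/(uz_neq0 (V := fun n => R n : zmodType))/aeT => n; apply: oner_neq0. Qed.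

HB.instance Definition _ := GRing.Zmodule_isComNzRing.Build ufield mulA mulC mul1 mulDl one_neq0.

Let mulV x : x != 0 -> inv x * x = 1.
Proof.
elim/uz_ind: x => f /uz_neq0 h.
rewrite /inv umapE [LHS]mulE.
by apply/upiP; apply: aeS h => n; apply: mulVf.
Qed.
Let inv0 : inv 0 = 0.
Proof. by rewrite /inv uz0 umapE; apply/upiP/aeT => n; rewrite invr0. Qed.
HB.instance Definition _ := GRing.ComNzRing_isField.Build ufield mulV inv0.

Definition uf (f : forall n, R n) : ufield := uz (V := fun n => R n : zmodType) f.

Lemma ufP f g : uf f = uf g <-> ae (fun n => f n = g n). Proof. exact: uzP. Qed.
Lemma uf_ind (P : ufield -> Prop) : (forall f, P (uf f)) -> forall x, P x.
Proof. exact: uz_ind. Qed.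
Lemma ufD f g : uf f + uf g = uf (fun n => f n + g n). Proof. exact: uzD. Qed.
Lemma ufN f : - uf f = uf (fun n => - f n). Proof. exact: uzN. Qed.
Lemma uf0 : 0 = uf (fun n => 0). Proof. by []. Qed.
Lemma uf1 : 1 = uf (fun n => 1). Proof. by []. Qed.
Lemma ufM f g : uf f * uf g = uf (fun n => f n * g n).
Proof. exact: (umap2E (fun n => @GRing.mul (R n))). Qed.
Lemma ufV f : (uf f)^-1 = uf (fun n => (f n)^-1).
Proof. exact: (umapE (fun n => @GRing.inv (R n))). Qed.
Lemma uf_neq0 f : uf f != 0 <-> ae (fun n => f n != 0). Proof. exact: uz_neq0. Qed.
Lemma uf_sum (I : Type) (r : seq I) (F : I -> forall n, R n) :
  \sum_(i <- r) uf (F i) = uf (fun n => \sum_(i <- r) F i n).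
Proof.
elim: r => [|i r IH]; first by rewrite big_nil uf0; apply/ufP/aeT => n; rewrite big_nil.
by rewrite big_cons IH ufD; apply/ufP/aeT => n; rewrite big_cons.
Qed.
Lemma uf_prod (I : Type) (r : seq I) (F : I -> forall n, R n) :
  \prod_(i <- r) uf (F i) = uf (fun n => \prod_(i <- r) F i n).
Proof.
elim: r => [|i r IH]; first by rewrite big_nil uf1; apply/ufP/aeT => n; rewrite big_nil.
by rewrite big_cons IH ufM; apply/ufP/aeT => n; rewrite big_cons.
Qed.
Lemma ufX f k : uf f ^+ k = uf (fun n => f n ^+ k).
Proof.
elim: k => [|k IH]; first by rewrite expr0 uf1.
by rewrite exprS IH ufM; apply/ufP/aeT => n; rewrite exprS.
Qed.
Lemma uf_nat k : k%:R = uf (fun n => k%:R).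
Proof.
elim: k => [|k IH]; first by rewrite mulr0n.
by rewrite mulrS IH uf1 ufD; apply/ufP/aeT => n; rewrite mulrS.
Qed.
End UltraField.

Section UltraLimit.
Variable V : nat -> zmodType.
Implicit Types f g : forall n, option (V n).

(** A sequence is infinite almost everywhere or finite almost everywhere, so an ultraproduct of
    options is an option over the ultraproduct. *)
Definition ulim f : option (uzmod V) :=
  if `[< ae (fun n => f n <> None) >] then Some (uz (fun n => odflt 0 (f n))) else None.

Lemma ulim_some f (g : forall n, V n) : ae (fun n => f n = Some (g n)) -> ulim f = Some (uz g).
Proof.
move=> h; rewrite /ulim; case: asboolP => [_|[]]; last by apply: aeS h => n ->.
by congr Some; apply/uzP; apply: aeS h => n ->.
Qed.

Lemma ulim_none f : ae (fun n => f n = None) -> ulim f = None.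
Proof.
move=> h; rewrite /ulim; case: asboolP => // k.
by case: aeF; apply: (ae2 h k) => n ->.
Qed.

Lemma ulim_case f : ae (fun n => f n = None) \/ exists g : forall n, V n, ae (fun n => f n = Some (g n)).
Proof.
have [h|/aeN h] := pselect (ae (fun n => f n = None)); first by left.
by right; exists (fun n => odflt 0 (f n)); apply: aeS h => n; case: (f n).
Qed.

Lemma ulimP f g : ulim f = ulim g <-> ae (fun n => f n = g n).
Proof.
split=> [|h].
  have [hf|[f' hf]] := ulim_case f; have [hg|[g' hg]] := ulim_case g.
  - by move=> _; apply: (ae2 hf hg) => n -> ->.
  - by rewrite (ulim_none hf) (ulim_some hg).
  - by rewrite (ulim_none hg) (ulim_some hf).
  rewrite (ulim_some hf) (ulim_some hg) => e.
  move: (Some_inj e) => /uzP {}e.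
  by apply: (ae2 (aeI hf hg) e) => n [-> ->] ->.
have [hf|[f' hf]] := ulim_case f.
  by rewrite (ulim_none hf) (ulim_none (f := g)) //; apply: (ae2 h hf) => n ->.
by rewrite (ulim_some hf) (ulim_some (f := g) (g := f')) //; apply: (ae2 h hf) => n ->.
Qed.

Lemma ulim_uz (g : forall n, V n) : ulim (fun n => Some (g n)) = Some (uz g).
Proof. exact/ulim_some/aeT. Qed.

Lemma ulim_ind (P : option (uzmod V) -> Prop) : (forall f, P (ulim f)) -> forall o, P o.
Proof.
move=> h [x|]; last by rewrite -(ulim_none (f := fun=> None)) //; exact: aeT.
by elim/uz_ind: x => f; rewrite -ulim_uz.
Qed.

Lemma ulim_addE f g : oadd (ulim f) (ulim g) = ulim (fun n => oadd (f n) (g n)).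
Proof.
have [hf|[f' hf]] := ulim_case f.
  by rewrite (ulim_none hf) [RHS]ulim_none //; apply: aeS hf => n ->.
have [hg|[g' hg]] := ulim_case g.
  by rewrite (ulim_none hg) (ulim_some hf) [RHS]ulim_none //; apply: (ae2 hf hg) => n -> ->.
rewrite (ulim_some hf) (ulim_some hg) -[LHS]/(Some (uz f' + uz g')) uzD; symmetry.
by apply: ulim_some; apply: (ae2 hf hg) => n -> ->.
Qed.
End UltraLimit.

Lemma ulim_omap (V W : nat -> zmodType) (F : forall n, V n -> W n) (f : forall n, option (V n)) :
  omap (umap F : uzmod V -> uzmod W) (ulim f) = ulim (fun n => omap (F n) (f n)).
Proof.
have [hf|[f' hf]] := ulim_case f.
  by rewrite (ulim_none hf) [RHS]ulim_none //; apply: aeS hf => n ->.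
rewrite (ulim_some hf) [LHS]/= (umapE F); symmetry.
by apply: ulim_some; apply: aeS hf => n ->.
Qed.

Lemma ulim_mulE (R : nat -> fieldType) (f g : forall n, option (R n)) :
  omul (ulim f : option (ufield R)) (ulim g) = ulim (fun n => omul (f n) (g n)).
Proof.
have [hf|[f' hf]] := ulim_case f.
  by rewrite (ulim_none hf) [RHS]ulim_none //; apply: aeS hf => n ->.
have [hg|[g' hg]] := ulim_case g.
  by rewrite (ulim_none hg) (ulim_some hf) [RHS]ulim_none //; apply: (ae2 hf hg) => n -> ->.
rewrite (ulim_some hf) (ulim_some hg) [LHS]/= [X in Some X = _](@ufM R f' g'); symmetry.
by apply: ulim_some; apply: (ae2 hf hg) => n -> ->.
Qed.

Section UltraGroup.
Variable G : nat -> porderZmodType.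
Definition ugroup : Type := uzmod (fun n => G n : zmodType).
HB.instance Definition _ := GRing.Zmodule.on ugroup.

Let le : rel ugroup := fun x y => `[< ae (fun n => (urep x n : G n) <= (urep y n : G n)) >].

Let leE (f g : forall n, G n) : le (upi f) (upi g) <-> ae (fun n => f n <= g n).
Proof.
split=> [/asboolP h|h].
  by apply: (ae2 (aeI (urep_pi f) (urep_pi g)) h) => n [-> ->].
by apply/asboolP; apply: (ae2 (aeI (urep_pi f) (urep_pi g)) h) => n [-> ->].
Qed.
Let le_refl : reflexive le.
Proof. by elim/upi_ind => f; apply/leE/aeT => n; apply: lexx. Qed.
Let le_anti : antisymmetric le.
Proof.
elim/upi_ind => f; elim/upi_ind => g /andP[/leE h /leE k].
by apply/upiP; apply: (ae2 h k) => n a b; apply/eqP; rewrite eq_le a b.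
Qed.
Let le_trans : transitive le.
Proof.
elim/upi_ind => f; elim/upi_ind => g; elim/upi_ind => h /leE a /leE b.
by apply/leE; apply: (ae2 a b) => n; apply: le_trans.
Qed.
HB.instance Definition _ :=
  Order.Le_isPOrder.Build ring_display ugroup le_refl le_anti le_trans.

Definition ug (f : forall n, G n) : ugroup := uz (V := fun n => G n : zmodType) f.
Lemma ug_le f g : ug f <= ug g <-> ae (fun n => f n <= g n).
Proof. exact: leE. Qed.

Lemma ulim_le (f g : forall n, option (G n)) :
  ole (ulim f : option ugroup) (ulim g) <-> ae (fun n => ole (f n) (g n)).
Proof.
have [hg|[g' hg]] := ulim_case g.
  rewrite (ulim_none hg); split=> [_|_]; last by case: (ulim f).
  by apply: aeS hg => n ->; case: (f n).
have [hf|[f' hf]] := ulim_case f.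
  rewrite (ulim_none hf) (ulim_some hg); split=> // h.
  by case: aeF; apply: (ae2 (aeI hf hg) h) => n [-> ->].
rewrite (ulim_some hf) (ulim_some hg); apply: (iff_trans (ug_le f' g')); split=> h;
  by apply: (ae2 (aeI hf hg) h) => n [-> ->].
Qed.
End UltraGroup.

(** * Ultraproducts of structures *)

Section Ultrastructure.
Variable S : nat -> structure.

Section DiffField.
Variable K : nat -> diffField.
Let R n : fieldType := K n.
Let uder : ufield R -> ufield R := umap (fun n => @der (K n)).
Let uderD a b : uder (a + b) = uder a + uder b.
Proof.
elim/uf_ind: a => f; elim/uf_ind: b => g; rewrite ufD /uder !umapE [RHS]ufD.
by apply/upiP/aeT => n; rewrite derD.
Qed.
Let uderM a b : uder (a * b) = uder a * b + a * uder b.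
Proof.
elim/uf_ind: a => f; elim/uf_ind: b => g; rewrite ufM /uder !umapE.
rewrite -[upi _]/(uf _) -[upi (fun n => der (f n))]/(uf _) -[upi (fun n => der (g n))]/(uf _) !ufM ufD.
by apply/upiP/aeT => n; rewrite derM.
Qed.
Let uchar0 : [pchar ufield R] =i pred0.
Proof.
move=> p; rewrite inE; apply/negP => /andP[pp /eqP].
rewrite uf_nat => /ufP h; apply: aeF; apply: aeS h => n /eqP.
by have := dfield_char0 (K n) p; rewrite inE pp /= => ->.
Qed.
Definition udiff : diffField := DiffField uderD uderM uchar0.
Definition ud (f : forall n, K n) : udiff := uf (R := R) f.
Lemma udP f g : ud f = ud g <-> ae (fun n => f n = g n). Proof. exact: ufP. Qed.
Lemma ud_ind (P : udiff -> Prop) : (forall f, P (ud f)) -> forall x, P x.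
Proof. exact: uf_ind. Qed.
Lemma udD f g : ud f + ud g = ud (fun n => f n + g n). Proof. exact: ufD. Qed.
Lemma udN f : - ud f = ud (fun n => - f n). Proof. exact: ufN. Qed.
Lemma udM f g : ud f * ud g = ud (fun n => f n * g n). Proof. exact: ufM. Qed.
Lemma udV f : (ud f)^-1 = ud (fun n => (f n)^-1). Proof. exact: ufV. Qed.
Lemma ud_der f : der (ud f) = ud (fun n => der (f n)). Proof. exact: (umapE (fun n => @der (K n))). Qed.
Lemma ud_logder f : logder (ud f) = ud (fun n => logder (f n)).
Proof. by rewrite /logder ud_der udV udM. Qed.
Lemma ud_neq0 f : ud f != 0 <-> ae (fun n => f n != 0). Proof. exact: uf_neq0. Qed.
End DiffField.

Let K n := fsort (S n).
Let k n := rsort (S n).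
Let G n := vsort (S n).

Definition ustr : structure := @Structure (udiff K) (udiff k) (ugroup G)
  (fun x => ulim (fun n => residue (urep x n)))
  (fun x => ulim (fun n => valuation (urep x n)))
  (umap (fun n => @cmap (S n)))
  (umap (fun n => @ac (S n))).

Definition uF (f : forall n, fsort (S n)) : fsort ustr := @ud K f.
Definition uR (f : forall n, rsort (S n)) : rsort ustr := @ud k f.
Definition uG (f : forall n, vsort (S n)) : vsort ustr := @ug G f.
Definition uRo (f : forall n, option (rsort (S n))) : option (rsort ustr) := @ulim k f.
Definition uGo (f : forall n, option (vsort (S n))) : option (vsort ustr) := @ulim G f.

Lemma uF_residue f : residue (uF f) = uRo (fun n => residue (f n)).
Proof. by apply/ulimP; apply: aeS (urep_pi f) => n ->. Qed.
Lemma uF_val f : valuation (uF f) = uGo (fun n => valuation (f n)).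
Proof. by apply/ulimP; apply: aeS (urep_pi f) => n ->. Qed.
Lemma uG_cmap f : cmap (uG f) = uR (fun n => cmap (f n)).
Proof. exact: (umapE (fun n => @cmap (S n))). Qed.
Lemma uF_ac f : ac (uF f) = uR (fun n => ac (f n)).
Proof. exact: (umapE (fun n => @ac (S n))). Qed.
End Ultrastructure.

(** * The axioms in ultraproducts *)

Section UltraModel.
Variable S : nat -> structure.
Hypothesis hS : forall n, is_model (S n).
Local Notation U := (ustr S).
Local Notation K n := (fsort (S n)).

Lemma uF_P (f g : forall n, K n) : uF f = uF g <-> ae (fun n => f n = g n).
Proof. exact: udP. Qed.
Lemma uF_ind (P : fsort U -> Prop) : (forall f, P (uF f)) -> forall x, P x.
Proof. exact: ud_ind. Qed.
Lemma uF_neq0 (f : forall n, K n) : uF f != 0 <-> ae (fun n => f n != 0).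
Proof. exact: ud_neq0. Qed.
Lemma uFD (f g : forall n, K n) : uF f + uF g = uF (fun n => f n + g n). Proof. exact: udD. Qed.
Lemma uFN (f : forall n, K n) : - uF f = uF (fun n => - f n). Proof. exact: udN. Qed.
Lemma uFM (f g : forall n, K n) : uF f * uF g = uF (fun n => f n * g n). Proof. exact: udM. Qed.
Lemma uF_der (f : forall n, K n) : der (uF f) = uF (fun n => der (f n)). Proof. exact: ud_der. Qed.
Lemma uF_logder (f : forall n, K n) : logder (uF f) = uF (fun n => logder (f n)).
Proof. exact: ud_logder. Qed.
Lemma uRo_P (f g : forall n, option (rsort (S n))) : uRo f = uRo g <-> ae (fun n => f n = g n).
Proof. exact: ulimP. Qed.
Lemma uGo_P (f g : forall n, option (vsort (S n))) : uGo f = uGo g <-> ae (fun n => f n = g n).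
Proof. exact: ulimP. Qed.
Lemma uRoE (f : forall n, rsort (S n)) : Some (uR f) = uRo (fun n => Some (f n)).
Proof. by rewrite /uRo ulim_uz. Qed.
Lemma uGoE (f : forall n, vsort (S n)) : Some (uG f) = uGo (fun n => Some (f n)).
Proof. by rewrite /uGo ulim_uz. Qed.
Lemma uGo_le (f g : forall n, option (vsort (S n))) :
  ole (uGo f) (uGo g) <-> ae (fun n => ole (f n) (g n)).
Proof. exact: ulim_le. Qed.
Lemma uGo_add (f g : forall n, option (vsort (S n))) :
  oadd (uGo f) (uGo g) = uGo (fun n => oadd (f n) (g n)).
Proof. exact: ulim_addE. Qed.
Lemma uGo_opp (f : forall n, option (vsort (S n))) :
  omap -%R (uGo f) = uGo (fun n => omap -%R (f n)).
Proof. exact: (ulim_omap (fun n => @GRing.opp (vsort (S n)))). Qed.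
Lemma uGo_cmap (f : forall n, option (vsort (S n))) :
  omap cmap (uGo f) = uRo (fun n => omap cmap (f n)).
Proof. exact: (ulim_omap (fun n => @cmap (S n))). Qed.
Lemma uRo_add (f g : forall n, option (rsort (S n))) :
  oadd (uRo f) (uRo g) = uRo (fun n => oadd (f n) (g n)).
Proof. exact: ulim_addE. Qed.
Lemma uRo_opp (f : forall n, option (rsort (S n))) :
  omap -%R (uRo f) = uRo (fun n => omap -%R (f n)).
Proof. exact: (ulim_omap (fun n => @GRing.opp (rsort (S n)))). Qed.
Lemma uRo_mul (f g : forall n, option (rsort (S n))) :
  omul (uRo f) (uRo g) = uRo (fun n => omul (f n) (g n)).
Proof. exact: ulim_mulE. Qed.
Lemma uRo_der (f : forall n, option (rsort (S n))) :
  omap der (uRo f) = uRo (fun n => omap der (f n)).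
Proof. exact: (ulim_omap (fun n => @der (rsort (S n)))). Qed.
Lemma uRo_ind (P : option (rsort U) -> Prop) : (forall f, P (uRo f)) -> forall o, P o.
Proof. exact: ulim_ind. Qed.
Lemma uGo_ind (P : option (vsort U) -> Prop) : (forall f, P (uGo f)) -> forall o, P o.
Proof. exact: ulim_ind. Qed.
Lemma uR_ind (P : rsort U -> Prop) : (forall f, P (uR f)) -> forall o, P o.
Proof. exact: ud_ind. Qed.
Lemma uG_ind (P : vsort U -> Prop) : (forall f, P (uG f)) -> forall o, P o.
Proof. exact: uz_ind. Qed.
Lemma uGD (f g : forall n, vsort (S n)) : uG f + uG g = uG (fun n => f n + g n).
Proof. exact: uzD. Qed.
Lemma uGo0 : Some (0 : vsort U) = uGo (fun n => Some 0).
Proof. exact: (uGoE (fun n => 0)). Qed.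
Lemma uGoN : None = @uGo S (fun n => None).
Proof. by symmetry; apply/ulim_none/aeT. Qed.
Lemma uRoN : None = @uRo S (fun n => None).
Proof. by symmetry; apply/ulim_none/aeT. Qed.

Lemma uF_in_O (f : forall n, K n) : in_O (uF f) <-> ae (fun n => in_O (f n)).
Proof. by rewrite /in_O uF_val uGo0 uGo_le. Qed.

Lemma uF_dle (f g : forall n, K n) : dle (uF f) (uF g) <-> ae (fun n => dle (f n) (g n)).
Proof. by rewrite /dle !uF_val uGo_le. Qed.

Lemma aeNb (P : nat -> bool) : ae (fun n => ~~ P n) <-> ~ ae P.
Proof. by rewrite -aeN; split; apply: aeS => n /negP. Qed.

Lemma ae_choice (T : nat -> Type) (C : forall n, T n -> Prop) :
  (forall n, inhabited (T n)) -> ae (fun n => exists w, C n w) ->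
  exists w : forall n, T n, ae (fun n => C n (w n)).
Proof.
move=> inh h; have [|w hw] := @ae_saturation T (fun=> C) inh.
  by move=> s; apply: aeS h => n [w hw]; exists w.
by exists w; apply: (hw 0%N).
Qed.

Lemma ultra_ordered_group : ordered_group (vsort U).
Proof.
split=> [|].
  elim/uG_ind => f; elim/uG_ind => g.
  have : ae (fun n => f n <= g n \/ g n <= f n).
    by apply: aeT => n; have [/(_ (f n) (g n)) /orP] := model_ordered_group (hS n).
  by move/ae_or => [] h; apply/orP; [left|right]; apply/ug_le.
elim/uG_ind => f; elim/uG_ind => g; elim/uG_ind => h /ug_le fg.
by rewrite !uGD; apply/ug_le; apply: aeS fg => n; have [_] := model_ordered_group (hS n); apply.
Qed.

Lemma uF0 : (0 : fsort U) = uF (fun=> 0). Proof. by []. Qed.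
Lemma uF1 : (1 : fsort U) = uF (fun=> 1). Proof. by []. Qed.

Lemma ultra_valuation : valuation_axiom U.
Proof.
split.
- elim/uF_ind => f; rewrite uF_val uGoN uGo_P uF0 uF_P.
  by split; apply: aeS => n; have [/(_ (f n)) [h1 h2]] := model_valuation (hS n).
- elim/uF_ind => f; elim/uF_ind => g; rewrite uFM !uF_val uGo_add.
  by apply/uGo_P/aeT => n; have [_] := model_valuation (hS n).
- elim/uF_ind => f; elim/uF_ind => g; rewrite uFD !uF_val /omin.
  by case: ifP => [/uGo_le h|/negP h]; [|move/uGo_le/aeNb : h => h]; apply/uGo_le; apply: aeS h => n h;
    have [_ _ /(_ (f n) (g n))] := model_valuation (hS n); rewrite /omin ?h ?(negbTE h).
elim/uG_ind => g.
have [f hf] := @ae_choice (fun n => K n) (fun n a => valuation a = Some (g n))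
  (fun n => inhabits 0) (aeT (fun n => let: And4 _ _ _ h := model_valuation (hS n) in h (g n))).
by exists (uF f); rewrite uF_val uGoE; apply/uGo_P.
Qed.

Lemma ultra_monotone : monotone_axiom U.
Proof.
elim/uF_ind => f /uF_neq0 h; rewrite uF_der !uF_val; apply/uGo_le.
by apply: aeS h => n; apply: (model_monotone (hS n)).
Qed.

Lemma ultra_residue : residue_axiom U.
Proof.
split.
  split.
  - elim/uF_ind => f; rewrite uF_residue uRoN uRo_P.
    have -> : ~~ in_O (uF f) <-> ae (fun n => ~~ in_O (f n)).
      by rewrite aeNb -uF_in_O; split=> /negP.
    by split; apply: aeS => n; have [[/(_ (f n)) [h1 h2] _ _ _ _] _] := model_residue (hS n).
  - rewrite uF1 uF_residue -[Some 1]/(Some (uR (fun=> 1))) uRoE; apply/uRo_P/aeT => n.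
    by have [[_ -> _ _ _] _] := model_residue (hS n).
  - elim/uF_ind => f; elim/uF_ind => g /uF_in_O h1 /uF_in_O h2.
    rewrite uFD !uF_residue uRo_add; apply/uRo_P; apply: (ae2 h1 h2) => n p q.
    by have [[_ _ /(_ _ _ p q) h _ _] _] := model_residue (hS n).
  - elim/uF_ind => f; elim/uF_ind => g /uF_in_O h1 /uF_in_O h2.
    rewrite uFM !uF_residue uRo_mul; apply/uRo_P; apply: (ae2 h1 h2) => n p q.
    by have [[_ _ _ /(_ _ _ p q) h _] _] := model_residue (hS n).
  elim/uF_ind => f /uF_in_O h1.
  rewrite uF_der !uF_residue uRo_der; apply/uRo_P; apply: aeS h1 => n p.
  by have [[_ _ _ _ h] _] := model_residue (hS n); apply: h.
elim/uR_ind => u.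
have [f hf] := @ae_choice (fun n => K n) (fun n a => residue a = Some (u n))
  (fun n => inhabits 0) (aeT (fun n => (model_residue (hS n)).2 (u n))).
by exists (uF f); rewrite uF_residue uRoE; apply/uRo_P.
Qed.

Lemma ultra_cmap : cmap_axiom U.
Proof.
split.
  elim/uG_ind => f; elim/uG_ind => g.
  rewrite uGD !uG_cmap [RHS]udD.
  by apply/udP/aeT => n; have [->] := model_cmap (hS n).
elim/uG_ind => g.
have [f hf] := @ae_choice (fun n => K n)
  (fun n a => [/\ a != 0, valuation a = Some (g n) & residue (logder a) = Some (cmap (g n))])
  (fun n => inhabits 0) (aeT (fun n => (model_cmap (hS n)).2 (g n))).
exists (uF f); rewrite uF_logder uF_val uF_residue uG_cmap uGoE uRoE; split.
- by apply/uF_neq0; apply: aeS hf => n [].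
- by apply/uGo_P; apply: aeS hf => n [].
by apply/uRo_P; apply: aeS hf => n [].
Qed.

Lemma ultra_ac : ac_axiom U.
Proof.
split.
  split.
  - rewrite uF0 uF_ac; apply/udP/aeT => n; by have [[]] := model_ac (hS n).
  - elim/uF_ind => f /uF_neq0 h; rewrite uF_ac; apply/ud_neq0; apply: aeS h => n.
    by have [[_ h _] _] := model_ac (hS n); apply: h.
  elim/uF_ind => f; elim/uF_ind => g /uF_neq0 p /uF_neq0 q; rewrite uFM !uF_ac [RHS]udM.
  by apply/udP; apply: (ae2 p q) => n; have [[_ _ h] _] := model_ac (hS n); apply: h.
split.
- elim/uF_ind => f; rewrite uF_val uF_residue uF_ac uGo0 uRoE => /uGo_P h.
  by apply/uRo_P; apply: aeS h => n; have [_ [h _ _]] := model_ac (hS n); apply: h.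
- elim/uF_ind => f; elim/uG_ind => g.
  rewrite uF_der uF_logder !uF_val uGoE => /uGo_P p /uGo_P q.
  rewrite !uF_ac ud_logder uG_cmap [RHS]udD; apply/udP; apply: (ae2 p q) => n.
  by have [_ [_ h _]] := model_ac (hS n); apply: h.
elim/uF_ind => f; elim/uG_ind => g.
rewrite uF_der uF_val uF0 uGoE => /uGo_P p /uF_P q.
rewrite uF_ac ud_logder uG_cmap [RHS]udN; apply/udP; apply: (ae2 p q) => n.
by have [_ [_ _ h]] := model_ac (hS n); apply: h.
Qed.

Lemma iter_uF_der j (f : forall n, K n) : iter j der (uF f) = uF (fun n => iter j der (f n)).
Proof. by elim: j => //= j ->; exact: uF_der. Qed.

(** A polynomial over the ultraproduct has finitely many coefficients and hence comes from a
    sequence of polynomials [Q n] supported in one finite set [D]. The hypotheses concern finitely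
    many coefficients, so they hold almost everywhere. *)
Lemma ultra_dhenselian : dhenselian_axiom U.
Proof.
move=> P hO /dmsize2P [h1 [m1 [d1 n1]]].
pose c m n : K n := urep (monalg.mcoeff m P) n.
have cE m : monalg.mcoeff m P = uF (c m) by rewrite /uF /ud /uf /uz urepK.
pose D := monalg.msupp P.
pose Q n : dpoly (K n) unit := \sum_(m <- D) mkmalgU m (c m n).
have QE n m : monalg.mcoeff m (Q n) = if m \in D then c m n else 0.
  by rewrite /Q (@mcoeff_sumU _ _ _ _ id) ?fset_uniq.
have redE m : monalg.mcoeff m (dpoly_red P) = uR (fun n => monalg.mcoeff m (dpoly_red (Q n))).
  rewrite mcoeff_dpoly_redE; case: ifPn => mD; last first.
    apply/udP/aeT => n; rewrite mcoeff_dpoly_redE QE (negbTE mD).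
    by case: ifP => // _; rewrite res0.
  have c0 : ae (fun n => c m n != 0) by apply/uF_neq0; rewrite -cE monalg.mcoeff_neq0.
  have cO : ae (fun n => in_O (c m n)) by apply/uF_in_O; rewrite -cE.
  have e : residue (uF (c m)) = Some (uR (fun n => monalg.mcoeff m (dpoly_red (Q n)))).
    rewrite uF_residue uRoE; apply/uRo_P; apply: (ae2 c0 cO) => n cn0 cnO.
    rewrite mcoeff_dpoly_redE -monalg.mcoeff_neq0 QE mD cn0 residueE //.
    by rewrite -in_OE.
  by rewrite /res cE e.
have aeO : ae (fun n => forall m, m \in (D : seq _) -> in_O (c m n)).
  by apply: ae_all_seq => m _; apply/uF_in_O; rewrite -cE.
have ae0 : ae (fun n => forall m, m \in (D : seq _) -> (1 < monalg.mdeg m)%N ->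
    monalg.mcoeff m (dpoly_red (Q n)) = 0).
  apply: ae_all_seq => m _; have [dm|ndm] := boolP (1 < monalg.mdeg m)%N.
    by move/h1: dm; rewrite redE => /udP; apply: aeS.
  by apply: aeT.
have ae1 : ae (fun n => monalg.mcoeff m1 (dpoly_red (Q n)) != 0) by apply/ud_neq0; rewrite redE in n1.
have [|a ha] := @ae_choice (fun n => K n)
   (fun n a => in_O a /\ dpoly_eval id (Q n) (fun=> a) = 0) (fun n => inhabits 0).
  apply: (ae2 (aeI aeO ae0) ae1) => n [nO n0 nn1].
  have [||a aO e] := model_dhenselian (hS n) (P := Q n); last by exists a.
    move=> m; rewrite QE; case: ifP => [/nO //|_]; by rewrite in_OE ?dle0 //; apply: hS.
  apply/dmsize2P; split=> [m dm|]; last by exists m1.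
  have [mD|mD] := boolP (m \in D); first exact: n0.
  rewrite mcoeff_dpoly_redE -monalg.mcoeff_neq0 QE (negbTE mD) eqxx //.
exists (uF a); first by apply/uF_in_O; apply: aeS ha => n [].
transitivity (uF (fun n => dpoly_eval id (Q n) (fun=> a n))); last first.
  by apply/uF_P; apply: aeS ha => n [].
rewrite /dpoly_eval /monalg.mmap.
have monE (m : {cmonom (unit * nat)%type}) : \prod_(ij <- finsupp m) iter ij.2 der (uF a) ^+ m ij =
    uF (fun n => \prod_(ij <- finsupp m) iter ij.2 der (a n) ^+ m ij).
  transitivity (\prod_(ij <- finsupp m) uF (fun n => iter ij.2 der (a n) ^+ m ij)).
    by apply: eq_bigr => ij _; rewrite iter_uF_der; exact: ufX.
  exact: uf_prod.
transitivity (\sum_(m <- D) (uF (fun n => c m n * \prod_(ij <- finsupp m) iter ij.2 der (a n) ^+ m ij) : fsort U)).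
  by apply: eq_bigr => m _; rewrite monE cE uFM.
apply: etrans; first exact: uf_sum.
apply/ufP/aeT => n.
rewrite -[RHS]/(monalg.mmap (idfun : {additive K n -> K n}) _ (Q n)).
rewrite (monalg.mmapEw (d := D)).
  by rewrite !big_seq; apply: eq_bigr => m mD; rewrite QE mD.
by apply/fsubsetP => m; rewrite -monalg.mcoeff_neq0 QE; case: ifP => //; rewrite eqxx.
Qed.

Theorem ultra_model : is_model U.
Proof.
split.
- exact: ultra_ordered_group.
- exact: ultra_valuation.
- exact: ultra_monotone.
- exact: ultra_residue.
- exact: ultra_dhenselian.
- exact: ultra_cmap.
- exact: ultra_ac.
Qed.

(** Membership in a ball is a condition on representatives, so [ae_saturation] applies to countably
    many balls. *)
Lemma ultra_complete (c r : nat -> fsort U) :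
  (forall s, exists x, forall i, (i <= s)%N -> dle (x - c i) (r i)) ->
  exists x, forall i, dle (x - c i) (r i).
Proof.
have bE i x : dle (uF x - c i) (r i) <-> ae (fun n => dle (x n - urep (c i) n) (urep (r i) n)).
  by rewrite -{1}(urepK (c i)) -{1}(urepK (r i)) (uFN (urep (c i))) uFD; apply: uF_dle.
move=> h; have [||w hw] := @ae_saturation (fun n => K n)
    (fun i n w => dle (w - urep (c i) n) (urep (r i) n)) .
- by move=> n; exists; exact: 0.
- move=> s; have [x] := h s; elim/uF_ind: x => x hx.
  have : ae (fun n => forall i, i \in iota 0 s.+1 -> dle (x n - urep (c i) n) (urep (r i) n)).
    by apply: ae_all_seq => i; rewrite mem_iota ltnS => /hx/bE.
  by apply: aeS => n hn; exists (x n) => i si; apply: hn; rewrite mem_iota ltnS.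
by exists (uF w) => i; apply/bE.
Qed.

Lemma uF_feval l (x : 'I_l -> forall n, K n) (t : fterm l) :
  feval (fun i => uF (x i)) t = uF (fun n => feval (fun i => x i n) t).
Proof.
elim: t => //= [t -> |t -> u -> |t -> u -> |t ->].
- exact: uFN.
- exact: uFD.
- exact: uFM.
exact: uF_der.
Qed.
End UltraModel.

(** * Formulas of the residue field and value group *)

Section CountableClosure.
Variables (T : Type) (x0 : T) (O : countType) (ops : O -> seq T -> T).

Fixpoint tree_eval (t : GenTree.tree nat) : T :=
  if t is GenTree.Node k ts then
    if choice.unpickle k is Some o then ops o (map tree_eval ts) else x0
  else x0.

(** The closure consists of the values of syntax trees over a countable type of operations, and such
    trees are countable. The list argument allows operations of every arity. *)
Lemma countable_closure : exists f : nat -> T, forall o s,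
  (forall i, (i < size s)%N -> exists n, f n = nth x0 s i) -> exists n, f n = ops o s.
Proof.
exists (fun n => tree_eval (odflt (GenTree.Leaf 0%N) (choice.unpickle n))) => o s h.
have [ts ets] : exists ts, s = map tree_eval ts.
  elim: s h => [|x s IH] h; first by exists [::].
  have [ts ->] := IH (fun i => h i.+1).
  have [n /= <-] := h 0%N isT.
  by exists (odflt (GenTree.Leaf 0%N) (choice.unpickle n) :: ts).
by exists (choice.pickle (GenTree.Node (choice.pickle o) ts)); rewrite choice.pickleK /= choice.pickleK ets.
Qed.
End CountableClosure.

Lemma countable_enum (T : countType) (x0 : T) : exists f : nat -> T, forall x, exists n, f n = x.
Proof. by exists (fun n => odflt x0 (choice.unpickle n)) => x; exists (choice.pickle x); rewrite choice.pickleK. Qed.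

(* Formulas of L_rv in de Bruijn style, evaluated in infinite environments.  Atoms
   are flat: in [AtR t i j l] the tag [t] selects one of the relations of [rsat]
   between the r-variables i, j, l; [AtC i j] says that i is the image of j under c. *)
Inductive rvf : Type :=
  | AtR of nat & nat & nat & nat
  | AtV of nat & nat & nat & nat
  | AtC of nat & nat
  | RNeg of rvf
  | RAnd of rvf & rvf
  | RExR of rvf
  | RExV of rvf.

Fixpoint rvf_code (p : rvf) : GenTree.tree (nat * nat * nat * nat) :=
  match p with
  | AtR t i j l => GenTree.Node 0 [:: GenTree.Leaf (t, i, j, l)]
  | AtV t i j l => GenTree.Node 1 [:: GenTree.Leaf (t, i, j, l)]
  | AtC i j => GenTree.Node 2 [:: GenTree.Leaf (0%N, 0%N, i, j)]
  | RNeg p => GenTree.Node 3 [:: rvf_code p]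
  | RAnd p q => GenTree.Node 4 [:: rvf_code p; rvf_code q]
  | RExR p => GenTree.Node 5 [:: rvf_code p]
  | RExV p => GenTree.Node 6 [:: rvf_code p]
  end.

Fixpoint rvf_decode (t : GenTree.tree (nat * nat * nat * nat)) : rvf :=
  match t with
  | GenTree.Node 0 [:: GenTree.Leaf (t, i, j, l)] => AtR t i j l
  | GenTree.Node 1 [:: GenTree.Leaf (t, i, j, l)] => AtV t i j l
  | GenTree.Node 2 [:: GenTree.Leaf (_, _, i, j)] => AtC i j
  | GenTree.Node 3 [:: p] => RNeg (rvf_decode p)
  | GenTree.Node 4 [:: p; q] => RAnd (rvf_decode p) (rvf_decode q)
  | GenTree.Node 5 [:: p] => RExR (rvf_decode p)
  | GenTree.Node 6 [:: p] => RExV (rvf_decode p)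
  | _ => AtC 0 0
  end.

Lemma rvf_codeK : cancel rvf_code rvf_decode.
Proof. by elim=> //= [p ->|p -> q ->|p ->|p ->]. Qed.

HB.instance Definition _ := Countable.copy rvf (can_type rvf_codeK).

Definition econs (A : Type) (a : A) (e : nat -> A) (i : nat) : A := if i is j.+1 then e j else a.

Definition rsat (k : diffField) (t : nat) (a b c : option k) : Prop :=
  match t with
  | 0 => a = b
  | 1 => a = Some 0
  | 2 => a = Some 1
  | 3 => a = omap -%R b
  | 4 => a = oadd b c
  | 5 => a = omul b c
  | _ => a = omap der b
  end.

Definition vsat (G : porderZmodType) (t : nat) (a b c : option G) : Prop :=
  match t with
  | 0 => a = b
  | 1 => a = Some 0
  | 2 => a = omap -%R b
  | 3 => a = oadd b c
  | _ => ole a b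
  end.

Fixpoint rholds (M : structure) (p : rvf) (eR : nat -> option (rsort M))
    (eV : nat -> option (vsort M)) : Prop :=
  match p with
  | AtR t i j l => rsat t (eR i) (eR j) (eR l)
  | AtV t i j l => vsat t (eV i) (eV j) (eV l)
  | AtC i j => eR i = omap cmap (eV j)
  | RNeg p => ~ rholds p eR eV
  | RAnd p q => rholds p eR eV /\ rholds q eR eV
  | RExR p => exists a, rholds p (econs a eR) eV
  | RExV p => exists a, rholds p eR (econs a eV)
  end.

Lemma rholdsAnd (M : structure) p q (eR : nat -> option (rsort M)) eV :
  rholds (RAnd p q) eR eV = (rholds p eR eV /\ rholds q eR eV).
Proof. by []. Qed.
Lemma rholdsExR (M : structure) p (eR : nat -> option (rsort M)) eV :
  rholds (RExR p) eR eV = exists a, rholds p (econs a eR) eV.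
Proof. by []. Qed.
Lemma rholdsExV (M : structure) p (eR : nat -> option (rsort M)) eV :
  rholds (RExV p) eR eV = exists a, rholds p eR (econs a eV).
Proof. by []. Qed.

Definition up (f : nat -> nat) (i : nat) : nat := if i is j.+1 then (f j).+1 else 0.

Fixpoint ren (f g : nat -> nat) (p : rvf) : rvf :=
  match p with
  | AtR t i j l => AtR t (f i) (f j) (f l)
  | AtV t i j l => AtV t (g i) (g j) (g l)
  | AtC i j => AtC (f i) (g j)
  | RNeg p => RNeg (ren f g p)
  | RAnd p q => RAnd (ren f g p) (ren f g q)
  | RExR p => RExR (ren (up f) g p)
  | RExV p => RExV (ren f (up g) p)
  end.

Lemma econs_up (A : Type) (a : A) e f : econs a e \o up f = econs a (e \o f).
Proof. by apply/funext => -[]. Qed.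

Lemma rholds_ren (M : structure) p f g (eR : nat -> option (rsort M)) eV :
  rholds (ren f g p) eR eV <-> rholds p (eR \o f) (eV \o g).
Proof.
elim: p f g eR eV => //= [p IH|p IHp q IHq|p IH|p IH] f g eR eV.
- by rewrite IH.
- by rewrite IHp IHq.
- have e a : rholds (ren (up f) g p) (econs a eR) eV <-> rholds p (econs a (eR \o f)) (eV \o g).
    by rewrite IH econs_up.
  by split=> -[a] /e; exists a.
- have e a : rholds (ren f (up g) p) eR (econs a eV) <-> rholds p (eR \o f) (econs a (eV \o g)).
    by rewrite IH econs_up.
  by split=> -[a] /e; exists a.
Qed.

(** A formula mentions finitely many indices. The bound depends on the formula alone and is uniform
    in the structure, which allows infinite environments to be cut down to finite tuples. *)
Lemma rholds_bound p : exists B, forall (M : structure) (eR eR' : nat -> option (rsort M)) eV eV',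
  (forall i, (i < B)%N -> eR i = eR' i) -> (forall i, (i < B)%N -> eV i = eV' i) ->
  rholds p eR eV <-> rholds p eR' eV'.
Proof.
elim: p => [t i j l|t i j l|i j|p [B IH]|p [B IH] q [C IH']|p [B IH]|p [B IH]].
- exists (i + j + l).+1 => M eR eR' eV eV' h _ /=.
  by rewrite !h // ltnS ?leq_addl // -?addnA ?leq_addr // addnCA leq_addr.
- exists (i + j + l).+1 => M eR eR' eV eV' _ h /=.
  by rewrite !h // ltnS ?leq_addl // -?addnA ?leq_addr // addnCA leq_addr.
- by exists (i + j).+1 => M eR eR' eV eV' h h' /=; rewrite h ?h' // ltnS ?leq_addl ?leq_addr.
- by exists B => M eR eR' eV eV' h h' /=; rewrite (IH _ _ _ _ _ h h').
- exists (B + C)%N => M eR eR' eV eV' h h' /=.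
  have k1 := IH M eR eR' eV eV' (fun i b => h i (ltn_addr C b)) (fun i b => h' i (ltn_addr C b)).
  have k2 := IH' M eR eR' eV eV' (fun i b => h i (ltn_addl B b)) (fun i b => h' i (ltn_addl B b)).
  by rewrite k1 k2.
- exists B => M eR eR' eV eV' h h' /=.
  have e a : rholds p (econs a eR) eV <-> rholds p (econs a eR') eV'.
    by apply: IH => // -[|i] //= ib; apply: h; apply: ltnW.
  by split=> -[a] /e; exists a.
- exists B => M eR eR' eV eV' h h' /=.
  have e a : rholds p eR (econs a eV) <-> rholds p eR' (econs a eV').
    by apply: IH => // -[|i] //= ib; apply: h'; apply: ltnW.
  by split=> -[a] /e; exists a.
Qed.

Definition RTop := RExR (AtR 1 0 0 0).
Definition RBot := RNeg RTop.
Definition ROr p q := RNeg (RAnd (RNeg p) (RNeg q)).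

Section Connectives.
Variables (M : structure) (eR : nat -> option (rsort M)) (eV : nat -> option (vsort M)).
Lemma rholds_top : rholds RTop eR eV. Proof. by exists (Some 0). Qed.
Lemma rholds_or p q : rholds (ROr p q) eR eV <-> rholds p eR eV \/ rholds q eR eV.
Proof.
split=> [n|[h|h] [hp hq]] //; have [h|h] := pselect (rholds p eR eV); first by left.
by right; apply: contrapT => k; apply: n.
Qed.
Lemma rholds_bigand (I : eqType) (s : seq I) (F : I -> rvf) :
  rholds (foldr (fun i => RAnd (F i)) RTop s) eR eV <-> (forall i, i \in s -> rholds (F i) eR eV).
Proof.
elim: s => [|i s IH]; first by split=> // _; exact: rholds_top.
split=> [[hi /IH hs] j|h].
  by rewrite inE => /orP[/eqP ->|/hs].
split; first by apply: h; exact: mem_head.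
by apply/IH => j js; apply: h; rewrite inE js orbT.
Qed.
End Connectives.

(** Interleaving keeps infinitely many parameters and infinitely many new elements in one
    environment. *)
Definition merge (A : Type) (p a : nat -> A) (i : nat) : A := if odd i then a i./2 else p i./2.

(** Existence of an infinite sequence is expressible because only finitely many of its entries
    matter; these are quantified one at a time, by induction on their number [b]. *)
Lemma ex_blockR p : exists q, forall (M : structure) eR (eV : nat -> option (vsort M)),
  rholds q eR eV <-> exists a : nat -> option (rsort M), rholds p (merge eR a) eV.
Proof.
have [B hB] := rholds_bound p.
suff H : forall b p, (forall (M : structure) (eR eR' : nat -> option (rsort M)) eV,
    (forall i, ~~ odd i || (i./2 < b)%N -> eR i = eR' i) -> rholds p eR eV -> rholds p eR' eV) ->
  exists q, forall (M : structure) eR (eV : nat -> option (vsort M)),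
  rholds q eR eV <-> exists a : nat -> option (rsort M), rholds p (merge eR a) eV.
  apply: (H B p) => M eR eR' eV h; apply: (proj1 (hB M eR eR' eV eV _ _)) => // i iB.
  by apply: h; rewrite (leq_ltn_trans _ iB) ?orbT // -{2}(odd_double_half i) -addnn addnA leq_addl.
elim=> [|b IH] {B hB}p dep.
  exists (ren half id p) => M eR eV; rewrite rholds_ren; split=> [h|[a]].
    by exists eR; apply: dep h => i _; rewrite /merge /=; case: (odd i).
  by apply: dep => i; rewrite orbF /merge /= => /negbTE ->.
(* Entry [b] of the sequence sits at index [2 b + 1]; it becomes the bound variable 0, and every
   other index moves up by one. *)
pose f i := if i == b.*2.+1 then 0%N else i.+1.
pose rp (A : Type) (e : nat -> A) a i := if i == b.*2.+1 then a else e i.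
have fE (A : Type) (e : nat -> A) a : econs a e \o f = rp A e a.
  by apply/funext => i; rewrite /f /rp /=; case: eqP.
have [|q hq] := IH (RExR (ren f id p)).
  move=> M eR eR' eV h [a] /rholds_ren; rewrite fE => k; exists a; apply/rholds_ren; rewrite fE.
  apply: dep k => i; rewrite /rp; case: eqP => // ne; rewrite ltnS leq_eqVlt => ib.
  apply: h; case: (boolP (odd i)) ib => //= oi /orP[/eqP e|-> //].
  by case: ne; rewrite -(odd_double_half i) oi e.
exists q => M eR eV; rewrite hq; split=> [[a]|[a h]].
  rewrite rholdsExR => -[c].
  rewrite rholds_ren fE => h; exists (fun i => if i == b then c else a i).
  congr (rholds p _ _): h; apply/funext => i; rewrite /rp /merge; case: eqP => [->|ne].
    by rewrite /= odd_double uphalf_double eqxx.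
  case: ifP => // oi; case: eqP => // e; case: ne; by rewrite -(odd_double_half i) oi e.
exists a; rewrite rholdsExR; exists (a b); rewrite rholds_ren fE.
congr (rholds p _ _): h; apply/funext => i; rewrite /rp /merge; case: eqP => [->|ne] //.
by rewrite /= odd_double uphalf_double.
Qed.

Lemma ex_blockV p : exists q, forall (M : structure) (eR : nat -> option (rsort M)) eV,
  rholds q eR eV <-> exists a : nat -> option (vsort M), rholds p eR (merge eV a).
Proof.
have [B hB] := rholds_bound p.
suff H : forall b p, (forall (M : structure) (eR : nat -> option (rsort M)) eV eV',
    (forall i, ~~ odd i || (i./2 < b)%N -> eV i = eV' i) -> rholds p eR eV -> rholds p eR eV') ->
  exists q, forall (M : structure) (eR : nat -> option (rsort M)) eV,
  rholds q eR eV <-> exists a : nat -> option (vsort M), rholds p eR (merge eV a).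
  apply: (H B p) => M eR eV eV' h; apply: (proj1 (hB M eR eR eV eV' _ _)) => // i iB.
  by apply: h; rewrite (leq_ltn_trans _ iB) ?orbT // -{2}(odd_double_half i) -addnn addnA leq_addl.
elim=> [|b IH] {B hB}p dep.
  exists (ren id half p) => M eR eV; rewrite rholds_ren; split=> [h|[a]].
    by exists eV; apply: dep h => i _; rewrite /merge /=; case: (odd i).
  by apply: dep => i; rewrite orbF /merge /= => /negbTE ->.
pose f i := if i == b.*2.+1 then 0%N else i.+1.
pose rp (A : Type) (e : nat -> A) a i := if i == b.*2.+1 then a else e i.
have fE (A : Type) (e : nat -> A) a : econs a e \o f = rp A e a.
  by apply/funext => i; rewrite /f /rp /=; case: eqP.
have [|q hq] := IH (RExV (ren id f p)).
  move=> M eR eV eV' h [a] /rholds_ren; rewrite fE => k; exists a; apply/rholds_ren; rewrite fE.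
  apply: dep k => i; rewrite /rp; case: eqP => // ne; rewrite ltnS leq_eqVlt => ib.
  apply: h; case: (boolP (odd i)) ib => //= oi /orP[/eqP e|-> //].
  by case: ne; rewrite -(odd_double_half i) oi e.
exists q => M eR eV; rewrite hq; split=> [[a]|[a h]].
  rewrite rholdsExV => -[c].
  rewrite rholds_ren fE => h; exists (fun i => if i == b then c else a i).
  congr (rholds p _ _): h; apply/funext => i; rewrite /rp /merge; case: eqP => [->|ne].
    by rewrite /= odd_double uphalf_double eqxx.
  case: ifP => // oi; case: eqP => // e; case: ne; by rewrite -(odd_double_half i) oi e.
exists a; rewrite rholdsExV; exists (a b); rewrite rholds_ren fE.
congr (rholds p _ _): h; apply/funext => i; rewrite /rp /merge; case: eqP => [->|ne] //.
by rewrite /= odd_double uphalf_double.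
Qed.

(** * Transfer and saturation for formulas of L_rv *)

Section Los.
Variable S : nat -> structure.
Notation U := (ustr S).
Definition uenvR (e : forall n, nat -> option (rsort (S n))) : nat -> option (rsort U) :=
  fun i => uRo (fun n => e n i).
Definition uenvV (e : forall n, nat -> option (vsort (S n))) : nat -> option (vsort U) :=
  fun i => uGo (fun n => e n i).

(** The theorem of Los. Negation uses that the filter is an ultrafilter, the quantifiers use a
    choice of witnesses. *)
Lemma los p (eR : forall n, nat -> option (rsort (S n))) (eV : forall n, nat -> option (vsort (S n))) :
  rholds p (uenvR eR) (uenvV eV) <-> ae (fun n => rholds p (eR n) (eV n)).
Proof.
elim: p eR eV => [t i j l|t i j l|i j|p IH|p IHp q IHq|p IH|p IH] eR eV.
- rewrite /= /uenvR; case: t => [|[|[|[|[|[|t]]]]]] /=.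
  + exact: uRo_P.
  + by rewrite -[Some 0]/(Some (uR (fun n => 0))) uRoE; apply: uRo_P.
  + by rewrite -[Some 1]/(Some (uR (fun n => 1))) uRoE; apply: uRo_P.
  + by rewrite uRo_opp; apply: uRo_P.
  + by rewrite uRo_add; apply: uRo_P.
  + by rewrite uRo_mul; apply: uRo_P.
  + by rewrite uRo_der; apply: uRo_P.
- rewrite /= /uenvV; case: t => [|[|[|[|t]]]] /=.
  + exact: uGo_P.
  + by rewrite uGo0; apply: uGo_P.
  + by rewrite uGo_opp; apply: uGo_P.
  + by rewrite uGo_add; apply: uGo_P.
  + exact: uGo_le.
- by rewrite /= /uenvR /uenvV uGo_cmap; apply: uRo_P.
- by rewrite /= IH aeN.
- rewrite /= IHp IHq; split=> [[hp hq]|h]; first exact: aeI.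
  by split; apply: aeS h => n [].
- have E a : econs (uRo a) (uenvR eR) = uenvR (fun n => econs (a n) (eR n)).
    by apply/funext => -[].
  rewrite rholdsExR; split=> [[a]|h].
    by elim/uRo_ind: a => a; rewrite E IH; apply: aeS => n h; exists (a n).
  have [a ha] := @ae_choice (fun n => option (rsort (S n))) _ (fun n => inhabits None) h.
  by exists (uRo a); rewrite E IH.
- have E a : econs (uGo a) (uenvV eV) = uenvV (fun n => econs (a n) (eV n)).
    by apply/funext => -[].
  rewrite rholdsExV; split=> [[a]|h].
    by elim/uGo_ind: a => a; rewrite E IH; apply: aeS => n h; exists (a n).
  have [a ha] := @ae_choice (fun n => option (vsort (S n))) _ (fun n => inhabits None) h.
  by exists (uGo a); rewrite E IH.
Qed.

Lemma uenvR_ex (e : nat -> option (rsort U)) : exists f, e = uenvR f.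
Proof.
have h i : exists f, e i = uRo f by elim/uRo_ind: (e i) => f; exists f.
by have [f hf] := choice h; exists (fun n i => f i n); apply/funext => i; rewrite hf.
Qed.
Lemma uenvV_ex (e : nat -> option (vsort U)) : exists f, e = uenvV f.
Proof.
have h i : exists f, e i = uGo f by elim/uGo_ind: (e i) => f; exists f.
by have [f hf] := choice h; exists (fun n i => f i n); apply/funext => i; rewrite hf.
Qed.

(** Finitely many conditions on the new elements become one formula in the parameters by [ex_blockR]
    and [ex_blockV]. By hypothesis it holds in the ultraproduct, and saturation realizes all
    conditions together. Negations turn the implication into an equivalence. *)
Lemma rv_saturation (M : structure) (pR aR : nat -> option (rsort M)) pV aV
    (pR' : nat -> option (rsort U)) pV' :
  (forall p, rholds p pR pV -> rholds p pR' pV') ->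
  exists aR' aV', forall p,
    rholds p (merge pR aR) (merge pV aV) <-> rholds p (merge pR' aR') (merge pV' aV').
Proof.
have [qR ->] := uenvR_ex pR'; have [qV ->] := uenvV_ex pV' => h.
have [e he] := countable_enum (AtC 0 0 : rvf).
have [||w hw] := @ae_saturation
  (fun n => (nat -> option (rsort (S n))) * (nat -> option (vsort (S n))))%type
  (fun i n w => rholds (e i) (merge pR aR) (merge pV aV) ->
      rholds (e i) (merge (qR n) w.1) (merge (qV n) w.2)).
- by move=> n; split; split=> _; exact: None.
- move=> s; pose sq := [seq p <- map e (iota 0 s.+1) | `[< rholds p (merge pR aR) (merge pV aV) >]].
  pose P := foldr (fun p => RAnd p) RTop sq.
  have PE (N : structure) (dR : nat -> option (rsort N)) dV :
      rholds P dR dV <-> forall p, p \in sq -> rholds p dR dV by exact: (rholds_bigand _ _ _ id).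
  have [Q hQ] := ex_blockR P; have [Q' hQ'] := ex_blockV Q.
  have : rholds Q' pR pV.
    apply/hQ'; exists aV; apply/hQ; exists aR; apply/PE => p.
    by rewrite mem_filter => /andP[/asboolP].
  move/h/los; apply: aeS => n /hQ' [wV] /hQ [wR] /PE k; exists (wR, wV) => i si hi.
  apply: k; rewrite mem_filter; apply/andP; split; first exact/asboolP.
  by apply: map_f; rewrite mem_iota.
have H p : rholds p (merge pR aR) (merge pV aV) ->
    rholds p (merge (uenvR qR) (uenvR (fun n => (w n).1))) (merge (uenvV qV) (uenvV (fun n => (w n).2))).
  have -> : merge (uenvR qR) (uenvR (fun n => (w n).1)) = uenvR (fun n => merge (qR n) (w n).1).
    by apply/funext => i; rewrite /merge /uenvR; case: (odd i).
  have -> : merge (uenvV qV) (uenvV (fun n => (w n).2)) = uenvV (fun n => merge (qV n) (w n).2).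
    by apply/funext => i; rewrite /merge /uenvV; case: (odd i).
  by have [i <-] := he p => hi; apply/los; apply: aeS (hw i) => n; apply.
exists (uenvR (fun n => (w n).1)), (uenvV (fun n => (w n).2)) => p; split; first exact: H.
by move=> hp; apply: contrapT => /(H (RNeg p)).
Qed.
End Los.

(** * Countable closed subfields *)

Section CountableSub.
Variable M : structure.
Hypothesis hM : is_model M.
Local Notation K := (fsort M).

Definition hens_zero n (P : mpoly n K) : K :=
  if pselect (exists y, dle y 1 /\ P.@[jet y] = 0) is left h then sval (cid h) else 0.

(** A henselian polynomial is coded by its number of variables and its list of exponents, with the
    coefficients as arguments, so that countably many operations suffice. [inl (4, n)] contributes
    the given element [g n]. *)
Definition field_op (g : nat -> K) (o : nat * nat + nat * seq (seq nat)) (s : seq K) : K :=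
  match o with
  | inl (0, _) => s`_0 - s`_1
  | inl (1, _) => s`_0 * s`_1
  | inl (2, _) => (s`_0)^-1
  | inl (3, _) => der s`_0
  | inl (4, n) => g n
  | inl _ => 1
  | inr (n, ms) => hens_zero (\sum_(i < size ms) s`_i *: 'X_[[multinom nth 0%N (nth [::] ms i) j | j < n]])
  end.

Lemma countable_closed_sub (g : nat -> K) :
  exists f : nat -> K, closed_sub (fun x => exists n, f n = x) /\ forall n, exists k, f k = g n.
Proof.
have [f hf] := countable_closure 0 (field_op g); exists f.
have op0 o : exists n, f n = field_op g o [::] by apply: hf.
have op1 o a : (exists n, f n = a) -> exists n, f n = field_op g o [:: a].
  by move=> h; apply: hf => -[|[|]].
have op2 o a b : (exists n, f n = a) -> (exists n, f n = b) -> exists n, f n = field_op g o [:: a; b].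
  by move=> ha hb; apply: hf => -[|[|]].
split; last by move=> n; exact: (op0 (inl (4, n)%N)).
split.
- split; first exact: (op0 (inl (5, 0)%N)).
  + by move=> a b; apply: (op2 (inl (0, 0)%N)).
  + by move=> a b; apply: (op2 (inl (1, 0)%N)).
- by move=> a; apply: (op1 (inl (2, 0)%N)).
- by move=> a; apply: (op1 (inl (3, 0)%N)).
move=> n P SP P1 P2 P3.
pose ms := [seq [seq (m : multinom n) i | i <- enum 'I_n] | m <- msupp P].
have [|k hk] := hf (inr (n, ms)) [seq P@_m | m <- msupp P].
  by move=> i; rewrite size_map => im; rewrite (nth_map 0%MM).
exists (f k); split; [by exists k|..]; rewrite hk /=; set Q := \sum_(i < _) _;
  have QP : Q = P.
- rewrite [RHS]mpolyE /Q size_map (big_nth 0%MM) big_mkord; apply: eq_bigr => i _.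
  rewrite !(nth_map 0%MM) //; congr (_ *: 'X_[_]); apply/mnmP => j.
  by rewrite mnmE (nth_map j) ?size_enum_ord // nth_ord_enum.
- rewrite QP /hens_zero; case: pselect => [h|n0]; first by case: (svalP (cid h)).
  exact: dle0.
- rewrite [RHS]mpolyE /Q size_map (big_nth 0%MM) big_mkord; apply: eq_bigr => i _.
  rewrite !(nth_map 0%MM) //; congr (_ *: 'X_[_]); apply/mnmP => j.
  by rewrite mnmE (nth_map j) ?size_enum_ord // nth_ord_enum.
rewrite QP /hens_zero; case: pselect => [h|[]]; first by case: (svalP (cid h)).
have [i hi] := P3.
by have [y y1 y0] := dhens_mpoly hM P1 P2 P3; exists y.
Qed.
End CountableSub.

(** * Partial isomorphisms of residue fields and value groups *)

Section Interpretation.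
Variables (M : structure) (S : nat -> structure).
Hypotheses (hM : is_model M) (hS : forall n, is_model (S n)).
Notation N := (ustr S).
Local Notation K := (fsort M).
Variables (pR : nat -> option (rsort M)) (pV : nat -> option (vsort M)).
Variables (pR' : nat -> option (rsort N)) (pV' : nat -> option (vsort N)).
Hypothesis same_type : forall p, rholds p pR pV -> rholds p pR' pV'.
Variable f : nat -> K.
Hypothesis hf : closed_sub (fun x => exists n, f n = x).

Definition group_op (o : nat * nat) (s : seq (vsort M)) : vsort M :=
  match o with
  | (0, _) => s`_0 + s`_1
  | (1, _) => - s`_0
  | (2, n) => odflt 0 (valuation (f n))
  | (_, n) => odflt 0 (pV n)
  end.

(** Besides the angular components and the parameters, the countable residue field has to contain
    the image under [cmap] of the countable group, enumerated by [e]. *)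
Definition res_op (e : nat -> vsort M) (o : nat * nat) (s : seq (rsort M)) : rsort M :=
  match o with
  | (0, _) => s`_0 - s`_1
  | (1, _) => s`_0 * s`_1
  | (2, _) => (s`_0)^-1
  | (3, _) => der s`_0
  | (4, n) => ac (f n)
  | (5, n) => cmap (e n)
  | (6, n) => odflt 0 (pR n)
  | _ => 1
  end.

(** The countable parts are enumerated and matched with sequences in [N] by one application of
    [rv_saturation]; the clauses of [rv_iso] on residues and values then follow from atomic
    formulas. Parameters equal to oo are matched as well. *)
Lemma rv_iso_ex : exists eR eV eR' eV',
  [/\ forall p, rholds p eR eV <-> rholds p eR' eV',
      forall i, exists j, eR j = pR i /\ eR' j = pR' i,
      forall i, exists j, eV j = pV i /\ eV' j = pV' i &
      @rv_iso M N (fun x => exists n, f n = x)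
        (fun u u' => exists i, eR i = Some u /\ eR' i = Some u')
        (fun g g' => exists i, eV i = Some g /\ eV' i = Some g')].
Proof.
have [e he] := countable_closure 0 group_op.
have [d hd] := countable_closure 0 (res_op e).
have e1 o a : (exists n, e n = a) -> exists n, e n = group_op o [:: a].
  by move=> h; apply: he => -[|[|]].
have e2 o a b : (exists n, e n = a) -> (exists n, e n = b) -> exists n, e n = group_op o [:: a; b].
  by move=> ha hb; apply: he => -[|[|]].
have d0 o : exists n, d n = res_op e o [::] by apply: hd.
have d1 o a : (exists n, d n = a) -> exists n, d n = res_op e o [:: a].
  by move=> h; apply: hd => -[|[|]].
have d2 o a b : (exists n, d n = a) -> (exists n, d n = b) -> exists n, d n = res_op e o [:: a; b].
  by move=> ha hb; apply: hd => -[|[|]].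
have [aR' [aV' T]] := rv_saturation (fun n => Some (d n)) (fun n => Some (e n)) same_type.
move: T; set eR := merge pR _; set eV := merge pV _; set eR' := merge _ _; set eV' := merge _ _ => T.
exists eR, eV, eR', eV'; split=> //.
- by move=> i; exists i.*2; rewrite /eR /eR' /merge odd_double doubleK.
- by move=> i; exists i.*2; rewrite /eV /eV' /merge odd_double doubleK.
have dR i u : eR i = Some u -> exists n, d n = u.
  rewrite /eR /merge; case: ifP => _; first by case=> <-; exists i./2.
  by move=> E; have [n] := d0 (6, i./2)%N; rewrite /= E /= => <-; exists n.
have dV i g : eV i = Some g -> exists n, e n = g.
  rewrite /eV /merge; case: ifP => _; first by case=> <-; exists i./2.
  have [n] := he (3, i./2)%N [::] (fun _ => ltac:(done)).
  by move=> + E; rewrite /= E /= => <-; exists n.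
have iR u : (exists n, d n = u) -> exists i, eR i = Some u.
  by case=> n <-; exists n.*2.+1; rewrite /eR /merge /= odd_double uphalf_double.
have iV g : (exists n, e n = g) -> exists i, eV i = Some g.
  by case=> n <-; exists n.*2.+1; rewrite /eV /merge /= odd_double uphalf_double.
have TR t i j l : rsat t (eR i) (eR j) (eR l) -> rsat t (eR' i) (eR' j) (eR' l).
  by move/(T (AtR t i j l)).
have TV t i j l : vsat t (eV i) (eV j) (eV l) -> vsat t (eV' i) (eV' j) (eV' l).
  by move/(T (AtV t i j l)).
(* The partner of [u] might be oo; the atomic formula expressing [u + (- u) = 0] excludes this. *)
have pk u : (exists n, d n = u) -> exists i u', eR i = Some u /\ eR' i = Some u'.
  move=> hu; have [i hi] := iR _ hu.
  have hz0 := d2 (0, 0)%N _ _ hu hu; have [z hz] := iR _ hz0.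
  have [j hj] := iR _ (d2 (0, 0)%N _ _ hz0 hu); rewrite /= in hz hj; rewrite subrr in hz hj.
  have := TR 1%N z z z; rewrite /= hz => /(_ erefl) z0.
  have := TR 4%N z i j; rewrite /= /oadd hi hj hz sub0r subrr z0 => /(_ erefl).
  by case E: (eR' i) => [u'|] //; exists i, u'.
have pV2 g : (exists n, e n = g) -> exists i g', eV i = Some g /\ eV' i = Some g'.
  move=> hg; have [i hi] := iV _ hg; have [j hj] := iV _ (e1 (1, 0)%N _ hg).
  have [z hz] := iV _ (e2 (0, 0)%N _ _ hg (e1 (1, 0)%N _ hg)).
  rewrite /= in hj hz; rewrite subrr in hz.
  have := TV 1%N z z z; rewrite /= hz => /(_ erefl) z0.
  have := TV 3%N z i j; rewrite /= /oadd hi hj hz subrr z0 => /(_ erefl).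
  by case E: (eV' i) => [g'|] //; exists i, g'.
have mR u u' i : eR i = Some u -> eR' i = Some u' -> exists i, eR i = Some u /\ eR' i = Some u'.
  by exists i.
split=> //.
- move=> u u' w w' [i [ui ui']] [j [wj wj']].
  have := T (AtR 0 i j 0); rewrite /= ui ui' wj wj' => -[h1 h2].
  by split=> E; apply: Some_inj; [apply: h1|apply: h2]; rewrite E.
- have z0 : exists i, eR i = Some 0 /\ eR' i = Some 0.
    have [o ho] := d0 (7, 0)%N.
    have [|z hz] := iR 0; first by have := d2 (0,0)%N (d o) (d o) (ex_intro _ o erefl) (ex_intro _ o erefl); rewrite /= subrr.
    by exists z; split=> //; have := TR 1%N z z z; apply.
  split.
  + have [i hi] := iR _ (d0 (7, 0)%N); exists i; split=> //.
    by have := TR 2%N i i i; apply.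
  + move=> [u u'] [w w'] /= [i [ui ui']] [j [wj wj']].
    have [h hh] := iR _ (d2 (0, 0)%N _ _ (dR _ _ ui) (dR _ _ wj)).
    have := TR 4%N i h j; rewrite /= /oadd ui ui' hh wj wj' /= subrK => /(_ erefl).
    by case E: (eR' h) => [c|] //= [ec]; exists h; rewrite hh E ec addrK.
  move=> [u u'] [w w'] /= [i [ui ui']] [j [wj wj']].
  have [h hh] := iR _ (d2 (1, 0)%N _ _ (dR _ _ ui) (dR _ _ wj)).
  have := TR 5%N h i j; rewrite /= /omul ui ui' hh wj wj' => /(_ erefl) E.
  by exists h.
- move=> u u' [i [ui ui']].
  have [u0|u0] := eqVneq u 0.
    have : u' = 0; last by move=> ->; rewrite u0 !invr0; exists i; rewrite ui ui' u0; split=> //; have := TR 1%N i i i; rewrite /= ui u0 ui' => /(_ erefl).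
    by have := TR 1%N i i i; rewrite /= ui u0 ui' => /(_ erefl) [].
  have [h hh] := iR _ (d1 (2, 0)%N _ (dR _ _ ui)).
  have [o ho] := iR _ (d0 (7, 0)%N).
  have := TR 2%N o o o; rewrite /= ho => /(_ erefl) o1.
  have := TR 5%N o i h; rewrite /= /omul ui ui' hh ho o1 /= divff // => /(_ erefl).
  case E: (eR' h) => [c|] // /Some_inj ec; exists h; rewrite hh E; split=> //; congr Some.
  have u'0 : u' != 0 by apply/eqP => e0; move/eqP: ec; rewrite e0 mul0r oner_eq0.
  by apply: (mulfI u'0); rewrite -ec divff.
- move=> u u' [i [ui ui']]; have [h hh] := iR _ (d1 (3, 0)%N _ (dR _ _ ui)).
  by exists h; split=> //; have := TR 6%N h i i; rewrite /= ui ui' hh; apply.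
- move=> g g' h h' [i [gi gi']] [j [hj hj']].
  have := T (AtV 4 i j 0); rewrite /= gi gi' hj hj' => E.
  by apply/idP/idP => /E.
- move=> g g' h h' [i [gi gi']] [j [hj hj']].
  have [k hk] := iV _ (e2 (0, 0)%N _ _ (dV _ _ gi) (dV _ _ hj)).
  by exists k; split=> //; have := TV 3%N k i j; rewrite /= gi gi' hj hj' hk; apply.
- move=> g g' [i [gi gi']]; have [k hk] := iV _ (e1 (1, 0)%N _ (dV _ _ gi)).
  by exists k; split=> //; have := TV 2%N k i i; rewrite /= gi gi' hk; apply.
- move=> g g' [i [gi gi']]; have [n en] := dV _ _ gi.
  have [h hh] := iR _ (d0 (5, n)%N); rewrite /= en in hh.
  exists h; split=> //; have := proj1 (T (AtC h i)); rewrite /= gi gi' hh; exact.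
- move=> x [n <-]; have [i [u' [hi hi']]] := pk _ (d0 (4, n)%N).
  by exists u', i.
move=> x g [n <-] vg; have [k hk] := he (2, n)%N [::] (fun _ => ltac:(done)).
rewrite /= vg /= in hk; have [i [g' [hi hi']]] := pV2 g (ex_intro _ k hk).
by exists g', i.
Qed.
End Interpretation.

(** * Elimination of field quantifiers *)

Section FTermCode.
Variable l : nat.

Fixpoint fterm_code (t : fterm l) : GenTree.tree 'I_l :=
  match t with
  | FVar i => GenTree.Leaf i
  | FZero => GenTree.Node 0 [::]
  | FOne => GenTree.Node 1 [::]
  | FOpp t => GenTree.Node 2 [:: fterm_code t]
  | FAdd t u => GenTree.Node 3 [:: fterm_code t; fterm_code u]
  | FMul t u => GenTree.Node 4 [:: fterm_code t; fterm_code u]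
  | FDer t => GenTree.Node 5 [:: fterm_code t]
  end.

Fixpoint fterm_decode (t : GenTree.tree 'I_l) : fterm l :=
  match t with
  | GenTree.Leaf i => FVar i
  | GenTree.Node 1 [::] => FOne
  | GenTree.Node 2 [:: t] => FOpp (fterm_decode t)
  | GenTree.Node 3 [:: t; u] => FAdd (fterm_decode t) (fterm_decode u)
  | GenTree.Node 4 [:: t; u] => FMul (fterm_decode t) (fterm_decode u)
  | GenTree.Node 5 [:: t] => FDer (fterm_decode t)
  | _ => FZero
  end.

Lemma fterm_codeK : cancel fterm_code fterm_decode.
Proof. by elim=> //= [t ->|t -> u ->|t -> u ->|t ->]. Qed.

HB.instance Definition _ := Countable.copy (fterm l) (can_type fterm_codeK).
End FTermCode.

Definition fterm_seq l : nat -> fterm l := sval (cid (countable_enum (FZero : fterm l))).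
Lemma fterm_seq_surj l t : exists k, fterm_seq l k = t.
Proof. exact: (svalP (cid (countable_enum (FZero : fterm l)))). Qed.

Section Environments.
Variables (M : structure) (l m n : nat) (x : 'I_l -> fsort M).
Variables (y : 'I_m -> option (rsort M)) (z : 'I_n -> option (vsort M)).

(* The variables y and z get the even indices, the special terms in x the odd ones. *)
Definition envR (i : nat) : option (rsort M) :=
  if odd i then Some (ac (feval x (fterm_seq l i./2)))
  else if insub i./2 is Some j then y j else None.

Definition envV (i : nat) : option (vsort M) :=
  if odd i then valuation (feval x (fterm_seq l i./2))
  else if insub i./2 is Some j then z j else None.

Lemma envR_odd k : envR k.*2.+1 = Some (ac (feval x (fterm_seq l k))).
Proof. by rewrite /envR /= odd_double uphalf_double. Qed.
Lemma envV_odd k : envV k.*2.+1 = valuation (feval x (fterm_seq l k)).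
Proof. by rewrite /envV /= odd_double uphalf_double. Qed.
Lemma envR_even (j : 'I_m) : envR j.*2 = y j.
Proof. by rewrite /envR odd_double doubleK valK. Qed.
Lemma envV_even (j : 'I_n) : envV j.*2 = z j.
Proof. by rewrite /envV odd_double doubleK valK. Qed.
Lemma env_cases i : (exists k, i = k.*2.+1) \/ (exists k, i = k.*2).
Proof.
rewrite -(odd_double_half i); case: (odd i); first by left; exists i./2.
by right; exists i./2.
Qed.
End Environments.

(** A new variable moves the old variables by two places, since they occupy the even indices, and
    fixes the terms at the odd ones, whereas [econs] moves every index by one. *)
Definition shift_env (i : nat) : nat := if odd i then i.+1 else i.-1.

Lemma scons_insub (A : Type) (n : nat) (a : option A) (y : 'I_n -> option A) k :
  (if insub k is Some j then scons a y j else None) =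
  (if k is k'.+1 then if insub k' is Some j then y j else None else a).
Proof.
case: k => [|k].
  case: insubP => [j _ j0|//]; rewrite /scons (_ : j = ord0) ?unlift_none //.
  exact: val_inj.
case: insubP => [j jn jk|/negP nk]; last first.
  by case: insubP => // j; rewrite -ltnS => /nk.
have kn : (k < n)%N by [].
rewrite insubT /scons (_ : j = lift ord0 (Ordinal kn)) ?liftK //=.
exact: val_inj.
Qed.

Lemma envR_scons (M : structure) l m (x : 'I_l -> fsort M) (y : 'I_m -> option (rsort M)) a :
  envR x (scons a y) = econs a (envR x y) \o shift_env.
Proof.
apply/funext => i; rewrite /= /shift_env; have [[k ->]|[k ->]] := env_cases i.
  by rewrite envR_odd /= odd_double /= envR_odd.
rewrite odd_double {1}/envR odd_double doubleK scons_insub.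
by case: k => [|k] //=; rewrite /envR odd_double doubleK.
Qed.

Lemma envV_scons (M : structure) l m (x : 'I_l -> fsort M) (z : 'I_m -> option (vsort M)) a :
  envV x (scons a z) = econs a (envV x z) \o shift_env.
Proof.
apply/funext => i; rewrite /= /shift_env; have [[k ->]|[k ->]] := env_cases i.
  by rewrite envV_odd /= odd_double /= envV_odd.
rewrite odd_double {1}/envV odd_double doubleK scons_insub.
by case: k => [|k] //=; rewrite /envV odd_double doubleK.
Qed.

Record point (l m n : nat) := Point {
  pt : structure;
  pt_model : is_model pt;
  ptx : 'I_l -> fsort pt;
  pty : 'I_m -> option (rsort pt);
  ptz : 'I_n -> option (vsort pt)
}.

Definition pholds l m n (p : rvf) (d : point l m n) : Prop :=
  rholds p (envR (ptx d) (pty d)) (envV (ptx d) (ptz d)).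

Section FiniteTypes.
Variables l m n : nat.
Implicit Types d e : point l m n.

(** A class decided by the truth of finitely many formulas is a Boolean combination of them; the
    induction splits along the first formula. Points range over all models, which gives one formula
    for the whole theory. *)
Lemma separation (s : seq rvf) (Q : point l m n -> Prop) :
  (forall d e, (forall p, p \in s -> pholds p d <-> pholds p e) -> Q d -> Q e) ->
  exists q, forall d, Q d <-> pholds q d.
Proof.
elim: s Q => [|p s IH] Q h.
  have [[d Qd]|no] := pselect (exists d, Q d).
    exists RTop => e; split=> [_|_]; first exact: rholds_top.
    exact: h Qd.
  exists RBot => e; split=> [Qe|]; first by case: no; exists e.
  by move=> h0; case: (h0 (rholds_top _ (envV (ptx e) (ptz e)))).
have [d1 d2|q1 h1] := IH (fun d => exists e, [/\ Q e, pholds p e &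
    forall q, q \in s -> pholds q e <-> pholds q d]).
  by move=> ag [e [Qe pe es]]; exists e; split=> // q qs; rewrite es ?ag.
have [d1 d2|q0 h0] := IH (fun d => exists e, [/\ Q e, ~ pholds p e &
    forall q, q \in s -> pholds q e <-> pholds q d]).
  by move=> ag [e [Qe pe es]]; exists e; split=> // q qs; rewrite es ?ag.
exists (ROr (RAnd p q1) (RAnd (RNeg p) q0)) => d.
rewrite /pholds rholds_or /=; rewrite -/(pholds p d) -/(pholds q1 d) -/(pholds q0 d) -h1 -h0.
split=> [Qd|].
  by have [pd|npd] := pselect (pholds p d); [left|right]; split=> //; exists d.
case=> -[pd [e [Qe pe es]]]; apply: (h e d) Qe => q; rewrite inE => /orP[/eqP ->|/es //].
  by split.
by split=> // /pe.
Qed.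
End FiniteTypes.

Section UltraEnv.
Variable S : nat -> structure.
Variables l m n : nat.
Variables (x : forall i, 'I_l -> fsort (S i)) (y : forall i, 'I_m -> option (rsort (S i)))
  (z : forall i, 'I_n -> option (vsort (S i))).
Definition ultx : 'I_l -> fsort (ustr S) := fun j => uF (fun i => x i j).
Definition ulty : 'I_m -> option (rsort (ustr S)) := fun j => uRo (fun i => y i j).
Definition ultz : 'I_n -> option (vsort (ustr S)) := fun j => uGo (fun i => z i j).

Lemma ultra_envR : envR ultx ulty = uenvR (fun i => envR (x i) (y i)).
Proof.
apply/funext => k; rewrite /uenvR /envR; case: (odd k).
  by rewrite uF_feval uF_ac uRoE.
by case: insubP => [j _ _|_] //; rewrite uRoN.
Qed.
Lemma ultra_envV : envV ultx ultz = uenvV (fun i => envV (x i) (z i)).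
Proof.
apply/funext => k; rewrite /uenvV /envV; case: (odd k).
  by rewrite uF_feval uF_val.
by case: insubP => [j _ _|_] //; rewrite uGoN.
Qed.
Lemma ultra_los p : rholds p (envR ultx ulty) (envV ultx ultz) <->
  ae (fun i => rholds p (envR (x i) (y i)) (envV (x i) (z i))).
Proof. by rewrite ultra_envR ultra_envV los. Qed.
End UltraEnv.

Lemma ultx_scons (S : nat -> structure) l (a : forall i, fsort (S i)) (x : forall i, 'I_l -> fsort (S i)) :
  scons (uF a) (ultx x) = ultx (fun i => scons (a i) (x i)).
Proof. by apply/funext => j; rewrite /scons /ultx; case: unliftP => [i|] _ /=. Qed.

Lemma rholds_transfer (M N : structure) (eR dR : nat -> option (rsort M)) (eV dV : nat -> option (vsort M))
    (eR' dR' : nat -> option (rsort N)) (eV' dV' : nat -> option (vsort N)) :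
  (forall p, rholds p eR eV <-> rholds p eR' eV') ->
  (forall i, exists j, eR j = dR i /\ eR' j = dR' i) ->
  (forall i, exists j, eV j = dV i /\ eV' j = dV' i) ->
  forall p, rholds p dR dV <-> rholds p dR' dV'.
Proof.
move=> h /choice [f hf] /choice [g hg] p.
have -> : dR = eR \o f by apply/funext => i; have [] := hf i.
have -> : dR' = eR' \o f by apply/funext => i; have [] := hf i.
have -> : dV = eV \o g by apply/funext => i; have [] := hg i.
have -> : dV' = eV' \o g by apply/funext => i; have [] := hg i.
by split=> /rholds_ren /h /rholds_ren.
Qed.

Section ExtendPoint.
Variables (l m n : nat) (M : structure) (S : nat -> structure).
Notation N := (ustr S).
Hypotheses (hM : is_model M) (hS : forall i, is_model (S i)).
Variables (x : 'I_l -> fsort M) (y : 'I_m -> option (rsort M)) (z : 'I_n -> option (vsort M)).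
Variables (x' : 'I_l -> fsort N) (y' : 'I_m -> option (rsort N)) (z' : 'I_n -> option (vsort N)).
Hypothesis same_type : forall p, rholds p (envR x y) (envV x z) -> rholds p (envR x' y') (envV x' z').

(** The pairs of values of a term at [x] and [x'] are compatible, because [ac] and [v] of every term
    occur in the environments. The embedding theorem extends them to a field containing [a], and the
    image of [a] serves. *)
Lemma same_type_extend (a : fsort M) : exists a' : fsort N, forall p,
  rholds p (envR (scons a x) y) (envV (scons a x) z) ->
  rholds p (envR (scons a' x') y') (envV (scons a' x') z').
Proof.
have hN : is_model N := ultra_model hS.
have [f [hf fx]] := countable_closed_sub hM
  (fun i => if i is j.+1 then if insub j is Some k then x k else 0 else a).
have [eR [eV [eR' [eV' [T hR hV rv]]]]] := rv_iso_ex same_type hf.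
pose F0 b := exists t, b = (feval x t, feval x' t).
set S0 := fun b => exists k, f k = b in hf rv.
set Rk := fun u u' => exists i, eR i = Some u /\ eR' i = Some u' in rv.
set RG := fun g g' => exists i, eV i = Some g /\ eV' i = Some g' in rv.
have Sx t : S0 (feval x t).
  have hSr := closed_sub_ring hf.
  elim: t => /= [i| | |t h|t h u k|t h u k|t h].
  - by have [k] := fx i.+1; rewrite valK; exists k.
  - exact: (sub0 hSr).
  - exact: (sub1 hSr).
  - exact: (subN hSr).
  - exact: (subD hSr).
  - exact: (subM hSr).
  - exact: (closed_sub_der hf).
have g0 : good S0 Rk RG F0.
  split.
  - split; first by exists FOne.
      by move=> _ _ [t ->] [u ->]; exists (FAdd t (FOpp u)).
    by move=> _ _ [t ->] [u ->]; exists (FMul t u).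
  - by move=> _ [t ->]; exists (FDer t).
  move=> _ [t ->]; split; first exact: Sx.
  have [k kt] := fterm_seq_surj t.
  have [j [j1 j2]] := hR k.*2.+1; have [i [i1 i2]] := hV k.*2.+1.
  rewrite !envR_odd kt in j1 j2; rewrite !envV_odd kt in i1 i2.
  (* [ac] vanishes only at 0, so vanishing of a term is expressed by an atom on its angular
     component. *)
  have [t0|t0] := eqVneq (feval x t) 0.
    left; split=> //; apply/eqP; rewrite -(ac_eq0 hN).
    have := proj1 (T (AtR 1 j j j)); rewrite /= j1 j2 t0 (ac0 hM) => /(_ erefl) /Some_inj /eqP.
    exact.
  right; have [g gE] := val_some hM t0.
  have t0' : feval x' t != 0.
    apply/negP => /eqP e; have := proj2 (T (AtR 1 j j j)); rewrite /= j1 j2 e (ac0 hN).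
    by move=> /(_ erefl) /Some_inj /eqP; rewrite (ac_eq0 hM) (negbTE t0).
  have [g' gE'] := val_some hN t0'.
  exists g, g'; split=> //=; first by exists i; rewrite i1 i2 gE gE'.
  by exists j; rewrite j1 j2.
have S0_f : exists f : nat -> fsort M, forall x, S0 x -> exists k, f k = x by exists f.
have [F [[Fr Fd Fc] F0F FS]] := embedding hM hN rv S0_f (@ultra_complete S) g0.
have [a' Fa] : exists a', F (a, a') by apply: FS; have [k] := fx 0%N; exists k.
exists a' => p.
have Ft t : F (feval (scons a x) t, feval (scons a' x') t).
  elim: t => /= [i| | |t h|t h u k|t h u k|t h].
  - rewrite /scons; case: unliftP => [j|] _ //=.
    by apply: F0F; exists (FVar j).
  - exact: (sub0 Fr).
  - exact: (sub1 Fr).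
  - exact: (subN Fr h).
  - exact: (subD Fr h k).
  - exact: (subM Fr h k).
  - exact: (Fd _ h).
suff E : rholds p (envR (scons a x) y) (envV (scons a x) z) <->
    rholds p (envR (scons a' x') y') (envV (scons a' x') z') by move/E.
(* Each entry of the extended environments is an old parameter or belongs to the leading term of a
   pair in [F], hence occurs in the matched sequences. The value oo of a vanishing term is found at
   [FZero]. *)
apply: (rholds_transfer T) => i; have [[k ->]|[k ->]] := env_cases i.
- have [_ [[/= e1 /= e2]|[g [g' [_ _ _ [j [j1 j2]]]]]]] := Fc _ (Ft (fterm_seq _ k)).
    by rewrite !envR_odd e1 e2 (ac0 hM) (ac0 hN); have [j] := rk0 rv; exists j.
  by exists j; rewrite !envR_odd j1 j2.
- by have [j] := hR k.*2; rewrite /envR !odd_double; exists j.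
- have [_ [[/= e1 /= e2]|[g [g' [e1 e2 [j [j1 j2]] _]]]]] := Fc _ (Ft (fterm_seq _ k)).
    have [k' kt] := fterm_seq_surj (FZero : fterm l).
    by have [j] := hV k'.*2.+1; rewrite !envV_odd kt e1 e2; exists j.
  by exists j; rewrite !envV_odd j1 j2; split; [exact: esym e1 | exact: esym e2].
by have [j] := hV k.*2; rewrite /envV !odd_double; exists j.
Qed.
End ExtendPoint.

(** * Definability of formulas and terms *)

Definition definable l m n (Q : forall M : structure, ('I_l -> fsort M) ->
    ('I_m -> option (rsort M)) -> ('I_n -> option (vsort M)) -> Prop) : Prop :=
  exists p, forall M, is_model M -> forall x y z, Q M x y z <-> rholds p (envR x y) (envV x z).

Lemma definable_exF l m n Q : @definable l.+1 m n Q ->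
  @definable l m n (fun M x y z => exists a, Q M (scons a x) y z).
Proof.
move=> [chi hchi]; pose Th (d : point l m n) := exists a,
  rholds chi (envR (scons a (ptx d)) (pty d)) (envV (scons a (ptx d)) (ptz d)).
suff [p hp] : exists p, forall d, Th d <-> pholds p d.
  exists p => M hM x y z; have := hp (Point hM x y z); rewrite /pholds /= => <-.
  by split=> -[a ha]; exists a; apply/(hchi _ hM).
apply: contrapT => no.
have [e he] := countable_enum (AtC 0 0 : rvf).
(* If no such pair existed for some [s], the formulas up to index [s] would decide [Th], and
   [separation] would define it. *)
have H s : exists dd : point l m n * point l m n,
    [/\ forall i, (i <= s)%N -> pholds (e i) dd.1 <-> pholds (e i) dd.2, Th dd.1 & ~ Th dd.2].
  apply: contrapT => nos; apply: no; apply: (separation (s := map e (iota 0 s.+1))) => d d' h Td.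
  apply: contrapT => nTd; apply: nos; exists (d, d'); split=> // i si; apply: h.
  by apply: map_f; rewrite mem_iota.
have {H} [P hP] := choice H.
pose SM i := pt (P i).1; pose SN i := pt (P i).2.
have hSM i : is_model (SM i) := pt_model (P i).1.
have hSN i : is_model (SN i) := pt_model (P i).2.
pose x i := ptx (P i).1; pose y i := pty (P i).1; pose z i := ptz (P i).1.
pose x' i := ptx (P i).2; pose y' i := pty (P i).2; pose z' i := ptz (P i).2.
have hT i : Th (P i).1 by have [] := hP i.
pose a i : fsort (SM i) := sval (cid (hT i)).
have ha i : rholds chi (envR (scons (a i) (x i)) (y i)) (envV (scons (a i) (x i)) (z i)).
  exact: svalP (cid (hT i)).
have st p : rholds p (envR (ultx x) (ulty y)) (envV (ultx x) (ultz z)) ->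
    rholds p (envR (ultx x') (ulty y')) (envV (ultx x') (ultz z')).
  move/ultra_los => h; apply/ultra_los; have [j ej] := he p.
  apply: (ae2 h (ae_ge j)) => i hi ji; have [/(_ j ji)] := hP i.
  by rewrite ej /pholds => k _ _; apply/k.
have [a' ha'] := same_type_extend (ultra_model hSM) hSN st (uF a).
have := ha' chi; rewrite ultx_scons ultra_los => /(_ (aeT ha)).
elim/uF_ind: a' {ha'} => a'; rewrite ultx_scons => /ultra_los /ae_ex [i hi].
by have [_ _ []] := hP i; exists (a' i).
Qed.

Section Definability.
Variables l m n : nat.

(** Graphs are used because atoms are flat: nested terms are unfolded through bound variables for
    their subterms. *)
Definition rdefinable (F : forall M : structure, ('I_l -> fsort M) ->
    ('I_m -> option (rsort M)) -> ('I_n -> option (vsort M)) -> option (rsort M)) : Prop :=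
  exists p, forall M, is_model M -> forall x y z a,
    rholds p (econs a (envR x y)) (envV x z) <-> a = F M x y z.

Definition vdefinable (F : forall M : structure, ('I_l -> fsort M) ->
    ('I_n -> option (vsort M)) -> option (vsort M)) : Prop :=
  exists p, forall M, is_model M -> forall x (y : 'I_m -> option (rsort M)) z a,
    rholds p (envR x y) (econs a (envV x z)) <-> a = F M x z.

Lemma definable_ext Q R : (forall M, is_model M -> forall x y z, Q M x y z <-> R M x y z) ->
  @definable l m n Q -> definable R.
Proof. by move=> e [p hp]; exists p => M hM x y z; rewrite -hp // e. Qed.

Lemma definable_not Q : @definable l m n Q -> @definable l m n (fun M x y z => ~ Q M x y z).
Proof. by move=> [p hp]; exists (RNeg p) => M hM x y z; rewrite /= hp. Qed.

Lemma definable_and Q R : @definable l m n Q -> definable R ->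
  @definable l m n (fun M x y z => Q M x y z /\ R M x y z).
Proof. by move=> [p hp] [q hq]; exists (RAnd p q) => M hM x y z; rewrite /= hp ?hq. Qed.

Let skip1 i := if i is j.+1 then j.+3 else 1%N.
Let skip2 i := if i is j.+1 then j.+3 else 0%N.
Let skip1E (A : Type) (a b : A) e : econs a (econs b e) \o skip1 = econs b (fun i => e i.+1).
Proof. by apply/funext => -[]. Qed.
Let skip2E (A : Type) (a b : A) e : econs a (econs b e) \o skip2 = econs a (fun i => e i.+1).
Proof. by apply/funext => -[]. Qed.

Lemma definable_rsat t F G : rdefinable F -> rdefinable G ->
  definable (fun M x y z => rsat t (F M x y z) (G M x y z) (G M x y z)).
Proof.
move=> [p hp] [q hq].
pose f i := if i is j.+1 then j.+2 else 1%N; pose g i := if i is j.+1 then j.+2 else 0%N.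
have fE (A : Type) (a b : A) e : econs a (econs b e) \o f = econs b e by apply/funext => -[].
have gE (A : Type) (a b : A) e : econs a (econs b e) \o g = econs a e by apply/funext => -[].
exists (RExR (RExR (RAnd (ren f id p) (RAnd (ren g id q) (AtR t 1 0 0))))) => M hM x y z.
rewrite !rholdsExR; split=> [h|[b [c]]].
  exists (F M x y z), (G M x y z); split; first by apply/rholds_ren; rewrite fE; apply/hp.
  by split=> //; apply/rholds_ren; rewrite gE; apply/hq.
case=> /rholds_ren; rewrite fE => /(hp _ hM) ->.
by case=> /rholds_ren; rewrite gE => /(hq _ hM) ->.
Qed.

Lemma definable_vsat t F G : vdefinable F -> vdefinable G ->
  definable (fun M x (y : 'I_m -> option (rsort M)) z => vsat t (F M x z) (G M x z) (G M x z)).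
Proof.
move=> [p hp] [q hq].
pose f i := if i is j.+1 then j.+2 else 1%N; pose g i := if i is j.+1 then j.+2 else 0%N.
have fE (A : Type) (a b : A) e : econs a (econs b e) \o f = econs b e by apply/funext => -[].
have gE (A : Type) (a b : A) e : econs a (econs b e) \o g = econs a e by apply/funext => -[].
exists (RExV (RExV (RAnd (ren id f p) (RAnd (ren id g q) (AtV t 1 0 0))))) => M hM x y z.
rewrite !rholdsExV; split=> [h|[b [c]]].
  exists (F M x z), (G M x z); split; first by apply/rholds_ren; rewrite fE; apply/hp.
  by split=> //; apply/rholds_ren; rewrite gE; apply/hq.
case=> /rholds_ren; rewrite fE => /(hp _ hM) ->.
by case=> /rholds_ren; rewrite gE => /(hq _ hM) ->.
Qed.

Lemma rdefinable_op (op : forall k : diffField, option k -> option k -> option k) t F G :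
  (forall k a b c, @rsat k t a b c <-> a = op k b c) -> rdefinable F -> rdefinable G ->
  rdefinable (fun M x y z => op _ (F M x y z) (G M x y z)).
Proof.
move=> ht [p hp] [q hq].
exists (RExR (RExR (RAnd (ren skip1 id p) (RAnd (ren skip2 id q) (AtR t 2 1 0))))) => M hM x y z a.
rewrite !rholdsExR; split=> [[b [c]]|->].
  case=> /rholds_ren; rewrite skip1E => /(hp _ hM) ->.
  by case=> /rholds_ren; rewrite skip2E => /(hq _ hM) -> /ht.
exists (F M x y z), (G M x y z); split; first by apply/rholds_ren; rewrite skip1E; apply/hp.
by split; [apply/rholds_ren; rewrite skip2E; apply/hq | apply/ht].
Qed.

Lemma vdefinable_op (op : forall G : porderZmodType, option G -> option G -> option G) t F G :
  (forall V a b c, @vsat V t a b c <-> a = op V b c) -> vdefinable F -> vdefinable G ->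
  vdefinable (fun M x z => op _ (F M x z) (G M x z)).
Proof.
move=> ht [p hp] [q hq].
exists (RExV (RExV (RAnd (ren id skip1 p) (RAnd (ren id skip2 q) (AtV t 2 1 0))))) => M hM x y z a.
rewrite !rholdsExV; split=> [[b [c]]|->].
  case=> /rholds_ren; rewrite skip1E => /(hp _ hM) ->.
  by case=> /rholds_ren; rewrite skip2E => /(hq _ hM) -> /ht.
exists (F M x z), (G M x z); split; first by apply/rholds_ren; rewrite skip1E; apply/hp.
by split; [apply/rholds_ren; rewrite skip2E; apply/hq | apply/ht].
Qed.

Lemma rdefinable_cmap F : vdefinable F -> rdefinable (fun M x y z => omap cmap (F M x z)).
Proof.
move=> [p hp]; exists (RExV (RAnd (ren S id p) (AtC 0 0))) => M hM x y z a.
rewrite rholdsExV; split=> [[b]|->].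
  by case=> /rholds_ren /(hp _ hM) ->.
by exists (F M x z); split=> //; apply/rholds_ren/hp.
Qed.

Lemma vdefinable_term (t : vterm l n) : vdefinable (fun M x z => veval x z t).
Proof.
elim: t => [i| |t ht|t ht u hu|t] /=.
- by exists (AtV 0 0 (i.*2).+1 0) => M hM x y z a; rewrite /= envV_even.
- by exists (AtV 1 0 0 0).
- exact: (@vdefinable_op (fun V a _ => omap -%R a) 2 _ _ _ ht ht).
- exact: (@vdefinable_op (fun V : porderZmodType => @oadd V) 3 _ _ _ ht hu).
have [k kt] := fterm_seq_surj t.
by exists (AtV 0 0 (k.*2.+1).+1 0) => M hM x y z a; rewrite /= envV_odd kt.
Qed.

(** The residue is [ac] at value 0, it is 0 at positive value and oo at negative value. No atom
    names oo; it is the only solution of [a = a + a] other than 0. The bound variable holds the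
    value 0 for comparison. *)
Lemma rdefinable_residue (t : fterm l) : rdefinable (fun M x y z => residue (feval x t)).
Proof.
have [k kt] := fterm_seq_surj t; pose w := k.*2.+1.
exists (RExV (RAnd (AtV 1 0 0 0) (ROr (RAnd (AtV 0 0 w.+1 0) (AtR 0 0 w.+1 0))
  (ROr (RAnd (RNeg (AtV 0 0 w.+1 0)) (RAnd (AtV 4 0 w.+1 0) (AtR 1 0 0 0)))
       (RAnd (RNeg (AtV 4 0 w.+1 0)) (RAnd (AtR 4 0 0 0) (RNeg (AtR 1 0 0 0)))))))).
move=> M hM x y z a; rewrite rholdsExV; set e := feval x t.
set P := RAnd _ _.
have E b : rholds P (econs a (envR x y)) (econs b (envV x z)) <-> b = Some 0 /\
    ((b = valuation e /\ a = Some (ac e)) \/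
     (b <> valuation e /\ ole b (valuation e) /\ a = Some 0) \/
     (~ ole b (valuation e) /\ a = oadd a a /\ a <> Some 0)).
  by rewrite /P rholdsAnd !rholds_or /= envR_odd envV_odd kt.
have {E}-> : (exists b, rholds P (econs a (envR x y)) (econs b (envV x z))) <->
   [\/ Some 0 = valuation e /\ a = Some (ac e),
       [/\ Some 0 <> valuation e, ole (Some 0) (valuation e) & a = Some 0] |
       [/\ ~ ole (Some 0) (valuation e), a = oadd a a & a <> Some 0]].
  split=> [[b] /E[->]|h].
    by case=> [?|[[? [? ?]]|[? [? ?]]]]; [apply: Or31|apply: Or32|apply: Or33].
  exists (Some 0); apply/E; split=> //.
  by case: h => [?|[? ? ?]|[? ? ?]]; [left|right; left|right; right].
clear P.
have vle : ole (Some 0) (valuation e) = dle e 1 by rewrite -in_OE.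
have [e1|e1] := boolP (dle e 1); last first.
  rewrite residueN // vle (negbTE e1); split=> [|->]; last by apply: Or33.
  case=> [[v0 _]|[] //|[_ aa a0]]; first by rewrite -vle -v0 /ole lexx in e1.
  case: a aa a0 => [a|] // /Some_inj aa; case; congr Some.
  by apply: (addrI a); rewrite addr0.
rewrite vle e1 residueE //.
have [v0|v0] := pselect (Some 0 = valuation e).
  rewrite -(ac_res hM) //; last by apply/deqE => //; rewrite -v0 val1.
  split=> [|->]; last by apply: Or31.
  by case=> [[_ ->]|[]|[]].
have e0 : dlt e 1.
  rewrite dltNge; apply/negP => h; apply: v0; rewrite -(val1 hM); apply/deqE => //.
  by rewrite /deq h e1.
rewrite res_small //; split=> [|->]; last by apply: Or32.
by case=> [[]|[]|[]].
Qed.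

Lemma rdefinable_term (t : rterm l m n) : rdefinable (fun M x y z => reval x y z t).
Proof.
elim: t => [i| | |t ht|t ht u hu|t ht u hu|t ht|t|t|t] /=.
- by exists (AtR 0 0 (i.*2).+1 0) => M hM x y z a; rewrite /= envR_even.
- by exists (AtR 1 0 0 0).
- by exists (AtR 2 0 0 0).
- exact: (@rdefinable_op (fun k a _ => omap -%R a) 3 _ _ _ ht ht).
- exact: (@rdefinable_op (fun k : diffField => @oadd k) 4 _ _ _ ht hu).
- exact: (@rdefinable_op (fun k : diffField => @omul k) 5 _ _ _ ht hu).
- exact: (@rdefinable_op (fun k a _ => omap der a) 6 _ _ _ ht ht).
- exact: rdefinable_residue.
- exact/rdefinable_cmap/vdefinable_term.
have [k kt] := fterm_seq_surj t.
by exists (AtR 0 0 (k.*2.+1).+1 0) => M hM x y z a; rewrite /= envR_odd kt.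
Qed.

Lemma definable_exR Q : @definable l m.+1 n Q ->
  @definable l m n (fun M x y z => exists a, Q M x (scons a y) z).
Proof.
move=> [p hp]; exists (RExR (ren shift_env id p)) => M hM x y z; rewrite rholdsExR.
by split=> -[a ha]; exists a; move: ha; rewrite rholds_ren hp // envR_scons.
Qed.

Lemma definable_exV Q : @definable l m n.+1 Q ->
  @definable l m n (fun M x y z => exists a, Q M x y (scons a z)).
Proof.
move=> [p hp]; exists (RExV (ren id shift_env p)) => M hM x y z; rewrite rholdsExV.
by split=> -[a ha]; exists a; move: ha; rewrite rholds_ren hp // envV_scons.
Qed.
End Definability.

Lemma forall_notexists (T : Type) (P : T -> Prop) : ~ (exists a, ~ P a) <-> (forall a, P a).
Proof. by split=> [h a|h [a]] //; apply: contrapT => na; apply: h; exists a. Qed.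

Theorem definable_formula l m n (theta : formula l m n) :
  definable (fun M x y z => holds theta x y z).
Proof.
elim: {l m n} theta => [l m n|l m n|l m n t u|l m n t u|l m n t u|l m n t u|l m n p hp|
  l m n p hp q hq|l m n p hp q hq|l m n p hp|l m n p hp|l m n p hp|l m n p hp|l m n p hp|l m n p hp] /=.
- by exists RTop => M hM x y z; split=> // _; exact: rholds_top.
- by exists RBot => M hM x y z; split=> // h; apply: h; exact: (rholds_top _ (envV x z)).
(* Equality of field terms is the vanishing of the angular component of their difference. *)
- have [k kt] := fterm_seq_surj (FAdd t (FOpp u)).
  exists (AtR 1 k.*2.+1 0 0) => M hM x y z; rewrite /= envR_odd kt /=.
  split=> [->|/Some_inj /eqP]; first by rewrite subrr ac0.
  by rewrite ac_eq0 // subr_eq0 => /eqP.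
- by apply: (@definable_rsat _ _ _ 0); apply: rdefinable_term.
- by apply: (@definable_vsat _ _ _ 0); apply: vdefinable_term.
- by apply: (@definable_vsat _ _ _ 4); apply: vdefinable_term.
- exact: definable_not.
- exact: definable_and.
- apply: (definable_ext _ (definable_not (definable_and (definable_not hp) (definable_not hq)))).
  move=> M hM x y z; split=> [h|[h|h] []] //.
  by have [k|k] := pselect (holds p x y z); [left|right; apply: contrapT => k'; apply: h].
- exact: (definable_exF hp).
- exact: (definable_exR hp).
- exact: (definable_exV hp).
- apply: (definable_ext _ (definable_not (definable_exF (definable_not hp)))) => M hM x y z.
  exact: (forall_notexists (fun a => holds p (scons a x) y z)).
- apply: (definable_ext _ (definable_not (definable_exR (definable_not hp)))) => M hM x y z.
  exact: (forall_notexists (fun a => holds p x (scons a y) z)).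
apply: (definable_ext _ (definable_not (definable_exV (definable_not hp)))) => M hM x y z.
exact: (forall_notexists (fun a => holds p x y (scons a z))).
Qed.

(** * Special formulas *)

Section DiffPolyTerms.
Variable l : nat.
Local Notation ifun := (forall M : structure, ('I_l -> fsort M) -> fsort M).

Definition mon_eval (M : structure) (x : 'I_l -> fsort M) (m : {cmonom ('I_l * nat)%type}) : fsort M :=
  \prod_(ij <- finsupp m) iter ij.2 der (x ij.1) ^+ m ij.

Lemma mon_evalE (M : structure) (x : 'I_l -> fsort M) (m : {cmonom ('I_l * nat)%type}) (D : {fset ('I_l * nat)%type}) :
  (finsupp m `<=` D)%fset -> mon_eval x m = \prod_(ij <- D) iter ij.2 der (x ij.1) ^+ m ij.
Proof.
move=> h; rewrite /mon_eval (big_fset_incl _ h) //= => ij _.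
by rewrite -monalg.cmE_neq0 negbK => /eqP ->; rewrite expr0.
Qed.

Lemma mon_evalM (M : structure) (x : 'I_l -> fsort M) m1 m2 :
  mon_eval x (mmul m1 m2) = mon_eval x m1 * mon_eval x m2.
Proof.
pose D := (finsupp m1 `|` finsupp m2 `|` finsupp (mmul m1 m2))%fset.
rewrite !(@mon_evalE _ _ _ D) ?fsubsetUr //.
- by rewrite -big_split; apply: eq_bigr => ij _; rewrite monalg.cmM exprD.
- by rewrite /D -fsetUA fsetUC -fsetUA fsubsetUl.
by rewrite /D -fsetUA fsubsetUl.
Qed.

(** One integral polynomial has to serve in all structures at once. *)
Definition dpolyfun (f : ifun) : Prop :=
  exists P : dpoly int 'I_l, forall M x, dpoly_eval intr P x = f M x.

Lemma dpolyfun_ext (f g : ifun) : (forall M x, f M x = g M x) -> dpolyfun f -> dpolyfun g.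
Proof. by move=> e [P hP]; exists P => M x; rewrite hP. Qed.

Lemma dpolyfunD f g : dpolyfun f -> dpolyfun g -> dpolyfun (fun M x => f M x + g M x).
Proof.
move=> [P hP] [Q hQ]; exists (P + Q) => M x; rewrite -hP -hQ.
exact: (raddfD (monalg.mmap (intr : {additive int -> fsort M}) _)).
Qed.

Lemma dpolyfunM f g : dpolyfun f -> dpolyfun g -> dpolyfun (fun M x => f M x * g M x).
Proof.
move=> [P hP] [Q hQ]; exists (P * Q) => M x; rewrite -hP -hQ.
rewrite -[LHS]/(monalg.mmap (intr : {additive int -> fsort M}) (mon_eval x) (P * Q)).
rewrite malgME raddf_sum mulr_suml /=; apply: eq_bigr => i _.
rewrite raddf_sum mulr_sumr /=; apply: eq_bigr => j _.
rewrite (@monalg.mmapU _ _ _ (intr : {additive int -> fsort M})) /= rmorphM mon_evalM.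
by rewrite mulrACA.
Qed.

Lemma dpolyfun_int (a : int) : dpolyfun (fun M x => a%:~R).
Proof.
exists (mkmalgU mone a) => M x.
rewrite -[LHS]/(monalg.mmap (intr : {additive int -> fsort M}) (mon_eval x) _).
rewrite (@monalg.mmapU _ _ _ (intr : {additive int -> fsort M})).
rewrite (@mon_evalE _ _ _ fset0) ?big_seq_fset0 ?mulr1 //.
by apply/fsubsetP => ij; rewrite -monalg.cmE_neq0 monalg.cm1 eqxx.
Qed.

Lemma dpolyfun_var (i : 'I_l) j : dpolyfun (fun M x => iter j der (x i)).
Proof.
exists (mkmalgU (ucm (i, j)) 1) => M x.
rewrite -[LHS]/(monalg.mmap (intr : {additive int -> fsort M}) (mon_eval x) _).
rewrite (@monalg.mmapU _ _ _ (intr : {additive int -> fsort M})) mul1r.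
rewrite (@mon_evalE _ _ _ [fset (i, j)]%fset) ?big_seq_fset1 ?monalg.cmU ?eqxx //.
by apply/fsubsetP => ij; rewrite -monalg.cmE_neq0 monalg.cmU in_fset1; case: ((i, j) =P ij) => [<-|].
Qed.

(** A function and its derivative are followed together, so that the sum and product rules propagate
    the property from constants and variables to all differential polynomials. *)
Let der_closed (f : ifun) := dpolyfun f /\ dpolyfun (fun M x => der (f M x)).

Let der_closed_int a : der_closed (fun M x => a%:~R).
Proof.
split; first exact: dpolyfun_int.
apply: (dpolyfun_ext _ (dpolyfun_int 0)) => M x.
have natE k : der (k%:R : fsort M) = 0.
  by elim: k => [|k IH]; rewrite ?mulr0n ?der0 // mulrS derD der1 IH addr0.
by case: a => k; rewrite ?NegzE ?mulrNz ?derN -?pmulrn natE ?oppr0.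
Qed.

Let der_closedM f g : der_closed f -> der_closed g -> der_closed (fun M x => f M x * g M x).
Proof.
move=> [hf hf'] [hg hg']; split; first exact: dpolyfunM.
apply: (dpolyfun_ext (fun M x => esym (derM _ _))).
by apply: dpolyfunD; apply: dpolyfunM.
Qed.

Let der_closedD f g : der_closed f -> der_closed g -> der_closed (fun M x => f M x + g M x).
Proof.
move=> [hf hf'] [hg hg']; split; first exact: dpolyfunD.
by apply: (dpolyfun_ext (fun M x => esym (derD _ _))); apply: dpolyfunD.
Qed.

Let der_closed_ext (f g : ifun) : (forall M x, f M x = g M x) -> der_closed f -> der_closed g.
Proof.
by move=> e [h k]; split; [apply: dpolyfun_ext h|apply: dpolyfun_ext k] => M x; rewrite e.
Qed.

Lemma dpolyfun_der f : dpolyfun f -> dpolyfun (fun M x => der (f M x)).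
Proof.
move=> [P hP]; suff [_] : der_closed (fun M x => dpoly_eval intr P x).
  by apply: dpolyfun_ext => M x; rewrite hP.
rewrite /dpoly_eval /monalg.mmap; elim: (monalg.msupp P : seq _) => [|m s IH].
  by apply: (der_closed_ext _ (der_closed_int 0)) => M x; rewrite big_nil.
apply: (der_closed_ext (fun M x => esym (big_cons _ _ _ _ _ _))).
apply: der_closedD IH; apply: der_closedM; first exact: der_closed_int.
elim: (finsupp m : seq _) => [|ij r IH].
  by apply: (der_closed_ext _ (der_closed_int 1)) => M x; rewrite big_nil.
apply: (der_closed_ext (fun M x => esym (big_cons _ _ _ _ _ _))).
apply: der_closedM IH; elim: (m ij) => [|k IH].
  by apply: (der_closed_ext _ (der_closed_int 1)) => M x; rewrite expr0.
apply: (der_closed_ext (fun M x => esym (exprS _ _))).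
apply: der_closedM IH; split; first exact: dpolyfun_var.
exact: (dpolyfun_var ij.1 ij.2.+1).
Qed.

Lemma dpolyfun_term (t : fterm l) : dpolyfun (fun M x => feval x t).
Proof.
elim: t => [i| | |t ht|t ht u hu|t ht u hu|t ht] /=.
- exact: (dpolyfun_var i 0).
- exact: (dpolyfun_int 0).
- exact: (dpolyfun_int 1).
- apply: (dpolyfun_ext _ (dpolyfunM (dpolyfun_int (-1)) ht)) => M x.
  by rewrite mulrN1z mulN1r.
- exact: dpolyfunD.
- exact: dpolyfunM.
exact: dpolyfun_der.
Qed.
End DiffPolyTerms.

(** * Substitution and the translation into special formulas *)

Section Substitution.
Variable M : structure.

Lemma feval_subst l l' (x : 'I_l' -> fsort M) (sf : 'I_l -> fterm l') t :
  feval x (fsubst sf t) = feval (fun i => feval x (sf i)) t.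
Proof. by elim: t => //= [t ->|t -> u ->|t -> u ->|t ->]. Qed.

Lemma veval_subst l l' n n' (x : 'I_l' -> fsort M) z (sf : 'I_l -> fterm l')
    (sv : 'I_n -> vterm l' n') t :
  veval x z (vsubst sf sv t) = veval (fun i => feval x (sf i)) (fun i => veval x z (sv i)) t.
Proof. by elim: t => //= [t ->|t -> u ->|t] //; rewrite feval_subst. Qed.

Lemma reval_subst l l' m m' n n' (x : 'I_l' -> fsort M) y z (sf : 'I_l -> fterm l')
    (sr : 'I_m -> rterm l' m' n') (sv : 'I_n -> vterm l' n') t :
  reval x y z (rsubst sf sr sv t) =
  reval (fun i => feval x (sf i)) (fun i => reval x y z (sr i)) (fun i => veval x z (sv i)) t.
Proof.
by elim: t => //= [t ->|t -> u ->|t -> u ->|t ->|t|t|t] //; rewrite ?feval_subst ?veval_subst.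
Qed.

Lemma scons0 (A : Type) n (a : A) (e : 'I_n -> A) : scons a e ord0 = a.
Proof. by rewrite /scons unlift_none. Qed.
Lemma scons_lift (A : Type) n (a : A) (e : 'I_n -> A) i : scons a e (lift ord0 i) = e i.
Proof. by rewrite /scons liftK. Qed.

Lemma reval_shiftR l m n (x : 'I_l -> fsort M) y z a (t : rterm l m n) :
  reval x (scons a y) z (rshiftR t) = reval x y z t.
Proof. by rewrite reval_subst /=; congr reval; apply/funext => i; rewrite /= scons_lift. Qed.
Lemma reval_shiftV l m n (x : 'I_l -> fsort M) y z a (t : rterm l m n) :
  reval x y (scons a z) (rshiftV t) = reval x y z t.
Proof. by rewrite reval_subst /=; congr reval; apply/funext => i; rewrite /= scons_lift. Qed.
Lemma veval_shiftV l n (x : 'I_l -> fsort M) z a (t : vterm l n) :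
  veval x (scons a z) (vshiftV t) = veval x z t.
Proof. by rewrite veval_subst /=; congr veval; apply/funext => i; rewrite /= scons_lift. Qed.

Lemma reval_sconsR l m k n (x : 'I_l -> fsort M) y z a (sr : 'I_k -> rterm l m n) :
  (fun i => reval x (scons a y) z (scons (RVar ord0) (fun i => rshiftR (sr i)) i)) =
  scons a (fun i => reval x y z (sr i)).
Proof.
apply/funext => i; case: (unliftP ord0 i) => [j|] ->; rewrite ?scons_lift ?scons0 /= ?scons0 //.
exact: reval_shiftR.
Qed.
Lemma veval_sconsV l k n (x : 'I_l -> fsort M) z a (sv : 'I_k -> vterm l n) :
  (fun i => veval x (scons a z) (scons (VVar ord0) (fun i => vshiftV (sv i)) i)) =
  scons a (fun i => veval x z (sv i)).
Proof.
apply/funext => i; case: (unliftP ord0 i) => [j|] ->; rewrite ?scons_lift ?scons0 /= ?scons0 //.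
exact: veval_shiftV.
Qed.
Lemma reval_econsR l m n (x : 'I_l -> fsort M) y z a (sr : nat -> rterm l m n) :
  (fun i => reval x (scons a y) z (econs (RVar ord0) (fun i => rshiftR (sr i)) i)) =
  econs a (fun i => reval x y z (sr i)).
Proof. by apply/funext => -[|i] /=; [exact: scons0 | exact: reval_shiftR]. Qed.
Lemma veval_econsV l n (x : 'I_l -> fsort M) z a (sv : nat -> vterm l n) :
  (fun i => veval x (scons a z) (econs (VVar ord0) (fun i => vshiftV (sv i)) i)) =
  econs a (fun i => veval x z (sv i)).
Proof. by apply/funext => -[|i] /=; [exact: scons0 | exact: veval_shiftV]. Qed.
Lemma reval_shiftV_fun (I : Type) l m n (x : 'I_l -> fsort M) y z a (sr : I -> rterm l m n) :
  (fun i => reval x y (scons a z) (rshiftV (sr i))) = (fun i => reval x y z (sr i)).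
Proof. by apply/funext => i; exact: reval_shiftV. Qed.

Lemma holds_subst l m n (phi : formula l m n) l' m' n' (x : 'I_l' -> fsort M) y z (sf : 'I_l -> fterm l')
    (sr : 'I_m -> rterm l' m' n') (sv : 'I_n -> vterm l' n') : formula_rv phi ->
  holds (subst phi sf sr sv) x y z <->
  holds phi (fun i => feval x (sf i)) (fun i => reval x y z (sr i)) (fun i => veval x z (sv i)).
Proof.
elim: {l m n} phi l' m' n' x y z sf sr sv => [l m n|l m n|l m n t u|l m n t u|l m n t u|l m n t u|
  l m n p hp|l m n p hp q hq|l m n p hp q hq|l m n p hp|l m n p hp|l m n p hp|
  l m n p hp|l m n p hp|l m n p hp] l' m' n' x y z sf sr sv //= rv.
- by rewrite !reval_subst.
- by rewrite !veval_subst.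
- by rewrite !veval_subst.
- by rewrite hp.
- by case/andP: rv => rp rq; rewrite hp ?hq.
- by case/andP: rv => rp rq; rewrite hp ?hq.
- by split=> -[a h]; exists a; move: h; rewrite hp // reval_sconsR.
- by split=> -[a h]; exists a; move: h; rewrite hp // veval_sconsV reval_shiftV_fun.
- by split=> h a; move: (h a); rewrite hp // reval_sconsR.
by split=> h a; move: (h a); rewrite hp // veval_sconsV reval_shiftV_fun.
Qed.
End Substitution.

Fixpoint rvf_formula (p : rvf) l m n (fR : nat -> rterm l m n) (fV : nat -> vterm l n) :
    formula l m n :=
  match p with
  | AtR 0 i j _ => EqR (fR i) (fR j)
  | AtR 1 i _ _ => EqR (fR i) RZero
  | AtR 2 i _ _ => EqR (fR i) ROne
  | AtR 3 i j _ => EqR (fR i) (ROpp (fR j))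
  | AtR 4 i j k => EqR (fR i) (RAdd (fR j) (fR k))
  | AtR 5 i j k => EqR (fR i) (RMul (fR j) (fR k))
  | AtR _ i j _ => EqR (fR i) (RDer (fR j))
  | AtV 0 i j _ => EqV m (fV i) (fV j)
  | AtV 1 i _ _ => EqV m (fV i) VZero
  | AtV 2 i j _ => EqV m (fV i) (VOpp (fV j))
  | AtV 3 i j k => EqV m (fV i) (VAdd (fV j) (fV k))
  | AtV _ i j _ => LeV m (fV i) (fV j)
  | AtC i j => EqR (fR i) (RCmap (fV j))
  | RNeg p => Neg (rvf_formula p fR fV)
  | RAnd p q => And (rvf_formula p fR fV) (rvf_formula q fR fV)
  | RExR p => ExR (rvf_formula p (econs (RVar ord0) (fun i => rshiftR (fR i))) fV)
  | RExV p => ExV (rvf_formula p (fun i => rshiftV (fR i)) (econs (VVar ord0) (fun i => vshiftV (fV i))))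
  end.

Lemma holds_rvf_formula (M : structure) p l m n (fR : nat -> rterm l m n) fV
    (x : 'I_l -> fsort M) y z :
  holds (rvf_formula p fR fV) x y z <->
  rholds p (fun i => reval x y z (fR i)) (fun i => veval x z (fV i)).
Proof.
elim: p m n fR fV y z => [t i j k|t i j k|i j|p hp|p hp q hq|p hp|p hp] m n fR fV y z.
- by case: t => [|[|[|[|[|[|t]]]]]].
- by case: t => [|[|[|[|t]]]].
- by [].
- by rewrite /= hp.
- by rewrite /= hp hq.
- by rewrite rholdsExR /=; split=> -[a h]; exists a; move: h; rewrite hp reval_econsR.
by rewrite rholdsExV /=; split=> -[a h]; exists a; move: h; rewrite hp veval_econsV reval_shiftV_fun.
Qed.

Lemma vterm_rv_subst l n l' n' (sf : 'I_l -> fterm l') (sv : 'I_n -> vterm l' n') t :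
  (forall i, vterm_rv (sv i)) -> vterm_rv t -> vterm_rv (vsubst sf sv t).
Proof. by move=> h; elim: t => //= t ht u hu /andP[/ht -> /hu ->]. Qed.

Lemma rterm_rv_subst l m n l' m' n' (sf : 'I_l -> fterm l') (sr : 'I_m -> rterm l' m' n')
    (sv : 'I_n -> vterm l' n') t :
  (forall i, rterm_rv (sr i)) -> (forall i, vterm_rv (sv i)) -> rterm_rv t ->
  rterm_rv (rsubst sf sr sv t).
Proof.
move=> h k; elim: t => //= [t ht u hu /andP[/ht -> /hu ->]|t ht u hu /andP[/ht -> /hu ->]|t] //.
exact: vterm_rv_subst.
Qed.

Lemma rvf_formula_rv p l m n (fR : nat -> rterm l m n) fV :
  (forall i, rterm_rv (fR i)) -> (forall i, vterm_rv (fV i)) -> formula_rv (rvf_formula p fR fV).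
Proof.
elim: p m n fR fV => [t i j k|t i j k|i j|p hp|p hp q hq|p hp|p hp] m n fR fV h k'.
- by case: t => [|[|[|[|[|[|t]]]]]] /=; rewrite !h.
- by case: t => [|[|[|[|t]]]] /=; rewrite !k'.
- by rewrite /= h k'.
- exact: hp.
- by rewrite /= hp ?hq.
- by apply: hp => // -[|i] //=; apply: rterm_rv_subst.
apply: hp => [i|[|i]] //=; first exact: rterm_rv_subst.
exact: vterm_rv_subst.
Qed.

Theorem theorem5p4 (l m n : nat) (theta : formula l m n) :
  exists theta_star : formula l m n,
    special theta_star /\ T_equivalent theta theta_star.
Proof.
(* Only the first [B] of the enumerated terms can matter in [chi]; they give the polynomials of the
   special formula. *)
have [chi hchi] := definable_formula theta; have [B hB] := rholds_bound chi.
have [P hP] := choice (fun k => dpolyfun_term (fterm_seq l k)).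
(* the v-variable [inf] will be instantiated by v(0) = oo *)
pose inf : vterm 0 (B.+1 + n) := VVar (lshift n ord0).
(* Indices outside the tuples stand for oo, obtained in the residue sort as the image of [inf] under
   c. *)
pose fR i : rterm 0 (B + m) (B.+1 + n) :=
  if odd i then (if insub i./2 is Some j then RVar (lshift m j) else RCmap inf)
  else if insub i./2 is Some j then RVar (rshift B j) else RCmap inf.
pose fV i : vterm 0 (B.+1 + n) :=
  if odd i then (if insub i./2 is Some j then VVar (lshift n (lift ord0 j)) else inf)
  else if insub i./2 is Some j then VVar (rshift B.+1 j) else inf.
pose psi := rvf_formula chi fR fV.
have psi_rv : formula_rv psi.
  apply: rvf_formula_rv => i; rewrite /fR /fV.
    by case: (odd i); case: insub.
  by case: (odd i); case: insub.
(* The zero polynomial at index 0 provides the valuation that instantiates [inf]; hence [B.+1]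
   polynomials here against [B] under [ac]. *)
pose Q : 'I_B.+1 -> dpoly int 'I_l := scons 0 (fun j : 'I_B => P j).
eexists; split; first by exists B, B.+1, psi, (fun j : 'I_B => P j), Q; split.
move=> M hM x y z; rewrite hchi // holds_subst // holds_rvf_formula.
have half_lt i : (i < B)%N -> (i./2 < B)%N.
  by apply: leq_ltn_trans; rewrite -{2}(odd_double_half i) -addnn addnA leq_addl.
apply: hB => i /half_lt iB.
- rewrite /envR /fR; case: (odd i).
    by rewrite insubT /= (unsplitK (inl _)) /= feval_dpoly hP.
  case: insub => [j|] /=; first by rewrite (unsplitK (inr _)).
  by rewrite (unsplitK (inl _)) /= feval_dpoly /Q scons0 /dpoly_eval monalg.mmap0 val0.
rewrite /envV /fV; case: (odd i).
  by rewrite insubT /= (unsplitK (inl _)) /= feval_dpoly /Q scons_lift hP.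
case: insub => [j|] /=; first by rewrite (unsplitK (inr _)).
by rewrite (unsplitK (inl _)) /= feval_dpoly /Q scons0 /dpoly_eval monalg.mmap0 val0.
Qed.
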